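(* Let $N>2$ be an even integer, let $X$ be the pseudo-process associated with $\partial u/\partial t=\kappa_N\,\partial^N u/\partial x^N$, and let $M(t)=\max_{0\le s\le t}X(s)$, $m(t)=\min_{0\le s\le t}X(s)$. Let $\Re(\lambda)>0$ and put $$\varphi_\lambda(\xi)=\sqrt[N]{\lambda}\sum_{j\in J}\theta_jA_j\,e^{\theta_j\sqrt[N]{\lambda}\,\xi},\qquad \psi_\lambda(\xi)=-\sqrt[N]{\lambda}\sum_{k\in K}\theta_kB_k\,e^{\theta_k\sqrt[N]{\lambda}\,\xi}.$$ Then the Laplace transforms with respect to $t$ of the joint densities of $(X(t),M(t))$ and of $(X(t),m(t))$ are given, for $z\ge x\vee y$, by $$\int_0^{+\infty}e^{-\lambda t}\,dt\,\mathbb{P}_x\{X(t)\in dy,M(t)\in dz\}/dy\,dz=\frac1\lambda\,\varphi_\lambda(x-z)\,\psi_\lambda(z-y),$$ and, for $z\le x\wedge y$, by $$\int_0^{+\infty}e^{-\lambda t}\,dt\,\mathbb{P}_x\{X(t)\in dy,m(t)\in dz\}/dy\,dz=\frac1\lambda\,\psi_\lambda(x-z)\,\varphi_\lambda(z-y).$$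
   Context: Notation. $\kappa_N=(-1)^{1+N/2}$; $\theta_l=e^{i(2l+N/2+1)\pi/N}$, $0\le l\le N-1$, are the $N$th roots of $\kappa_N$; $J=\{l:\Re\theta_l>0\}$, $K=\{l:\Re\theta_l<0\}$; $A_j=\prod_{l\in J\setminus\{j\}}\frac{\theta_l}{\theta_l-\theta_j}$ for $j\in J$, $B_k=\prod_{l\in K\setminus\{k\}}\frac{\theta_l}{\theta_l-\theta_k}$ for $k\in K$; $\sqrt[N]{\lambda}$ is the principal root. Kernel. $p(t;\xi)=\frac1{2\pi}\int_{-\infty}^{+\infty}e^{-i\xi u+\kappa_N t(-iu)^N}\,du$ ($t>0$) is the fundamental solution of $\partial u/\partial t=\kappa_N\partial^N u/\partial x^N$; $\int p(t;\xi)\,d\xi=1$, $\int|p(t;\xi)|\,d\xi<\infty$. Pseudo-process. $X$ is governed by signed measures $\mathbb{P}_x$ with expectations $\mathbb{E}_x$: for $0=t_0<t_1<\dots<t_k$, $x_0=x$, and bounded Borel $F$, $\mathbb{E}_x[F(X(t_1),\dots,X(t_k))]=\int_{\mathbb{R}^k}F(x_1,\dots,x_k)\prod_{i=1}^k p(t_i-t_{i-1};x_{i-1}-x_i)\,dx_1\cdots dx_k$, and $X(0)=x$ under $\mathbb{P}_x$. With $t_{n,k}=k/2^n$, $X_{n,k}=X(t_{n,k})$, $M_{n,k}=\max_{0\le j\le k}X_{n,j}$, $m_{n,k}=\min_{0\le j\le k}X_{n,j}$, one defines $$\mathbb{E}_x\Big[\int_0^{\infty}e^{-\lambda t+i\mu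 X(t)-\nu M(t)}dt\Big]=\lim_{n\to\infty}\frac{1-e^{-\lambda/2^n}}{\lambda}\sum_{k=0}^\infty e^{-\lambda t_{n,k}}\,\mathbb{E}_x\big[e^{i\mu X_{n,k}-\nu M_{n,k}}\big]$$ for $\Re(\lambda)>0,\mu\in\mathbb{R},\nu>0$, and similarly with $-\nu M$ replaced by $+\nu m$. Densities. $\int_0^{\infty}e^{-\lambda t}dt\,\mathbb{P}_x\{X(t)\in dy,M(t)\in dz\}/dy\,dz$ denotes the function $h_\lambda(y,z)$, supported on $\{z\ge x\vee y\}$, such that $\iint e^{i\mu y-\nu z}h_\lambda(y,z)\,dy\,dz=\mathbb{E}_x\big[\int_0^\infty e^{-\lambda t+i\mu X(t)-\nu M(t)}dt\big]$ for all $\mu\in\mathbb{R}$, $\nu>0$. Likewise the density for $(X(t),m(t))$ is the function supported on $\{z\le x\wedge y\}$ whose integral against $e^{i\mu y+\nu z}$ equals $\mathbb{E}_x\big[\int_0^\infty e^{-\lambda t+i\mu X(t)+\nu m(t)}dt\big]$. *)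

(* Defs.v *)
From HB Require Import structures.
From mathcomp Require Import all_boot all_order all_algebra.
From mathcomp Require Import all_classical all_reals all_analysis.
From mathcomp Require Import complex.

Set Implicit Arguments.
Unset Strict Implicit.
Unset Printing Implicit Defensive.

Import Order.TTheory GRing.Theory Num.Theory.
Import numFieldNormedType.Exports.

Local Open Scope classical_set_scope.
Local Open Scope ring_scope.
Local Open Scope complex_scope.

Section ComplexAnalysis.
Variable R : realType.
Implicit Types z : R[i].

Definition cexp z : R[i] :=
  (expR (complex.Re z))%:C * (cos (complex.Im z) +i* sin (complex.Im z)).

(* The argument in ]-pi, pi]; the value at 0 is irrelevant. *)
Definition Arg z : R :=
  let a := acos (complex.Re z / ComplexField.Normc.normc z) in
  if 0 <= complex.Im z then a else - a.

(* This is not [n.-root] of numClosedFieldType, whose branch has a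
   nonnegative argument. *)
Definition principal_root (n : nat) z : R[i] :=
  (ComplexField.Normc.normc z `^ n%:R^-1)%:C * cexp ('i * (Arg z / n%:R)%:C).

(* R[i]^o carries the usual topology of the complex plane. *)
Definition ccvg (u : nat -> R[i]) (l : R[i]) : Prop :=
  (u : nat -> R[i]^o) @ \oo --> (l : R[i]^o).

Definition cseries_to (u : nat -> R[i]) (l : R[i]) : Prop :=
  ccvg (fun n => \sum_(0 <= k < n) u k) l.

Definition cintegrable d (T : measurableType d)
    (mu : {measure set T -> \bar R}) (f : T -> R[i]) : Prop :=
  mu.-integrable setT (EFin \o (fun t => complex.Re (f t))) /\
  mu.-integrable setT (EFin \o (fun t => complex.Im (f t))).

Definition cintegral d (T : measurableType d)
    (mu : {measure set T -> \bar R}) (f : T -> R[i]) : R[i] :=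
  (\int[mu]_t complex.Re (f t))%R +i* (\int[mu]_t complex.Im (f t))%R.

End ComplexAnalysis.

Section LebesgueTuple.
Variable R : realType.
Notation RT := (measurableTypeR R).

Definition cons_pair k (q : RT * k.-tuple RT) : k.+1.-tuple RT :=
  [tuple of q.1 :: q.2].

Lemma measurable_cons_pair k : measurable_fun setT (@cons_pair k).
Proof.
exact: (measurable_cons (@measurable_fst _ _ _ _) (@measurable_snd _ _ _ _)).
Qed.

Section Step.
Variables (k : nat) (mu : {sigma_finite_measure set (k.-tuple RT) -> \bar R}).

Definition lebesgue_cons : set (k.+1.-tuple RT) -> \bar R :=
  pushforward (lebesgue_measure \x mu)%E (@cons_pair k).

Let lebesgue_cons0 : lebesgue_cons set0 = 0%E.
Proof. by rewrite /lebesgue_cons /pushforward preimage_set0 measure0. Qed.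

Let lebesgue_cons_ge0 A : (0 <= lebesgue_cons A)%E.
Proof. by rewrite /lebesgue_cons /pushforward; exact: measure_ge0. Qed.

Let lebesgue_cons_sigma_additive : semi_sigma_additive lebesgue_cons.
Proof.
move=> F mF tF mUF.
have mc := @measurable_cons_pair k.
rewrite /lebesgue_cons /pushforward preimage_bigcup.
apply: measure_semi_sigma_additive.
- by move=> n; rewrite -[X in measurable X]setTI; exact: mc.
- apply/trivIsetP => /= i j _ _ ij; rewrite -preimage_setI.
  by move/trivIsetP : tF => /(_ _ _ _ _ ij) ->//; rewrite preimage_set0.
- by rewrite -preimage_bigcup -[X in measurable X]setTI; exact: mc.
Qed.

HB.instance Definition _ := isMeasure.Build _ _ _ lebesgue_cons
  lebesgue_cons0 lebesgue_cons_ge0 lebesgue_cons_sigma_additive.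

Let lebesgue_cons_sigma_finite : sigma_finite setT lebesgue_cons.
Proof.
have /sigma_finiteP[F [TF ndF Foo]] := sigma_finiteT (@lebesgue_measure R).
have /sigma_finiteP[G [TG ndG Goo]] := sigma_finiteT mu.
pose split (v : k.+1.-tuple RT) : RT * k.-tuple RT :=
  (tnth v ord0, [tuple of behead v]).
have ms : measurable_fun setT split.
  by apply/measurable_fun_pair; [exact: measurable_tnth|exact: measurable_behead].
have consK : cancel (@cons_pair k) split.
  by move=> [a v]; congr pair; apply/val_inj.
exists (fun n => split @^-1` (F n `*` G n)) => [|n].
  apply/esym; rewrite -subTset => v _.
  have [i _ Fi] : (\bigcup_i F i) (split v).1 by rewrite -TF.
  have [j _ Gj] : (\bigcup_i G i) (split v).2 by rewrite -TG.
  exists (maxn i j) => //; split.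
  - by move: Fi; exact/subsetPset/ndF/leq_maxl.
  - by move: Gj; exact/subsetPset/ndG/leq_maxr.
have [mF Fn] := Foo n; have [mG Gn] := Goo n; split.
  by rewrite -[X in measurable X]setTI; apply: ms => //; exact: measurableX.
rewrite /lebesgue_cons /pushforward (_ : _ @^-1` _ = F n `*` G n).
  by rewrite product_measure1E// lte_mul_pinfty// ge0_fin_numE.
by apply/seteqP; split => q; rewrite /preimage /mkset consK.
Qed.

HB.instance Definition _ := Measure_isSigmaFinite.Build _ _ _ lebesgue_cons
  lebesgue_cons_sigma_finite.

End Step.

(* Lebesgue measure on R^k, as the iterated product of the one on R. *)
Fixpoint lebesgue_tuple k : {sigma_finite_measure set (k.-tuple RT) -> \bar R} :=
  if k is k'.+1 then lebesgue_cons (lebesgue_tuple k')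
  else \d_([tuple] : 0.-tuple RT).

End LebesgueTuple.

Section PseudoProcess.
Variables (R : realType) (N : nat).
Notation RT := (measurableTypeR R).
Notation leb := (@lebesgue_measure R).

Definition kappa : R[i] := (-1) ^+ (1 + N./2).

Definition theta (l : 'I_N) : R[i] :=
  cexp ('i * ((2 * l + N./2 + 1)%:R * pi / N%:R)%:C).

Definition inJ (l : 'I_N) : bool := 0 < complex.Re (theta l).
Definition inK (l : 'I_N) : bool := complex.Re (theta l) < 0.

Definition coefA (j : 'I_N) : R[i] :=
  \prod_(l < N | inJ l && (l != j)) (theta l / (theta l - theta j)).

Definition coefB (k : 'I_N) : R[i] :=
  \prod_(l < N | inK l && (l != k)) (theta l / (theta l - theta k)).

Definition phi (lam : R[i]) (xi : R) : R[i] :=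
  principal_root N lam *
  \sum_(j < N | inJ j)
    theta j * coefA j * cexp (theta j * principal_root N lam * xi%:C).

Definition psi (lam : R[i]) (xi : R) : R[i] :=
  - principal_root N lam *
  \sum_(k < N | inK k)
    theta k * coefB k * cexp (theta k * principal_root N lam * xi%:C).

(* p(t; xi), kept complex-valued; its values are real when N is even. *)
Definition heat_kernel (t xi : R) : R[i] :=
  ((2 * pi)^-1)%:C *
  cintegral leb (fun u : RT =>
    cexp (- 'i * (xi * u)%:C + kappa * t%:C * (- 'i * u%:C) ^+ N)).

(* E_x[F(X(t_1), ..., X(t_k))] for times 0 = t_0 < t_1 < ... < t_k; the path
   x :: v lists X(t_0), ..., X(t_k). *)
Definition pp_expectation (x : R) (k : nat) (t : nat -> R) (F : seq R -> R[i]) :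
    R[i] :=
  cintegral (lebesgue_tuple R k) (fun v : k.-tuple RT =>
    F v * \prod_(i < k)
      heat_kernel (t i.+1 - t i) (nth 0 (x :: v : seq R) i - nth 0 (v : seq R) i)).

Definition dyadic (n k : nat) : R := k%:R / 2 ^+ n.

(* [l] is the value of E_x[int_0^oo e^(-lam t) F_t dt], where F_t is a
   functional of the path up to time t: the dyadic approximations converge, each
   series included, and their limit is [l]. At the step n, [F v] is the
   functional at t = k/2^n of the path with positions v at 1/2^n, ..., k/2^n. *)
Definition discounted_expectation (x : R) (lam : R[i]) (F : seq R -> R[i])
    (l : R[i]) : Prop :=
  exists S : nat -> R[i],
    (forall n, cseries_to
       (fun k => cexp (- lam * (dyadic n k)%:C) * pp_expectation x k (dyadic n) F)
       (S n)) /\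
    ccvg (fun n => (1 - cexp (- lam / 2 ^+ n)) / lam * S n) l.

Definition path_max (x : R) (v : seq R) : R := \big[Num.max/x]_(y <- v) y.
Definition path_min (x : R) (v : seq R) : R := \big[Num.min/x]_(y <- v) y.

(* [h y z] is int_0^oo e^(-lam t) dt P_x{X(t) in dy, M(t) in dz} / dy dz. *)
Definition is_XM_density (x : R) (lam : R[i]) (h : R -> R -> R[i]) : Prop :=
  (forall y z, ~~ (Num.max x y <= z) -> h y z = 0) /\
  forall mu nu : R, 0 < nu ->
    let g (q : RT * RT) := cexp ('i * (mu * q.1)%:C - (nu * q.2)%:C) * h q.1 q.2 in
    cintegrable (leb \x leb)%E g /\
    discounted_expectation x lam
      (fun v => cexp ('i * (mu * last x v)%:C - (nu * path_max x v)%:C))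
      (cintegral (leb \x leb)%E g).

(* [h y z] is int_0^oo e^(-lam t) dt P_x{X(t) in dy, m(t) in dz} / dy dz. *)
Definition is_Xm_density (x : R) (lam : R[i]) (h : R -> R -> R[i]) : Prop :=
  (forall y z, ~~ (z <= Num.min x y) -> h y z = 0) /\
  forall mu nu : R, 0 < nu ->
    let g (q : RT * RT) := cexp ('i * (mu * q.1)%:C + (nu * q.2)%:C) * h q.1 q.2 in
    cintegrable (leb \x leb)%E g /\
    discounted_expectation x lam
      (fun v => cexp ('i * (mu * last x v)%:C + (nu * path_min x v)%:C))
      (cintegral (leb \x leb)%E g).

End PseudoProcess.

(* Main.v *)
Require Import Defs.
From HB Require Import structures.
From mathcomp Require Import all_boot all_order all_algebra.
From mathcomp Require Import all_classical all_reals all_analysis.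
From mathcomp Require Import complex.
From mathcomp Require Import measurable_realfun zify ring lra.

(** Let Phi(t) = E_0[exp(i mu X(t) - nu X(t)^+)]. On a grid of mesh h, X is a
    walk with a signed step law, and Spitzer's identity holds for it as for random
    walks: the coefficients c_k = E_0[exp(i mu X(k h) - nu M(k h))] satisfy
    k c_k = sum_(j <= k) Phi(j h) c_(k - j). It is proved analytically, by
    telescoping with the semigroup property of the kernel. Hence, for |z| < 1,
    sum_k c_k z^k = exp(sum_j Phi(j h) z^j / j), and with z = exp(- lam h)
    (1 - z) sum_k c_k z^k = exp(sum_j z^j (Phi(j h) - 1) / j).
    As h tends to 0 the exponent, a Riemann sum, tends to
    int_0^oo exp(- lam t) (Phi(t) - 1) / t dt; this uses
    |Phi(t) - 1| <= C t^(1/N), which comes from the decay of the kernel.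

    With r the principal root of lam, the exponential of this integral is
    prod_(l in J) theta_l r / (theta_l r + nu - i mu) *
    prod_(l in K) theta_l r / (theta_l r - i mu):
    replacing lam by lam s^N, both sides have the same logarithmic derivative in s
    and tend to 1. The derivative involves only the Laplace transform of Phi, that
    is the integral of exp(i mu y - nu y^+) against the resolvent density of the
    equation, which Fourier inversion gives as a sum of exponentials exp(- theta_l r y).
    By partial fractions, the product is the transform of phi(x - z) psi(z - y) / lam
    up to the factor lam exp((nu - i mu) x). The minimum reduces to the maximum by
    the symmetry of the kernel, as psi(xi) = phi(- xi). *)

Set Implicit Arguments.
Unset Strict Implicit.
Unset Printing Implicit Defensive.

Import Order.TTheory GRing.Theory Num.Theory.
Import numFieldNormedType.Exports.

Local Open Scope classical_set_scope.
Local Open Scope ring_scope.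
Local Open Scope complex_scope.

(** The obstacle is that the step law is signed. Its total variation may exceed 1 and, by scaling,
    does not depend on the mesh [h], so that taking absolute values along paths only gives a
    geometric bound on the [c_k]; with [z = exp (- lam h)] such a bound secures convergence only for
    [Re lam] of order [1 / h]. The recursion itself repairs this: [Phi] is bounded uniformly in
    time, and if the integer [A] is a bound, the sum of [|c_0|, ..., |c_k|] is at most
    [(k + 1) ^ A]. The series thus converges for [|z| < 1] at every mesh.

    The term [- 1] in the exponent comes from the same recursion with all coefficients equal to 1,
    whose generating series is [1 / (1 - z)]. It tames the singularity [1 / t] at time 0, leaving
    [t ^ (1/N - 1)].

    The products over [J] and over [K] play the role of Wiener-Hopf factors. Since [- theta]
    exchanges [J] and [K], both are Laplace transforms of a single function [half_phi], taken at two
    points; this is why the density is a product. *)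

Notation nm := ComplexField.Normc.normc.

(** * Complex numbers *)

Section ComplexBasics.
Context {R : realType}.
Implicit Types z w : R[i].

Lemma cReD z w : complex.Re (z + w) = complex.Re z + complex.Re w.
Proof. by case: z w => [? ?] [? ?]. Qed.
Lemma cImD z w : complex.Im (z + w) = complex.Im z + complex.Im w.
Proof. by case: z w => [? ?] [? ?]. Qed.
Lemma cReN z : complex.Re (- z) = - complex.Re z.
Proof. by case: z. Qed.
Lemma cImN z : complex.Im (- z) = - complex.Im z.
Proof. by case: z. Qed.
Lemma cReM z w :
  complex.Re (z * w) = complex.Re z * complex.Re w - complex.Im z * complex.Im w.
Proof. by case: z w => [? ?] [? ?]. Qed.
Lemma cImM z w :
  complex.Im (z * w) = complex.Re z * complex.Im w + complex.Im z * complex.Re w.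
Proof. by case: z w => [? ?] [? ?]. Qed.
Lemma cReZ (a : R) z : complex.Re (a%:C * z) = a * complex.Re z.
Proof. by rewrite cReM /= mul0r subr0. Qed.
Lemma cImZ (a : R) z : complex.Im (a%:C * z) = a * complex.Im z.
Proof. by rewrite cImM /= mul0r addr0. Qed.

Lemma cplx_eq z w : complex.Re z = complex.Re w -> complex.Im z = complex.Im w -> z = w.
Proof. by case: z w => [? ?] [? ?] /= -> ->. Qed.

Lemma nm_ge0 z : 0 <= nm z.
Proof. by case: z => a b; exact: sqrtr_ge0. Qed.

Lemma nmM z w : nm (z * w) = nm z * nm w.
Proof. exact: ComplexField.Normc.normcM. Qed.

Lemma nmD z w : nm (z + w) <= nm z + nm w.
Proof. exact: le_normcD. Qed.

Lemma nmN z : nm (- z) = nm z.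
Proof. exact: normcN. Qed.

Lemma nmB z w : nm (z - w) <= nm z + nm w.
Proof. by rewrite -(nmN w) nmD. Qed.

Lemma nm0 : nm (0 : R[i]) = 0.
Proof. exact: ComplexField.Normc.normc0. Qed.

Lemma nm1 : nm (1 : R[i]) = 1.
Proof. exact: ComplexField.Normc.normc1. Qed.

Lemma nmV z : nm z^-1 = (nm z)^-1.
Proof. exact: ComplexField.Normc.normcV. Qed.

Lemma nmX z n : nm (z ^+ n) = nm z ^+ n.
Proof. by elim: n => [|n ih]; rewrite ?expr0 ?nm1// !exprS nmM ih. Qed.

Lemma nmR (a : R) : nm a%:C = `|a|.
Proof. by rewrite /= expr0n/= addr0 sqrtr_sqr. Qed.

Lemma nm_eq0 z : (nm z == 0) = (z == 0).
Proof.
apply/eqP/eqP => [|->]; last exact: nm0.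
exact: ComplexField.Normc.eq0_normc.
Qed.

Lemma nm_gt0 z : (0 < nm z) = (z != 0).
Proof. by rewrite lt_neqAle nm_ge0 andbT eq_sym nm_eq0. Qed.

Lemma nm_sum I (s : seq I) (P : pred I) (f : I -> R[i]) :
  nm (\sum_(i <- s | P i) f i) <= \sum_(i <- s | P i) nm (f i).
Proof.
elim/big_rec2: _ => [|i y1 y2 _ h]; first by rewrite nm0.
by apply: le_trans (nmD _ _) _; rewrite lerD2l.
Qed.

Lemma Re_le_nm z : `|complex.Re z| <= nm z.
Proof.
case: z => a b /=; rewrite -sqrtr_sqr ler_wsqrtr// lerDl; exact: sqr_ge0.
Qed.

Lemma Im_le_nm z : `|complex.Im z| <= nm z.
Proof.
case: z => a b /=; rewrite -sqrtr_sqr ler_wsqrtr// lerDr; exact: sqr_ge0.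
Qed.

Lemma nm_le z : nm z <= `|complex.Re z| + `|complex.Im z|.
Proof.
rewrite {1}(complexE z) (le_trans (nmD _ _))// nmM !nmR.
by rewrite [nm 'i]/= expr0n/= add0r expr1n sqrtr1 mul1r.
Qed.

Lemma normC_nm z : `|z| = (nm z)%:C.
Proof. by case: z. Qed.

Lemma RtoCD (a b : R) : (a + b)%:C = a%:C + b%:C.
Proof. exact: rmorphD. Qed.
Lemma RtoCM (a b : R) : (a * b)%:C = a%:C * b%:C.
Proof. exact: rmorphM. Qed.
Lemma RtoCN (a : R) : (- a)%:C = - a%:C.
Proof. exact: rmorphN. Qed.
Lemma RtoCV (a : R) : (a^-1)%:C = (a%:C)^-1.
Proof. exact: fmorphV. Qed.
Lemma RtoCX (a : R) n : (a ^+ n)%:C = a%:C ^+ n.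
Proof. exact: rmorphXn. Qed.
Lemma RtoCn n : (n%:R : R)%:C = n%:R.
Proof. exact: rmorph_nat. Qed.
Lemma RtoC_eq0 (a : R) : (a%:C == 0) = (a == 0).
Proof. by rewrite eq_complex /= eqxx andbT. Qed.

Lemma cexpD z w : cexp (z + w) = cexp z * cexp w.
Proof.
rewrite /cexp cReD cImD expRD cosD sinD.
by apply: cplx_eq; rewrite !(cReM, cImM)/=; ring.
Qed.

Lemma cexp0 : cexp (0 : R[i]) = 1.
Proof. by rewrite /cexp /= expR0 cos0 sin0 mul1r. Qed.

Lemma nm_cexp z : nm (cexp z) = expR (complex.Re z).
Proof.
rewrite /cexp nmM nmR ger0_norm ?expR_ge0// /nm.
by rewrite cos2Dsin2 sqrtr1 mulr1.
Qed.

Lemma cexp_neq0 z : cexp z != 0.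
Proof. by rewrite -nm_gt0 nm_cexp expR_gt0. Qed.

Lemma cexp_real (a : R) : cexp a%:C = (expR a)%:C.
Proof. by rewrite /cexp /= cos0 sin0 complexr0 mulr1. Qed.

Lemma cexpMn z n : cexp (z *+ n) = cexp z ^+ n.
Proof.
by elim: n => [|n ih]; rewrite ?mulr0n ?cexp0 ?expr0// mulrS cexpD ih exprS.
Qed.

Lemma Re_cexp z : complex.Re (cexp z) = expR (complex.Re z) * cos (complex.Im z).
Proof. by rewrite cReZ. Qed.
Lemma Im_cexp z : complex.Im (cexp z) = expR (complex.Re z) * sin (complex.Im z).
Proof. by rewrite cImZ. Qed.

Lemma ccvgP (u : nat -> R[i]) (l : R[i]) : ccvg u l <->
  ((fun n => complex.Re (u n)) @ \oo --> complex.Re l /\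
   (fun n => complex.Im (u n)) @ \oo --> complex.Im l).
Proof.
split.
- move=> /cvgrPdist_lt ul; split; apply/cvgrPdist_lt => e e0.
  + have e0' : 0 < e%:C by rewrite ltcE/= eqxx.
    have := ul _ e0'; apply: filterS => n /=.
    rewrite normC_nm ltcE/= eqxx/=; apply: le_lt_trans.
    by rewrite -cReN -cReD Re_le_nm.
  + have e0' : 0 < e%:C by rewrite ltcE/= eqxx.
    have := ul _ e0'; apply: filterS => n /=.
    rewrite normC_nm ltcE/= eqxx/=; apply: le_lt_trans.
    by rewrite -cImN -cImD Im_le_nm.
- move=> [/cvgrPdist_lt ur /cvgrPdist_lt ui]; apply/cvgrPdist_lt => e.
  rewrite ltcE/= => /andP[/eqP ei e0].
  have e2 : 0 < complex.Re e / 2 by rewrite divr_gt0.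
  near=> n; rewrite normC_nm ltcE/= ei eqxx/=.
  apply: le_lt_trans (nm_le _) _; rewrite [ltRHS]splitr ltrD//.
  + by rewrite cReD cReN; near: n; exact: ur.
  + by rewrite cImD cImN; near: n; exact: ui.
Unshelve. all: by end_near. Qed.

Lemma ccvg_nm (u : nat -> R[i]) l (e : nat -> R) :
  (forall n, nm (u n - l) <= e n) -> e @ \oo --> 0 -> ccvg u l.
Proof.
move=> ue e0; apply/ccvgP; split.
- apply/subr_cvg0; apply/cvgr0Pnorm_lt => d d0.
  move/cvgr0Pnorm_lt: e0 => /(_ _ d0); apply: filterS => n /=.
  apply: le_lt_trans; rewrite -cReN -cReD (le_trans (Re_le_nm _))//.
  by rewrite (le_trans (ue n))// ler_norm.
- apply/subr_cvg0; apply/cvgr0Pnorm_lt => d d0.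
  move/cvgr0Pnorm_lt: e0 => /(_ _ d0); apply: filterS => n /=.
  apply: le_lt_trans; rewrite -cImN -cImD (le_trans (Im_le_nm _))//.
  by rewrite (le_trans (ue n))// ler_norm.
Qed.

Lemma ccvg_unique (u : nat -> R[i]) l l' : ccvg u l -> ccvg u l' -> l = l'.
Proof.
by move=> /ccvgP[a b] /ccvgP[c d]; apply: cplx_eq;
  [exact: (cvg_unique _ a c)|exact: (cvg_unique _ b d)].
Qed.

Lemma ccvg_ext (u v : nat -> R[i]) l m : ccvg u l -> u =1 v -> l = m -> ccvg v m.
Proof. by move=> h /funext <- <-. Qed.

Lemma ccvg_cst (l : R[i]) : ccvg (fun=> l) l.
Proof. exact: cvg_cst. Qed.

Lemma ccvgD (u v : nat -> R[i]) l m : ccvg u l -> ccvg v m ->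
  ccvg (fun n => u n + v n) (l + m).
Proof. exact: cvgD. Qed.

Lemma ccvgM (u v : nat -> R[i]) l m : ccvg u l -> ccvg v m ->
  ccvg (fun n => u n * v n) (l * m).
Proof.
move=> ul vm; rewrite /ccvg.
exact: (@cvgM R[i] nat \oo _ u v l m ul vm).
Qed.

Lemma ccvgZ z (v : nat -> R[i]) m : ccvg v m -> ccvg (fun n => z * v n) (z * m).
Proof. by move=> h; apply: ccvgM h; exact: ccvg_cst. Qed.

Lemma ccvg_cexp (u : nat -> R[i]) l : ccvg u l -> ccvg (fun n => cexp (u n)) (cexp l).
Proof.
move=> /ccvgP[ur ui]; apply/ccvgP; rewrite Re_cexp Im_cexp; split.
- under [X in X @ _ --> _]eq_fun do rewrite Re_cexp.
  by apply: cvgM; [exact: (cvg_comp _ _ ur (@continuous_expR R _))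
    |exact: (cvg_comp _ _ ui (@continuous_cos R _))].
- under [X in X @ _ --> _]eq_fun do rewrite Im_cexp.
  by apply: cvgM; [exact: (cvg_comp _ _ ur (@continuous_expR R _))
    |exact: (cvg_comp _ _ ui (@continuous_sin R _))].
Qed.

Lemma ccvg_real (u : nat -> R) (l : R) : u @ \oo --> l -> ccvg (fun n => (u n)%:C) l%:C.
Proof. by move=> ul; apply/ccvgP; split => //; exact: cvg_cst. Qed.

End ComplexBasics.

Arguments ccvg_nm {R u l e} _ _.
Arguments ccvg_cst {R} l.
Arguments ccvgD {R u v l m} _ _.
Arguments ccvgM {R u v l m} _ _.
Arguments ccvgZ {R} z {v m} _.
Arguments ccvg_cexp {R u l} _.
Arguments ccvg_real {R u l} _.
Arguments ccvg_ext {R u v l m} _ _ _.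

(** * Integrals of complex-valued functions *)

Section ComplexIntegral.
Context {R : realType} d (T : measurableType d) (mu : {measure set T -> \bar R}).
Implicit Types f g : T -> R[i].

Definition cmeas f :=
  measurable_fun setT (fun t => complex.Re (f t)) /\
  measurable_fun setT (fun t => complex.Im (f t)).

Lemma cmeasD f g : cmeas f -> cmeas g -> cmeas (fun t => f t + g t).
Proof.
move=> [f1 f2] [g1 g2]; split.
- by under eq_fun do rewrite cReD; exact: measurable_funD.
- by under eq_fun do rewrite cImD; exact: measurable_funD.
Qed.

Lemma cmeasM f g : cmeas f -> cmeas g -> cmeas (fun t => f t * g t).
Proof.
move=> [f1 f2] [g1 g2]; split.
- under eq_fun do rewrite cReM; apply: measurable_funB; exact: measurable_funM.
- under eq_fun do rewrite cImM; apply: measurable_funD; exact: measurable_funM.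
Qed.

Lemma cmeas_cst z : cmeas (fun=> z).
Proof. by split; exact: measurable_cst. Qed.

Lemma cmeas_real (h : T -> R) : measurable_fun setT h -> cmeas (fun t => (h t)%:C).
Proof. by move=> mh; split. Qed.

Lemma cmeas_cexp f : cmeas f -> cmeas (fun t => cexp (f t)).
Proof.
move=> [f1 f2]; split.
- under eq_fun do rewrite Re_cexp.
  apply: measurable_funM; first exact: (measurableT_comp (@measurable_expR R) f1).
  exact: (measurableT_comp (continuous_measurable_fun (@continuous_cos R)) f2).
- under eq_fun do rewrite Im_cexp.
  apply: measurable_funM; first exact: (measurableT_comp (@measurable_expR R) f1).
  exact: (measurableT_comp (continuous_measurable_fun (@continuous_sin R)) f2).
Qed.

Lemma cmeas_sum I (s : seq I) (P : pred I) (F : I -> T -> R[i]) :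
  (forall i, cmeas (F i)) -> cmeas (fun t => \sum_(i <- s | P i) F i t).
Proof.
move=> mF; elim: s => [|i s ih].
  by under eq_fun do rewrite big_nil; exact: cmeas_cst.
under eq_fun do rewrite big_cons; case: (P i) => //; exact: cmeasD.
Qed.

Lemma cmeas_if (b : T -> bool) f g : measurable_fun setT b ->
  cmeas f -> cmeas g -> cmeas (fun t => if b t then f t else g t).
Proof.
move=> mb [f1 f2] [g1 g2]; split.
- rewrite (_ : (fun t => _) = (fun t => if b t then complex.Re (f t) else complex.Re (g t))).
    by apply: measurable_fun_ifT.
  by apply/funext => t; case: (b t).
- rewrite (_ : (fun t => _) = (fun t => if b t then complex.Im (f t) else complex.Im (g t))).
    by apply: measurable_fun_ifT.
  by apply/funext => t; case: (b t).
Qed.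

Lemma measurable_nm f : cmeas f -> measurable_fun setT (fun t => nm (f t)).
Proof.
move=> [f1 f2].
rewrite (_ : (fun t => _) =
    (fun t => Num.sqrt (complex.Re (f t) ^+ 2 + complex.Im (f t) ^+ 2))).
  apply: (measurableT_comp (continuous_measurable_fun (@sqrt_continuous R))).
  by apply: measurable_funD; exact: measurable_funX.
by apply/funext => t; case: (f t).
Qed.

Lemma cintegrable_cmeas f : cintegrable mu f -> cmeas f.
Proof.
by move=> [/integrableP[/measurable_EFinP h1 _] /integrableP[/measurable_EFinP h2 _]].
Qed.

Lemma cintegrable_dom f (g : T -> R) : cmeas f ->
  mu.-integrable setT (EFin \o g) -> (forall t, nm (f t) <= g t) ->
  cintegrable mu f.
Proof.
move=> [m1 m2] ig fg; split; apply: (le_integrable measurableT _ _ ig).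
- exact/measurable_EFinP.
- move=> t _ /=; rewrite lee_fin (le_trans (Re_le_nm _))// (le_trans (fg t))//.
  exact: ler_norm.
- exact/measurable_EFinP.
- move=> t _ /=; rewrite lee_fin (le_trans (Im_le_nm _))// (le_trans (fg t))//.
  exact: ler_norm.
Qed.

Lemma integrable_nm f : cintegrable mu f ->
  mu.-integrable setT (EFin \o (fun t => nm (f t))).
Proof.
move=> fi; have := fi => -[i1 i2].
apply: (@le_integrable _ _ _ mu _ measurableT _
   (fun t => `|(complex.Re (f t))%:E| + `|(complex.Im (f t))%:E|)%E).
- exact/measurable_EFinP/measurable_nm/cintegrable_cmeas.
- move=> t _ /=; rewrite lee_fin ger0_norm ?nm_ge0//.
  by rewrite (le_trans (nm_le _))// ler_norm.
- by apply: integrableD => //; exact: integrable_abse.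
Qed.

Lemma cintegralE f : cintegral mu f =
  (\int[mu]_t complex.Re (f t)) +i* (\int[mu]_t complex.Im (f t)).
Proof. by []. Qed.

Lemma eq_cintegral f g : f =1 g -> cintegral mu f = cintegral mu g.
Proof. by move=> /funext ->. Qed.

Lemma cintegrableD f g : cintegrable mu f -> cintegrable mu g ->
  cintegrable mu (fun t => f t + g t).
Proof.
move=> fi gi; apply: (@cintegrable_dom _ (fun t => nm (f t) + nm (g t))).
- by apply: cmeasD; exact: cintegrable_cmeas.
- by have := integrableD measurableT (integrable_nm fi) (integrable_nm gi).
- by move=> t; exact: nmD.
Qed.

Lemma cintegrableZ c f : cintegrable mu f -> cintegrable mu (fun t => c * f t).
Proof.
move=> fi; apply: (@cintegrable_dom _ (fun t => nm c * nm (f t))).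
- by apply: cmeasM; [exact: cmeas_cst|exact: cintegrable_cmeas].
- by have := integrableZl measurableT (nm c) (integrable_nm fi).
- by move=> t; rewrite nmM.
Qed.

Lemma cintegrableZr c f : cintegrable mu f -> cintegrable mu (fun t => f t * c).
Proof.
by move=> /(cintegrableZ c); under eq_fun do rewrite mulrC.
Qed.

Lemma cintegrableN f : cintegrable mu f -> cintegrable mu (fun t => - f t).
Proof.
move=> /(cintegrableZ (-1)).
by under eq_fun do rewrite mulN1r.
Qed.

Lemma cintegrable0 : cintegrable mu (fun=> 0).
Proof. by split; exact: integrable0. Qed.

Lemma cintegrable_sum I (s : seq I) (P : pred I) (F : I -> T -> R[i]) :
  (forall i, P i -> cintegrable mu (F i)) ->
  cintegrable mu (fun t => \sum_(i <- s | P i) F i t).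
Proof.
move=> mF; elim: s => [|i s ih].
  by under eq_fun do rewrite big_nil; exact: cintegrable0.
under eq_fun do rewrite big_cons; case: (boolP (P i)) => // Pi; apply: cintegrableD => //.
exact: mF.
Qed.

Lemma cintegralD f g : cintegrable mu f -> cintegrable mu g ->
  cintegral mu (fun t => f t + g t) = cintegral mu f + cintegral mu g.
Proof.
move=> [f1 f2] [g1 g2]; apply: cplx_eq; rewrite !(cReD, cImD) /=.
- by rewrite -RintegralD//; apply: eq_Rintegral => t _; rewrite cReD.
- by rewrite -RintegralD//; apply: eq_Rintegral => t _; rewrite cImD.
Qed.

Lemma cintegralZ c f : cintegrable mu f ->
  cintegral mu (fun t => c * f t) = c * cintegral mu f.
Proof.
move=> [f1 f2].
have Z (a : R) (h : T -> R) : mu.-integrable setT (EFin \o h) ->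
    mu.-integrable setT (EFin \o (fun t => a * h t)).
  by move=> hi; have := integrableZl measurableT a hi.
apply: cplx_eq; rewrite !(cReM, cImM) /=.
- rewrite -RintegralZl// -RintegralZl// -RintegralB//; [|exact: Z..].
  by apply: eq_Rintegral => t _; rewrite cReM.
- rewrite -RintegralZl// -RintegralZl// -RintegralD//; [|exact: Z..].
  by apply: eq_Rintegral => t _; rewrite cImM.
Qed.

Lemma cintegralZr c f : cintegrable mu f ->
  cintegral mu (fun t => f t * c) = cintegral mu f * c.
Proof.
move=> fi; rewrite mulrC -cintegralZ//.
by apply: eq_cintegral => t; rewrite mulrC.
Qed.

Lemma cintegralN f : cintegrable mu f ->
  cintegral mu (fun t => - f t) = - cintegral mu f.
Proof.
move=> fi; rewrite -[RHS]mulN1r -cintegralZ//.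
by apply: eq_cintegral => t; rewrite mulN1r.
Qed.

Lemma cintegralB f g : cintegrable mu f -> cintegrable mu g ->
  cintegral mu (fun t => f t - g t) = cintegral mu f - cintegral mu g.
Proof.
move=> fi gi; rewrite cintegralD//; last exact: cintegrableN.
by rewrite cintegralN.
Qed.

Lemma cintegral0 : cintegral mu (fun=> 0) = 0.
Proof.
by rewrite cintegralE /= /Rintegral integral0.
Qed.

Lemma cintegral_sum I (s : seq I) (P : pred I) (F : I -> T -> R[i]) :
  (forall i, P i -> cintegrable mu (F i)) ->
  cintegral mu (fun t => \sum_(i <- s | P i) F i t) =
  \sum_(i <- s | P i) cintegral mu (F i).
Proof.
move=> mF; elim: s => [|i s ih].
  by rewrite big_nil -[RHS]cintegral0; apply: eq_cintegral => t; rewrite big_nil.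
rewrite big_cons; case: ifPn => Pi.
- rewrite -ih -cintegralD//; [|exact: mF|exact: cintegrable_sum].
  by apply: eq_cintegral => t; rewrite big_cons Pi.
- by rewrite -ih; apply: eq_cintegral => t; rewrite big_cons (negbTE Pi).
Qed.

(** Real and imaginary parts are bounded separately, whence the factor 2. Only the order of
    magnitude matters in the estimates below. *)
Lemma nm_cintegral f (g : T -> R) : cintegrable mu f ->
  mu.-integrable setT (EFin \o g) -> (forall t, nm (f t) <= g t) ->
  nm (cintegral mu f) <= 2 * \int[mu]_t g t.
Proof.
move=> fi ig fg; rewrite (le_trans (nm_le _))//= mulrDl mul1r.
have ia h : mu.-integrable setT (EFin \o h) ->
    mu.-integrable setT (EFin \o (fun t => `|h t|)).
  by move=> hi; have := integrable_abse hi.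
have [f1 f2] := fi.
apply: lerD.
- rewrite (le_trans (le_normr_Rintegral measurableT f1))//.
  apply: le_Rintegral => //; first exact: ia.
  by move=> t _; rewrite (le_trans (Re_le_nm _)).
- rewrite (le_trans (le_normr_Rintegral measurableT f2))//.
  apply: le_Rintegral => //; first exact: ia.
  by move=> t _; rewrite (le_trans (Im_le_nm _)).
Qed.

Lemma Rintegral_dct (u_ : nat -> T -> R) (u g : T -> R) :
  (forall n, measurable_fun setT (u_ n)) -> (forall t, u_ ^~ t @ \oo --> u t) ->
  mu.-integrable setT (EFin \o g) -> (forall n t, `|u_ n t| <= g t) ->
  mu.-integrable setT (EFin \o u) /\
  (fun n => \int[mu]_t u_ n t) @ \oo --> \int[mu]_t u t.
Proof.
move=> mu_ cu ig ug.
have mu' : measurable_fun setT u.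
  exact: (measurable_realfun.measurable_fun_cvg mu_ (fun t _ => cu t)).
have iu : mu.-integrable setT (EFin \o u).
  apply: (le_integrable measurableT _ _ ig); first exact/measurable_EFinP.
  move=> t _ /=; rewrite lee_fin.
  rewrite [leRHS]ger0_norm ?(le_trans (normr_ge0 _) (ug 0 t))//.
  apply: (@closed_cvg nat R \oo _ (fun n => `|u_ n t|) (fun x => x <= g t)
    (@closed_le _ _) _ `|u t| (cvg_norm (cu t))).
  by apply: nearW => n; exact: ug.
split => //.
have [|||||_ _] := @dominated_convergence _ _ _ mu _ measurableT
  (fun n t => (u_ n t)%:E) (EFin \o u) (EFin \o g) => //.
- by move=> n; exact/measurable_EFinP.
- exact/measurable_EFinP.
- by apply: aeW => t _; apply: cvg_EFin; [exact: nearW|exact: cu].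
- by apply: aeW => t n _; rewrite lee_fin.
move=> h; apply: fine_cvg; rewrite fineK//.
exact: (integrable_fin_num measurableT iu).
Qed.

Lemma cintegral_dct (f_ : nat -> T -> R[i]) f (g : T -> R) :
  (forall n, cmeas (f_ n)) -> (forall t, ccvg (f_ ^~ t) (f t)) ->
  mu.-integrable setT (EFin \o g) -> (forall n t, nm (f_ n t) <= g t) ->
  cintegrable mu f /\ ccvg (fun n => cintegral mu (f_ n)) (cintegral mu f).
Proof.
move=> mf cf ig fg.
have [i1 c1] := Rintegral_dct (fun n => (mf n).1)
  (fun t => (proj1 (ccvgP _ _) (cf t)).1) ig
  (fun n t => le_trans (Re_le_nm _) (fg n t)).
have [i2 c2] := Rintegral_dct (fun n => (mf n).2)
  (fun t => (proj1 (ccvgP _ _) (cf t)).2) ig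
  (fun n t => le_trans (Im_le_nm _) (fg n t)).
by split; [split|apply/ccvgP].
Qed.

End ComplexIntegral.

Lemma cmeas_comp {R : realType} d1 d2 (T1 : measurableType d1)
    (T2 : measurableType d2) (f : T2 -> R[i]) (phi : T1 -> T2) :
  cmeas f -> measurable_fun setT phi -> cmeas (fun x => f (phi x)).
Proof.
by move=> [f1 f2] mphi; split; [exact: (measurableT_comp f1 mphi)
  |exact: (measurableT_comp f2 mphi)].
Qed.

(** * Fubini's theorem for complex-valued functions *)

Section ComplexFubini.
Context {R : realType} d1 d2 (T1 : measurableType d1) (T2 : measurableType d2).
Variables (m1 : {sigma_finite_measure set T1 -> \bar R})
  (m2 : {sigma_finite_measure set T2 -> \bar R}).

(** The real-valued inner integral agrees with the extended one only where the section is
    integrable, that is almost everywhere; this suffices to transfer integrability and value. *)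
Let fin_ae (f : T1 * T2 -> R) : (m1 \x m2)%E.-integrable setT (EFin \o f) ->
  m1.-integrable setT (EFin \o (fun x => \int[m2]_y f (x, y))) /\
  \int[(m1 \x m2)%E]_q f q = \int[m1]_x \int[m2]_y f (x, y).
Proof.
move=> fi.
have iF := integrable_fubini_F fi.
have mF := measurable_int _ iF.
have e : ae_eq m1 setT (fubini_F m2 (EFin \o f))
    (EFin \o (fun x => \int[m2]_y f (x, y))).
  have := ae_integrable1 fi; apply: filterS => x hx _.
  by rewrite /= /Rintegral fineK//; exact: (integrable_fin_num measurableT hx).
have mG : measurable_fun setT (EFin \o (fun x => \int[m2]_y f (x, y))).
  apply/measurable_EFinP.
  exact: (measurableT_comp (fine_measurable measurableT) mF).
split.
- apply/integrableP; split => //.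
  rewrite (ae_eq_integral (abse \o (fubini_F m2 (EFin \o f))))//.
  + by move/integrableP : iF => [].
  + exact: measurableT_comp.
  + exact: measurableT_comp.
  + by apply: filterS e => x h /h ex; congr abse; exact: esym.
- by rewrite /Rintegral -integral12_prod_meas1//; congr fine; exact: ae_eq_integral.
Qed.

Let fin_ae2 (f : T1 * T2 -> R) : (m1 \x m2)%E.-integrable setT (EFin \o f) ->
  m2.-integrable setT (EFin \o (fun y => \int[m1]_x f (x, y))) /\
  \int[(m1 \x m2)%E]_q f q = \int[m2]_y \int[m1]_x f (x, y).
Proof.
move=> fi.
have mf := measurable_int _ fi.
have mF := measurable_fubini_G fi.
have iF : m2.-integrable setT (fubini_G m1 (EFin \o f)).
  apply/integrableP; split => //.
  have lt := (integrable21ltyP m1 m2 mf).1 fi.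
  apply: le_lt_trans lt.
  apply: ge0_le_integral => //.
  - exact: measurableT_comp.
  - apply: (measurable_fun_fubini_tonelli_G (abse \o (EFin \o f))) => //=.
    exact: measurableT_comp.
  - move=> y _; apply: le_abse_integral => //.
    exact: (measurableT_comp mf (measurable_pair2 y)).
have e : ae_eq m2 setT (fubini_G m1 (EFin \o f))
    (EFin \o (fun y => \int[m1]_x f (x, y))).
  have := ae_integrable2 fi; apply: filterS => x hx _.
  by rewrite /= /Rintegral fineK//; exact: (integrable_fin_num measurableT hx).
have mG : measurable_fun setT (EFin \o (fun y => \int[m1]_x f (x, y))).
  apply/measurable_EFinP.
  exact: (measurableT_comp (fine_measurable measurableT) mF).
split.
- apply/integrableP; split => //.
  rewrite (ae_eq_integral (abse \o (fubini_G m1 (EFin \o f))))//.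
  + by move/integrableP : iF => [].
  + exact: measurableT_comp.
  + exact: measurableT_comp.
  + by apply: filterS e => x h /h ex; congr abse; exact: esym.
- by rewrite /Rintegral -integral21_prod_meas1//; congr fine; exact: ae_eq_integral.
Qed.

Lemma cintegral12 (f : T1 * T2 -> R[i]) : cintegrable (m1 \x m2)%E f ->
  cintegrable m1 (fun x => cintegral m2 (fun y => f (x, y))) /\
  cintegral (m1 \x m2)%E f = cintegral m1 (fun x => cintegral m2 (fun y => f (x, y))).
Proof.
move=> [/fin_ae[i1 e1] /fin_ae[i2 e2]]; split; first by split.
by apply: cplx_eq.
Qed.

Lemma cintegral21 (f : T1 * T2 -> R[i]) : cintegrable (m1 \x m2)%E f ->
  cintegrable m2 (fun y => cintegral m1 (fun x => f (x, y))) /\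
  cintegral (m1 \x m2)%E f = cintegral m2 (fun y => cintegral m1 (fun x => f (x, y))).
Proof.
move=> [/fin_ae2[i1 e1] /fin_ae2[i2 e2]]; split; first by split.
by apply: cplx_eq.
Qed.

Lemma cfubini (f : T1 -> T2 -> R[i]) :
  cintegrable (m1 \x m2)%E (fun q => f q.1 q.2) ->
  cintegral m1 (fun x => cintegral m2 (fun y => f x y)) =
  cintegral m2 (fun y => cintegral m1 (fun x => f x y)).
Proof. by move=> fi; rewrite -(cintegral12 fi).2 (cintegral21 fi).2. Qed.

(* The mixed bound lets an integrable majorant of the inner integral, possibly
   depending on the outer variable, be used instead of a product majorant. *)
Lemma cintegrable_prod (f : T1 * T2 -> R[i]) (g : T1 -> T2 -> R) (h : T1 -> R) :
  cmeas f -> (forall x y, nm (f (x, y)) <= g x y) ->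
  (forall x, m2.-integrable setT (EFin \o g x)) ->
  (forall x, \int[m2]_y g x y <= h x) -> m1.-integrable setT (EFin \o h) ->
  cintegrable (m1 \x m2)%E f.
Proof.
move=> mf fg ig gh ih.
have mn := measurable_nm mf.
suff : (m1 \x m2)%E.-integrable setT (EFin \o (fun q => nm (f q))).
  by move=> i; apply: (cintegrable_dom mf i).
apply/integrable12ltyP; first exact/measurable_EFinP.
have mF : measurable_fun setT
    (fun x => (\int[m2]_y `|(EFin \o (fun q => nm (f q))) (x, y)|)%E).
  apply: (measurable_fun_fubini_tonelli_F
    (abse \o (EFin \o (fun q => nm (f q))))) => //=.
  by apply: measurableT_comp => //; exact/measurable_EFinP.
move/integrableP : ih => [mh]; apply: le_lt_trans.
apply: ge0_le_integral => //.
- by move=> x _; apply: integral_ge0.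
- exact: measurableT_comp.
- move=> x _.
  have g0 y : 0 <= g x y by rewrite (le_trans _ (fg x y))// nm_ge0.
  apply: (@le_trans _ _ (\int[m2]_y (g x y)%:E)%E).
    apply: ge0_le_integral => //.
    + apply: measurableT_comp => //; apply/measurable_EFinP.
      exact: (measurableT_comp mn (measurable_pair1 x)).
    + exact: (measurable_int _ (ig x)).
    + by move=> y _ /=; rewrite lee_fin ger0_norm ?nm_ge0.
  rewrite -(fineK (integrable_fin_num measurableT (ig x))) /= lee_fin.
  by rewrite (le_trans (gh x))// ler_norm.
Qed.

Lemma cintegrable_prodM (f : T1 * T2 -> R[i]) (g : T2 -> R) (h : T1 -> R) :
  cmeas f -> (forall x y, nm (f (x, y)) <= h x * g y) ->
  m2.-integrable setT (EFin \o g) -> m1.-integrable setT (EFin \o h) ->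
  cintegrable (m1 \x m2)%E f.
Proof.
move=> mf fg ig ih.
apply: (@cintegrable_prod _ (fun x y => h x * g y)
  (fun x => h x * \int[m2]_y g y)) => //.
- by move=> x; have := integrableZl measurableT (h x) ig.
- by move=> x; rewrite RintegralZl.
- by have := integrableZr measurableT (\int[m2]_y g y) ih.
Qed.

End ComplexFubini.

(** * Translations and reflections of the line *)

Section ChangeOfVariable.
Context {R : realType}.
Notation RT := (measurableTypeR R).
Notation leb := (@lebesgue_measure R).

Section Preserve.
Variables (phi : RT -> RT) (mphi : measurable_fun setT phi).
Hypothesis pphi : forall A, measurable A -> leb (phi @^-1` A) = leb A.

Lemma integrable_preserve (h : RT -> R) : leb.-integrable setT (EFin \o h) ->
  leb.-integrable setT (EFin \o (fun t => h (phi t))) /\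
  \int[leb]_t h (phi t) = \int[leb]_t h t.
Proof.
move=> /integrableP[mh ih].
have mhp : measurable_fun setT (EFin \o (fun t => h (phi t))).
  exact: (measurableT_comp mh mphi).
have i1 : leb.-integrable setT (EFin \o (fun t => h (phi t))).
  apply/integrableP; split => //.
  apply: le_lt_trans ih.
  have := @ge0_integral_pushforward _ _ _ _ R phi mphi leb setT
    (abse \o (EFin \o h)) measurableT.
  rewrite preimage_setT => <- //.
  - rewrite le_eqVlt; apply/orP; left; apply/eqP.
    by apply: eq_measure_integral => A mA _; exact: pphi.
  - exact: measurableT_comp.
  - by move=> x _; exact: abse_ge0.
split => //; rewrite /Rintegral; congr fine.
have := @integral_pushforward _ _ _ _ R phi mphi leb setT (EFin \o h) mh.
rewrite preimage_setT => <- //.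
by apply: eq_measure_integral => A mA _; exact: pphi.
Qed.

Lemma cintegral_preserve (f : RT -> R[i]) : cintegrable leb f ->
  cintegrable leb (fun t => f (phi t)) /\
  cintegral leb (fun t => f (phi t)) = cintegral leb f.
Proof.
move=> [/integrable_preserve[i1 e1] /integrable_preserve[i2 e2]].
by split; [split|apply: cplx_eq].
Qed.

End Preserve.

Lemma leb_shift (a : R) (A : set RT) : measurable A ->
  leb ((fun t : RT => t + a : RT) @^-1` A) = leb A.
Proof.
have mf : measurable_fun setT (fun t : RT => t + a : RT).
  by apply: measurable_funD.
move=> mA; apply/esym.
apply: (@lebesgue_measure_unique R (pushforward leb (fun t : RT => t + a : RT))) => //.
move=> _ [[c b]] _ <-; rewrite /pushforward.
have e : (fun t : RT => t + a : RT) @^-1` `]c, b]%classic = `](c - a), (b - a)]%classic.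
  by apply/seteqP; split => t /=; rewrite !in_itv/= ltrBlDr lerBrDr.
rewrite [X in _ = leb X]e.
rewrite !lebesgue_measure_itv/= !lte_fin ltrD2r.
by case: ifP => // _; rewrite -!EFinD; congr EFin; ring.
Qed.

Lemma leb_opp (A : set RT) : measurable A ->
  leb ((fun t : RT => - t : RT) @^-1` A) = leb A.
Proof. by move=> mA; rewrite -[RHS]lebesgue_measureN. Qed.

Lemma cintegral_shift (a : R) (f : RT -> R[i]) : cintegrable leb f ->
  cintegrable leb (fun t => f (t + a)) /\
  cintegral leb (fun t => f (t + a)) = cintegral leb f.
Proof.
apply: cintegral_preserve; last exact: leb_shift.
exact: measurable_funD.
Qed.

Lemma cintegral_opp (f : RT -> R[i]) : cintegrable leb f ->
  cintegrable leb (fun t => f (- t)) /\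
  cintegral leb (fun t => f (- t)) = cintegral leb f.
Proof.
by apply: cintegral_preserve; [exact: oppr_measurable|exact: leb_opp].
Qed.

Lemma integrable_shift (a : R) (f : RT -> R) : leb.-integrable setT (EFin \o f) ->
  leb.-integrable setT (EFin \o (fun t => f (t + a))) /\
  \int[leb]_t f (t + a) = \int[leb]_t f t.
Proof.
apply: integrable_preserve; last exact: leb_shift.
exact: measurable_funD.
Qed.

Lemma integrable_opp (f : RT -> R) : leb.-integrable setT (EFin \o f) ->
  leb.-integrable setT (EFin \o (fun t => f (- t))) /\
  \int[leb]_t f (- t) = \int[leb]_t f t.
Proof.
by apply: integrable_preserve; [exact: oppr_measurable|exact: leb_opp].
Qed.

End ChangeOfVariable.

(** * Improper integrals through primitives *)

Section FTC.
Context {R : realType}.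
Notation RT := (measurableTypeR R).
Notation leb := (@lebesgue_measure R).

Lemma is_derive_continuous (F : R -> R) (x d : R) : is_derive x 1 F d -> {for x, continuous F}.
Proof. by move=> [dF _]; apply/differentiable_continuous/derivable1_diffP. Qed.

Lemma integral_is_derive (f F : R -> R) (a b : R) : a < b ->
  (forall x, a <= x <= b -> is_derive x 1 F (f x)) ->
  (forall x, a <= x <= b -> {for x, continuous f}) ->
  (\int[leb]_(x in `[a, b]) (f x)%:E = (F b - F a)%:E)%E.
Proof.
move=> ab dF cf; rewrite (@continuous_FTC2 _ f F)// ?EFinB//.
- by apply: continuous_in_subspaceT => x; rewrite inE/= in_itv/=; exact: cf.
- split.
  + by move=> x; rewrite in_itv/= => /andP[/ltW ax /ltW xb]; apply: ex_derive;
      apply: dF; rewrite ax.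
  + apply: cvg_at_right_filter; apply: (is_derive_continuous (dF a _)).
    by rewrite lexx ltW.
  + apply: cvg_at_left_filter; apply: (is_derive_continuous (dF b _)).
    by rewrite lexx ltW.
- move=> x; rewrite in_itv/= => /andP[/ltW ax /ltW xb].
  by rewrite derive1E; apply: derive_val; apply: dF; rewrite ax.
Qed.

(** An increasing sequence of compact intervals filling the set [P]. One theory of improper
    integrals then serves the line and both the closed and the open half-line. *)
Record exhausts (P : R -> bool) (a b : nat -> R) : Prop := Exhausts {
  exhausts_lt : forall n, a n < b n;
  exhausts_sub : forall n x, a n <= x <= b n -> P x;
  exhausts_near : forall x, P x -> \forall n \near \oo, a n <= x <= b n;
  exhausts_left : forall m n, (m <= n)%N -> a n <= a m;
  exhausts_right : forall m n, (m <= n)%N -> b m <= b n }.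

Lemma exhaustsT : exhausts xpredT (fun n => - n.+1%:R) (fun n => n.+1%:R).
Proof.
split => //.
- by move=> n; rewrite (@lt_trans _ _ 0)// ?oppr_lt0 ltr0n.
- move=> x _; near=> n; rewrite -ler_norml.
  rewrite (@le_trans _ _ n%:R) ?ler_nat//.
  by near: n; exact: nbhs_infty_ger.
- by move=> m n mn; rewrite lerN2 ler_nat ltnS.
- by move=> m n mn; rewrite ler_nat ltnS.
Unshelve. all: by end_near. Qed.

Lemma exhausts_ge0 : exhausts (>= 0) (fun=> 0) (fun n => n.+1%:R).
Proof.
split => //.
- by move=> n x /andP[].
- move=> x /= x0; near=> n; rewrite x0 (@le_trans _ _ n%:R) ?ler_nat//=.
  by near: n; exact: nbhs_infty_ger.
- by move=> m n mn; rewrite ler_nat ltnS.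
Unshelve. all: by end_near. Qed.

(** The right end is [n.+2] and not [n.+1] so that the interval is already nondegenerate for
    [n = 0], where the left end is 1. *)
Lemma exhausts_gt0 : exhausts (> 0) (fun n => n.+1%:R^-1) (fun n => n.+2%:R).
Proof.
split => //.
- move=> n; rewrite (@le_lt_trans _ _ 1) ?ltr1n// invf_le1 ?ler1n//.
- by move=> n x /andP[h _] /=; rewrite (lt_le_trans _ h)// invr_gt0.
- move=> x /= x0; near=> n; apply/andP; split.
    rewrite -[leRHS]invrK lef_pV2 ?posrE ?invr_gt0//.
    rewrite (@le_trans _ _ n%:R) ?ler_nat//.
    by near: n; exact: nbhs_infty_ger.
  rewrite (@le_trans _ _ n%:R) ?ler_nat//.
    by near: n; exact: nbhs_infty_ger.
  by rewrite -addn2 leq_addr.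
- by move=> m n mn; rewrite lef_pV2 ?posrE// ler_nat ltnS.
- by move=> m n mn; rewrite ler_nat !ltnS.
Unshelve. all: by end_near. Qed.

Section Exhaustion.
Variables (P : R -> bool) (a b : nat -> R).
Hypothesis E : exhausts P a b.
Let ab := exhausts_lt E.
Let abP := exhausts_sub E.
Let Pab := exhausts_near E.
Let nda := exhausts_left E.
Let ndb := exhausts_right E.
Variables (f F : R -> R).
Hypothesis dF : forall x, P x -> is_derive x 1 F (f x).
Hypothesis cf : forall x, P x -> {for x, continuous f}.

Let g n (x : RT) := if a n <= x <= b n then f x else 0.

Let gE n : g n = f \_ `[a n, b n].
Proof.
apply/funext => x; rewrite /g patchE; case: ifPn => h.
  by rewrite mem_set//= in_itv.
by rewrite memNset//= in_itv/=; exact/negP.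
Qed.

Let int_g n : (\int[leb]_x (g n x)%:E = (F (b n) - F (a n))%:E)%E.
Proof.
rewrite -(@integral_is_derive f F (a n) (b n) (ab n)
  (fun x h => dF (abP h)) (fun x h => cf (abP h))).
rewrite [RHS]integral_mkcond; apply: eq_integral => x _.
by rewrite gE restrict_EFin.
Qed.

Let mg n : measurable_fun setT (g n).
Proof.
rewrite gE; apply/(measurable_restrictT _ (measurable_itv _)).
apply: subspace_continuous_measurable_fun => //.
by apply: continuous_in_subspaceT => x; rewrite inE/= in_itv/= => /abP; exact: cf.
Qed.

Let g_cvg (x : RT) : g ^~ x @ \oo --> (if P x then f x else 0).
Proof.
case: ifPn => Px.
- apply: cvg_near_cst; have := Pab Px; apply: filterS => n h.
  by rewrite /g h.
- rewrite (_ : g ^~ x = fun=> 0); first exact: cvg_cst.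
  apply/funext => n; rewrite /g; case: ifPn => // /abP h.
  by rewrite h in Px.
Qed.

Lemma measurable_exhaust : measurable_fun setT (fun x : RT => if P x then f x else 0).
Proof.
by apply: (measurable_realfun.measurable_fun_cvg mg) => x _; exact: g_cvg.
Qed.

(** The truncated integrals are increments of the primitive; for a nonnegative integrand, a uniform
    bound on them passes to the limit by monotone convergence. *)
Lemma integrable_exhaust (B : R) : (forall x, P x -> 0 <= f x) ->
  (forall n, F (b n) - F (a n) <= B) ->
  leb.-integrable setT (EFin \o (fun x : RT => if P x then f x else 0)).
Proof.
move=> f0 FB; apply/integrableP; split.
  by apply/measurable_EFinP; exact: measurable_exhaust.
have g0 n x : 0 <= g n x by rewrite /g; case: ifPn => // /abP /f0.
under eq_integral.
  move=> x _; rewrite /= ger0_norm; last by case: ifPn => // /f0.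
  over.
have /cvg_lim <-// : (\int[leb]_x (g n x)%:E @[n --> \oo] -->
    \int[leb]_x (if P x then f x else 0)%:E)%E.
  have := @cvg_monotone_convergence _ _ _ leb setT measurableT
    (fun n x => (g n x)%:E).
  rewrite (_ : (fun x => limn _) = fun x : RT => (if P x then f x else 0)%:E).
    apply.
    - by move=> n; exact/measurable_EFinP.
    - by move=> n x _; rewrite lee_fin.
    - move=> x _ m n mn; rewrite lee_fin /g.
      case: ifPn => [/andP[h1 h2]|_]; last exact: g0.
      by rewrite (le_trans (nda mn) h1) (le_trans h2 (ndb mn)).
  by apply/funext => x; apply/cvg_lim => //; apply: cvg_EFin; [exact: nearW|exact: g_cvg].
apply: (@le_lt_trans _ _ B%:E); last exact: ltry.
apply: lime_le.
- apply: ereal_nondecreasing_is_cvgn => m n mn.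
  apply: ge0_le_integral => //.
  + by move=> x _; rewrite lee_fin.
  + exact/measurable_EFinP.
  + exact/measurable_EFinP.
  + move=> x _; rewrite lee_fin /g.
    case: ifPn => [/andP[h1 h2]|_]; last exact: g0.
    by rewrite (le_trans (nda mn) h1) (le_trans h2 (ndb mn)).
- by apply: nearW => n; rewrite int_g lee_fin.
Qed.

Lemma Rintegral_exhaust (l : R) :
  leb.-integrable setT (EFin \o (fun x : RT => if P x then f x else 0)) ->
  F (b n) - F (a n) @[n --> \oo] --> l ->
  \int[leb]_x (if P x then f x else 0) = l.
Proof.
move=> fi Fl.
have gb n x : `|g n x| <= `|if P x then f x else 0|.
  by rewrite /g; case: ifPn => [/abP ->|_]//; rewrite normr0.
have [_] := Rintegral_dct mg g_cvg (integrable_abse fi) gb.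
rewrite (_ : (fun n => _) = (fun n => F (b n) - F (a n))); last first.
  by apply/funext => n; rewrite /Rintegral int_g.
by move=> h; exact: (cvg_unique _ h Fl).
Qed.

End Exhaustion.
End FTC.

(** * Complex-valued functions of a real variable *)

Section ComplexDerivative.
Context {R : realType}.
Notation RT := (measurableTypeR R).
Notation leb := (@lebesgue_measure R).
Implicit Types (f g : R -> R[i]) (x : R) (d e : R[i]).

Definition cder f x d :=
  is_derive x (1 : R) (fun t => complex.Re (f t)) (complex.Re d) /\
  is_derive x (1 : R) (fun t => complex.Im (f t)) (complex.Im d).

Lemma is_derive_ext (F G : R -> R) x (d e : R) :
  is_derive x (1 : R) F d -> F =1 G -> d = e -> is_derive x (1 : R) G e.
Proof. by move=> h /funext <- <-. Qed.

Lemma cder_ext f g x d e : cder f x d -> f =1 g -> d = e -> cder g x e.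
Proof. by move=> h /funext <- <-. Qed.

Lemma cder_cst z x : cder (fun=> z) x 0.
Proof. by split; exact: is_derive_cst. Qed.

Lemma cder_real (F : R -> R) x (d : R) : is_derive x (1 : R) F d ->
  cder (fun t => (F t)%:C) x d%:C.
Proof. by move=> h; split => //; exact: is_derive_cst. Qed.

Lemma cder_id x : cder (fun t => t%:C) x 1.
Proof. by apply: (@cder_real id x 1); exact: is_derive_id. Qed.

Lemma cderD f g x d e : cder f x d -> cder g x e ->
  cder (fun t => f t + g t) x (d + e).
Proof.
move=> [f1 f2] [g1 g2]; split.
- apply: is_derive_ext (is_deriveD f1 g1) _ _; last by rewrite cReD.
  by move=> t; rewrite cReD.
- apply: is_derive_ext (is_deriveD f2 g2) _ _; last by rewrite cImD.
  by move=> t; rewrite cImD.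
Qed.

Lemma cderM f g x d e : cder f x d -> cder g x e ->
  cder (fun t => f t * g t) x (d * g x + f x * e).
Proof.
move=> [f1 f2] [g1 g2]; split.
- apply: is_derive_ext (is_deriveB (is_deriveM f1 g1) (is_deriveM f2 g2)) _ _.
    by move=> t; rewrite cReM.
  by rewrite cReD !cReM /GRing.scale/=; ring.
- apply: is_derive_ext (is_deriveD (is_deriveM f1 g2) (is_deriveM f2 g1)) _ _.
    by move=> t; rewrite cImM.
  by rewrite cImD !cImM /GRing.scale/=; ring.
Qed.

Lemma cderZ z f x d : cder f x d -> cder (fun t => z * f t) x (z * d).
Proof.
move=> h; apply: cder_ext (cderM (cder_cst z x) h) _ _ => //.
by rewrite mul0r add0r.
Qed.

Lemma cderN f x d : cder f x d -> cder (fun t => - f t) x (- d).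
Proof.
move=> h; apply: cder_ext (cderZ (-1) h) _ _ => [t|]; by rewrite mulN1r.
Qed.

Lemma cderB f g x d e : cder f x d -> cder g x e ->
  cder (fun t => f t - g t) x (d - e).
Proof. by move=> h k; apply: cderD => //; exact: cderN. Qed.

Lemma cder_sum I (s : seq I) (P : pred I) (F : I -> R -> R[i]) (D : I -> R[i]) x :
  (forall i, P i -> cder (F i) x (D i)) ->
  cder (fun t => \sum_(i <- s | P i) F i t) x (\sum_(i <- s | P i) D i).
Proof.
move=> FD; elim: s => [|i s ih].
  by apply: cder_ext (cder_cst 0 x) _ _ => [t|]; rewrite big_nil.
rewrite big_cons; case: (boolP (P i)) => Pi.
- by apply: cder_ext (cderD (FD i Pi) ih) _ _ => [t|]//; rewrite big_cons Pi.
- by apply: cder_ext ih _ _ => [t|]//; rewrite big_cons (negbTE Pi).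
Qed.

Lemma cderX f x d n : cder f x d ->
  cder (fun t => f t ^+ n.+1) x (n.+1%:R * f x ^+ n * d).
Proof.
move=> h; elim: n => [|n ih].
  by apply: cder_ext h _ _ => [t|]; rewrite ?expr1// expr0 !mul1r.
apply: cder_ext (cderM h ih) _ _ => [t|]; first by rewrite -exprS.
by rewrite !exprS -!natr1; ring.
Qed.

Lemma cder_cexp f x d : cder f x d -> cder (fun t => cexp (f t)) x (d * cexp (f x)).
Proof.
move=> [f1 f2].
have h1 := is_derive1_comp (is_derive_expR (complex.Re (f x))) f1.
have h2 := is_derive1_comp (is_derive_cos (complex.Im (f x))) f2.
have h3 := is_derive1_comp (is_derive_sin (complex.Im (f x))) f2.
split.
- apply: is_derive_ext (is_deriveM h1 h2) _ _ => [t|]; first by rewrite Re_cexp.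
  by rewrite cReM Re_cexp Im_cexp /GRing.scale /=; ring.
- apply: is_derive_ext (is_deriveM h1 h3) _ _ => [t|]; first by rewrite Im_cexp.
  by rewrite cImM Re_cexp Im_cexp /GRing.scale /=; ring.
Qed.

Lemma cder0_cst f (x0 : R) : (forall x, x0 < x -> cder f x 0) ->
  forall x y, x0 < x -> x0 < y -> f x = f y.
Proof.
move=> df.
have key (F : R -> R) : (forall x, x0 < x -> is_derive x (1 : R) F 0) ->
    forall x y, x0 < x -> x < y -> F x = F y.
  move=> dF x y x1 xy.
  have [||c _] := @MVT R F (fun=> 0) x y xy.
  - move=> z; rewrite in_itv/= => /andP[xz _]; apply: dF; exact: lt_trans xz.
  - apply: continuous_in_subspaceT => z; rewrite inE/= in_itv/= => /andP[xz _].
    by apply: is_derive_continuous (dF z _); exact: lt_le_trans xz.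
  - by rewrite mul0r => /eqP; rewrite subr_eq0 => /eqP.
have key2 x y : x0 < x -> x < y -> f x = f y.
  move=> x1 xy; apply: cplx_eq.
  - by apply: (key (fun t => complex.Re (f t))) => // z z1; case: (df z z1).
  - by apply: (key (fun t => complex.Im (f t))) => // z z1; case: (df z z1).
move=> x y x1 y1; have [xy|yx|->//] := ltgtP x y; first exact: key2.
by apply/esym; exact: key2.
Qed.

(** The mean value equality fails for complex values. Applied to the real and the imaginary part, it
    gives this inequality with a factor 2. *)
Lemma cder_mvt f (d : R -> R[i]) (a b M : R) : a <= b ->
  (forall x, a <= x <= b -> cder f x (d x)) ->
  (forall x, a <= x <= b -> nm (d x) <= M) -> nm (f b - f a) <= 2 * (M * (b - a)).
Proof.
rewrite le_eqVlt => /predU1P[-> _ _|ab df dM].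
  by rewrite !subrr nm0 mulr0 mulr0.
have key (F : R -> R) (D : R -> R) : (forall x, a <= x <= b -> is_derive x (1 : R) F (D x)) ->
    (forall x, a <= x <= b -> `|D x| <= M) -> `|F b - F a| <= M * (b - a).
  move=> dF DM.
  have [||c cab ->] := @MVT R F D a b ab.
  - by move=> z; rewrite in_itv/= => /andP[/ltW h1 /ltW h2]; apply: dF; rewrite h1.
  - apply: continuous_in_subspaceT => z; rewrite inE/= in_itv/= => h.
    by apply: is_derive_continuous (dF z _).
  - rewrite normrM [X in _ * X]gtr0_norm ?subr_gt0//.
    apply: ler_wpM2r; first by rewrite subr_ge0 ltW.
    by apply: DM; move: cab; rewrite in_itv/= => /andP[/ltW -> /ltW].
rewrite (le_trans (nm_le _))// mulrDl mul1r cReD cImD cReN cImN; apply: lerD.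
- apply: (key (fun t => complex.Re (f t)) (fun t => complex.Re (d t))).
    by move=> x /df[].
  by move=> x /dM; apply: le_trans; exact: Re_le_nm.
- apply: (key (fun t => complex.Im (f t)) (fun t => complex.Im (d t))).
    by move=> x /df[].
  by move=> x /dM; apply: le_trans; exact: Im_le_nm.
Qed.

(** Logarithmic derivatives add up. Writing each derivative as [F i x * D i] avoids dividing by a
    factor that might vanish. *)
Lemma cder_prod_log I (s : seq I) (P : pred I) (F : I -> R -> R[i]) (D : I -> R[i]) x :
  (forall i, P i -> cder (F i) x (F i x * D i)) ->
  cder (fun t => \prod_(i <- s | P i) F i t) x
    (\prod_(i <- s | P i) F i x * \sum_(i <- s | P i) D i).
Proof.
move=> FD; elim: s => [|i s ih].
  apply: cder_ext (cder_cst 1 x) _ _ => [t|]; first by rewrite big_nil.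
  by rewrite !big_nil mulr0.
rewrite !big_cons; case: (boolP (P i)) => Pi.
- apply: cder_ext (cderM (FD i Pi) ih) _ _ => [t|]; first by rewrite big_cons Pi.
  by ring.
- by apply: cder_ext ih _ _ => [t|]//; rewrite big_cons (negbTE Pi).
Qed.

(** Mean value inequality along the segment from 0 to [z], which stays in the half-plane where the
    exponential has modulus at most 1. *)
Lemma nm_cexp_sub1 (z : R[i]) : complex.Re z <= 0 -> nm (cexp z - 1) <= 2 * nm z.
Proof.
move=> z0.
have := @cder_mvt (fun s => cexp (z * s%:C)) (fun s => z * cexp (z * s%:C)) 0 1 (nm z) ler01.
rewrite mulr0 cexp0 mulr1 subr0 mulr1; apply.
- by move=> x _; apply: cder_cexp; apply: cder_ext (cderZ z (cder_id x)) _ _ => //; rewrite mulr1.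
- move=> x /andP[x0 _]; rewrite [leLHS]nmM; apply: ler_piMr; first exact: nm_ge0.
  rewrite nm_cexp -expR0 ler_expR cReM /= mulr0 subr0.
  by apply: mulr_le0_ge0.
Qed.

Lemma cder_under_integral (f d : R -> RT -> R[i]) (a u v : R) (G : RT -> R) :
  u < a < v -> (forall x, u < x < v -> cintegrable leb (f x)) ->
  (forall x y, u < x < v -> cder (f ^~ y) x (d x y)) ->
  (forall x y, u < x < v -> nm (d x y) <= G y) ->
  leb.-integrable setT (EFin \o G) ->
  cder (fun x => cintegral leb (f x)) a (cintegral leb (d a)).
Proof.
move=> auv fi fd dG iG.
have G0 y : 0 <= G y by rewrite (le_trans _ (dG a y auv))// nm_ge0.
have key (h e : R -> RT -> R) :
    (forall x, u < x < v -> leb.-integrable setT (EFin \o h x)) ->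
    (forall x y, u < x < v -> is_derive x (1 : R) (h ^~ y) (e x y)) ->
    (forall x y, u < x < v -> `|e x y| <= G y) ->
    is_derive a (1 : R) (fun x => \int[leb]_y h x y) (\int[leb]_y e a y).
  move=> hi hd eG.
  have Ia : `]u, v[%classic a by rewrite /= in_itv.
  have d1 x y : `]u, v[%classic x -> setT y -> derivable (h ^~ y) x 1.
    by rewrite /= in_itv/= => xuv _; case: (hd x y xuv).
  have dE x y : `]u, v[%classic x -> partial1of2 h x y = e x y.
    by rewrite /= in_itv/= => xuv; rewrite partial1of2E; case: (hd x y xuv).
  have b1 x y : `]u, v[%classic x -> setT y -> `|partial1of2 h x y| <= G y.
    by move=> xI _; rewrite dE//; move: xI; rewrite /= in_itv/= => xuv; exact: eG.
  have i1 x : `]u, v[%classic x -> leb.-integrable setT (EFin \o h x).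
    by rewrite /= in_itv/=; exact: hi.
  have D := @derivable_under_integral R _ RT leb h setT measurableT a u v Ia i1 d1 G G0 iG b1.
  have V := @differentiation_under_integral R _ RT leb h setT measurableT a u v Ia i1 d1 G G0 iG b1.
  apply: DeriveDef => //; rewrite -derive1E V; apply: eq_Rintegral => y _.
  exact: dE.
split.
- apply: (key (fun x y => complex.Re (f x y)) (fun x y => complex.Re (d x y))).
  + by move=> x /fi[].
  + by move=> x y /(fd x y)[].
  + by move=> x y /(dG x y); apply: le_trans; exact: Re_le_nm.
- apply: (key (fun x y => complex.Im (f x y)) (fun x y => complex.Im (d x y))).
  + by move=> x /fi[].
  + by move=> x y /(fd x y)[].
  + by move=> x y /(dG x y); apply: le_trans; exact: Im_le_nm.
Qed.

Lemma cintegral_exhaust (P : R -> bool) a b f F l : exhausts P a b ->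
  (forall x, P x -> cder F x (f x)) ->
  (forall x, P x -> exists d, cder f x d) ->
  cintegrable leb (fun x : RT => if P x then f x else 0) ->
  ccvg (fun n => F (b n) - F (a n)) l ->
  cintegral leb (fun x : RT => if P x then f x else 0) = l.
Proof.
move=> E dF df [i1 i2] /ccvgP[l1 l2].
have e1 : (fun x : RT => complex.Re (if P x then f x else 0)) =
  (fun x : RT => if P x then complex.Re (f x) else 0).
  by apply/funext => x; case: (P x).
have e2 : (fun x : RT => complex.Im (if P x then f x else 0)) =
  (fun x : RT => if P x then complex.Im (f x) else 0).
  by apply/funext => x; case: (P x).
apply: cplx_eq => /=.
- rewrite e1; apply: (@Rintegral_exhaust R P a b E (fun x => complex.Re (f x))
    (fun x => complex.Re (F x))).
  + by move=> x /dF[].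
  + by move=> x /df[d [h _]]; exact: is_derive_continuous h.
  + by rewrite -e1.
  + by under eq_fun do rewrite -cReN -cReD.
- rewrite e2; apply: (@Rintegral_exhaust R P a b E (fun x => complex.Im (f x))
    (fun x => complex.Im (F x))).
  + by move=> x /dF[].
  + by move=> x /df[d [_ h]]; exact: is_derive_continuous h.
  + by rewrite -e2.
  + by under eq_fun do rewrite -cImN -cImD.
Qed.

Lemma cder_cmeas P a b f : exhausts P a b ->
  (forall x, P x -> exists d, cder f x d) ->
  cmeas (fun x : RT => if P x then f x else 0).
Proof.
move=> E df; split.
- rewrite (_ : (fun x => _) = (fun x : RT => if P x then complex.Re (f x) else 0)).
    apply: (measurable_exhaust E) => x /df[d [h _]]; exact: is_derive_continuous h.
  by apply/funext => x; case: (P x).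
- rewrite (_ : (fun x => _) = (fun x : RT => if P x then complex.Im (f x) else 0)).
    apply: (measurable_exhaust E) => x /df[d [_ h]]; exact: is_derive_continuous h.
  by apply/funext => x; case: (P x).
Qed.

End ComplexDerivative.

(** * Integrals of exponentials and of Cauchy densities *)

Section BasicIntegrals.
Context {R : realType}.
Notation RT := (measurableTypeR R).
Notation leb := (@lebesgue_measure R).

Lemma cvgMl_pinfty (c : R) (u : nat -> R) : 0 < c -> u @ \oo --> +oo ->
  (fun n => c * u n) @ \oo --> +oo.
Proof.
by move=> c0 uoo; exact: (cvg_comp _ _ uoo (gt0_cvgMry c0 cvg_id)).
Qed.

Lemma is_derive_expM (c x : R) :
  is_derive x (1 : R) (fun t => expR (c * t)) (c * expR (c * x)).
Proof.
have h : is_derive x (1 : R) (fun t : R => c * t) c.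
  by apply: is_derive_ext (is_deriveZ c (is_derive_id x (1 : R))) _ _ => //;
    rewrite /GRing.scale /= mulr1.
apply: is_derive_ext (is_derive1_comp (is_derive_expR (c * x)) h) _ _ => //.
by rewrite /GRing.scale /= mulrC.
Qed.

Lemma integrable_expN P a b (c : R) : 0 < c -> exhausts P a b ->
  (forall n, 0 <= a n) ->
  leb.-integrable setT (EFin \o (fun x : RT => if P x then expR (- c * x) else 0)).
Proof.
move=> c0 E a0.
apply: (@integrable_exhaust R P a b E _ (fun x => - c^-1 * expR (- c * x)) _ _ c^-1).
- move=> x _; apply: is_derive_ext (is_deriveZ (- c^-1) (is_derive_expM (- c) x)) _ _ => //.
  by rewrite /GRing.scale /=; field; rewrite gt_eqF.
- by move=> x _; exact: is_derive_continuous (is_derive_expM (- c) x).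
- by move=> x _; exact: expR_ge0.
- move=> n; rewrite -mulrBr mulNr -mulrN opprB.
  rewrite (@le_trans _ _ (c^-1 * expR (- c * a n)))//.
    apply: ler_wpM2l; first by rewrite invr_ge0 ltW.
    by rewrite gerBl expR_ge0.
  apply: ler_piMr; first by rewrite invr_ge0 ltW.
  rewrite -expR0 ler_expR mulNr oppr_le0.
  by rewrite mulr_ge0// ltW.
Qed.

Lemma cder_cexpM (c : R[i]) (x : R) :
  cder (fun t => cexp (c * t%:C)) x (c * cexp (c * x%:C)).
Proof.
by apply: cder_cexp; apply: cder_ext (cderZ c (cder_id x)) _ _ => //; rewrite mulr1.
Qed.

Lemma cintegrable_cexpN P a b (c : R[i]) : 0 < complex.Re c -> exhausts P a b ->
  (forall n, 0 <= a n) ->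
  cintegrable leb (fun x : RT => if P x then cexp (- c * x%:C) else 0).
Proof.
move=> c0 E a0; apply: cintegrable_dom (integrable_expN c0 E a0) _.
- by apply: (cder_cmeas E) => x _; eexists; exact: cder_cexpM.
- move=> t; case: (P t); last by rewrite nm0.
  by rewrite nm_cexp cReM /= mulr0 subr0 cReN.
Qed.

Lemma cexpN_cvg0 (c : R[i]) (b : nat -> R) : 0 < complex.Re c ->
  b @ \oo --> +oo -> ccvg (fun n => cexp (- c * (b n)%:C)) 0.
Proof.
move=> c0 boo.
apply: (@ccvg_nm _ _ _ (fun n => expR (- (complex.Re c * b n)))).
  by move=> n; rewrite subr0 nm_cexp cReM /= mulr0 subr0 cReN mulNr.
have h : (fun n => complex.Re c * b n) @ \oo --> +oo.
  exact: cvgMl_pinfty.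
exact: (cvg_comp _ _ h (@cvgr_expR R)).
Qed.

Lemma cintegral_cexpN P a b (c : R[i]) : 0 < complex.Re c -> exhausts P a b ->
  (forall n, 0 <= a n) -> a @ \oo --> 0 -> b @ \oo --> +oo ->
  cintegral leb (fun x : RT => if P x then cexp (- c * x%:C) else 0) = c^-1.
Proof.
move=> c0 E a0 al bl.
have cn0 : c != 0 by apply/eqP => h; move: c0; rewrite h ltxx.
apply: (@cintegral_exhaust _ P a b _ (fun x => - c^-1 * cexp (- c * x%:C)) _ E).
- move=> x _; apply: cder_ext (cderZ (- c^-1) (cder_cexpM (- c) x)) _ _ => //.
  by rewrite mulrA mulrNN mulVf// mul1r.
- by move=> x _; eexists; exact: cder_cexpM.
- exact: cintegrable_cexpN E a0.
- have A := ccvgZ (- c^-1) (cexpN_cvg0 c0 bl).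
  have B := ccvgZ (c^-1) (ccvg_cexp (ccvgZ (- c) (ccvg_real al))).
  apply: ccvg_ext (ccvgD A B) _ _ => [n|]; first by rewrite -[in RHS]mulNr opprK.
  by rewrite !mulr0 cexp0 add0r mulr1.
Qed.

Lemma cvg_natS_pinfty : (fun n => n.+1%:R : R) @ \oo --> +oo.
Proof.
by rewrite (cvg_shiftS (fun n => n%:R : R)); exact: cvgr_idn.
Qed.

Lemma cintegral_cexpN_ge0 (c : R[i]) : 0 < complex.Re c ->
  cintegrable leb (fun x : RT => if 0 <= x then cexp (- c * x%:C) else 0) /\
  cintegral leb (fun x : RT => if 0 <= x then cexp (- c * x%:C) else 0) = c^-1.
Proof.
move=> c0; split.
  by apply: (cintegrable_cexpN c0 (@exhausts_ge0 R)).
apply: (cintegral_cexpN c0 (@exhausts_ge0 R)) => //; first exact: cvg_cst.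
exact: cvg_natS_pinfty.
Qed.

(** Both the closed and the open half-line occur, because two-sided integrals are split into [0 < y]
    and [0 <= - y]. *)
Lemma cintegral_cexpN_gt0 (c : R[i]) : 0 < complex.Re c ->
  cintegrable leb (fun x : RT => if 0 < x then cexp (- c * x%:C) else 0) /\
  cintegral leb (fun x : RT => if 0 < x then cexp (- c * x%:C) else 0) = c^-1.
Proof.
move=> c0; split.
  by apply: (cintegrable_cexpN c0 (@exhausts_gt0 R)) => n; rewrite /= invr_ge0.
apply: (cintegral_cexpN c0 (@exhausts_gt0 R)) => //.
- exact: (@cvg_harmonic R).
- by rewrite (cvg_shiftS (fun n => n.+1%:R : R)); exact: cvg_natS_pinfty.
Qed.

Lemma is_derive_atanM (c x : R) :
  is_derive x (1 : R) (fun t => atan (c * t)) (c / (1 + (c * x) ^+ 2)).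
Proof.
have h : is_derive x (1 : R) (fun t : R => c * t) c.
  by apply: is_derive_ext (is_deriveZ c (is_derive_id x (1 : R))) _ _ => //;
    rewrite /GRing.scale /= mulr1.
apply: is_derive_ext (is_derive1_comp (is_derive1_atan (c * x)) h) _ _ => //.
by rewrite /GRing.scale /= mulrC.
Qed.

Lemma onesqr_gt0 (y : R) : 0 < 1 + y ^+ 2.
Proof. by rewrite ltr_pwDl// sqr_ge0. Qed.

Lemma is_derive_cauchyV (c x : R) : exists d,
  is_derive x (1 : R) (fun t => (1 + (c * t) ^+ 2)^-1) d.
Proof.
have h : is_derive x (1 : R) (fun t : R => c * t) c.
  by apply: is_derive_ext (is_deriveZ c (is_derive_id x (1 : R))) _ _ => //;
    rewrite /GRing.scale /= mulr1.
have h2 := is_deriveD (is_derive_cst (1 : R) x (1 : R)) (is_deriveM h h).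
have n0 : (cst (1 : R) + (fun t : R => c * t) * (fun t : R => c * t)) x != 0.
  by rewrite [X in X != 0]/= gt_eqF// -expr2 onesqr_gt0.
by eexists; apply: is_derive_ext (is_deriveV n0 h2) _ _ => //.
Qed.

Lemma measurable_cauchyV (c : R) :
  measurable_fun setT (fun x : RT => (1 + (c * x) ^+ 2)^-1).
Proof.
have := @measurable_exhaust R xpredT _ _ (@exhaustsT R)
  (fun x => (1 + (c * x) ^+ 2)^-1); apply.
by move=> x _; have [d h] := is_derive_cauchyV c x; exact: is_derive_continuous h.
Qed.

Lemma is_derive_cauchy (c x : R) : exists d,
  is_derive x (1 : R) (fun t => c / (1 + (c * t) ^+ 2)) d.
Proof.
have [d h] := is_derive_cauchyV c x.
by exists (c *: d); apply: is_derive_ext (is_deriveZ c h) _ _.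
Qed.

Lemma cauchy_integral (c : R) : 0 < c ->
  leb.-integrable setT (EFin \o (fun x : RT => c / (1 + (c * x) ^+ 2))) /\
  \int[leb]_x (c / (1 + (c * x) ^+ 2)) = pi.
Proof.
move=> c0.
have i : leb.-integrable setT (EFin \o (fun x : RT => c / (1 + (c * x) ^+ 2))).
  apply: (@integrable_exhaust R xpredT _ _ (@exhaustsT R)
    (fun x => c / (1 + (c * x) ^+ 2)) (fun x => atan (c * x)) _ _ pi).
  - by move=> x _; exact: is_derive_atanM.
  - by move=> x _; have [d h] := is_derive_cauchy c x; exact: is_derive_continuous h.
  - by move=> x _; rewrite divr_ge0 ?ltW// onesqr_gt0.
  - move=> n; rewrite mulrN atanN opprK [leRHS]splitr; apply: lerD;
    exact/ltW/atan_ltpi2.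
split => //.
apply: (@Rintegral_exhaust R xpredT _ _ (@exhaustsT R)
    (fun x => c / (1 + (c * x) ^+ 2)) (fun x => atan (c * x))) => //.
- by move=> x _; exact: is_derive_atanM.
- by move=> x _; have [d h] := is_derive_cauchy c x; exact: is_derive_continuous h.
- have h : (fun n => c * n.+1%:R) @ \oo --> +oo.
    exact: (cvgMl_pinfty c0 cvg_natS_pinfty).
  have k := cvg_comp _ _ h (@cvgy_atan R).
  rewrite [X in _ --> X]splitr; under eq_fun do rewrite mulrN atanN opprK.
  exact: cvgD.
Qed.

End BasicIntegrals.

(** * The kernel *)

Section Kernel.
Context {R : realType} (N : nat) (N_gt2 : (2 < N)%N) (N_even : ~~ odd N).
Notation RT := (measurableTypeR R).
Notation leb := (@lebesgue_measure R).

Lemma expN_half (u : R) : u ^+ N = (u ^+ 2) ^+ N./2.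
Proof.
by rewrite -exprM mul2n -[in LHS](odd_double_half N) (negbTE N_even).
Qed.

Lemma expN_ge0 (u : R) : 0 <= u ^+ N.
Proof. by rewrite expN_half exprn_ge0// sqr_ge0. Qed.

Lemma expNN (u : R) : (- u) ^+ N = u ^+ N.
Proof. by rewrite !expN_half sqrrN. Qed.

(** The integrand of [heat_kernel] once [kappa * (- 'i * u) ^+ N] is reduced to [- u ^+ N] by
    [kappaE]. *)
Definition ek (t y u : R) : R[i] := cexp (- ('i * (y * u)%:C) - (t * u ^+ N)%:C).

Lemma nm_ek t y u : nm (ek t y u) = expR (- (t * u ^+ N)).
Proof.
rewrite nm_cexp; congr expR.
by rewrite !(cReN, cReD, cReM, cImM) /= !mul0r mul1r !subr0 oppr0 add0r.
Qed.

Lemma kappaE (u : R) : kappa R N * (- 'i * u%:C) ^+ N = - (u ^+ N)%:C.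
Proof.
rewrite /kappa exprMn [(- 'i) ^+ N]exprNn.
have -> : ('i : R[i]) ^+ N = (-1) ^+ N./2.
  rewrite -[in LHS](odd_double_half N) (negbTE N_even) add0n -mul2n exprM.
  by congr (_ ^+ _); apply: cplx_eq => /=; rewrite ?mul0r ?mulr0; ring.
have -> : (-1 : R[i]) ^+ N = 1 by rewrite -signr_odd (negbTE N_even).
rewrite mul1r mulrA -exprD -addnA addnn exprD expr1 -mul2n exprM sqrrN expr1n.
by rewrite expr1n mulr1 mulN1r RtoCX.
Qed.

Lemma heat_kernelE (t y : R) :
  heat_kernel N t y = ((2 * pi)^-1)%:C * cintegral leb (ek t y).
Proof.
rewrite /heat_kernel; congr (_ * _); apply: eq_cintegral => u.
rewrite /ek; congr cexp; rewrite mulNr; congr (_ + _).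
by rewrite mulrAC kappaE mulNr RtoCM [in RHS]mulrC.
Qed.

Lemma cder_ek (t y x : R) :
  cder (ek t y) x ((- ('i * y%:C) - (t * (N%:R * x ^+ N.-1))%:C) * ek t y x).
Proof.
apply: cder_cexp.
have h1 := cderZ (- ('i * y%:C)) (cder_id x).
have h2 := cderZ (- t%:C) (cderX N.-1 (cder_id x)).
apply: cder_ext (cderD h1 h2) _ _ => [u|].
  rewrite prednK ?(ltn_trans _ N_gt2)// RtoCM -mulNr RtoCM RtoCX.
  by congr (_ + _); rewrite ?mulNr ?mulrA.
rewrite prednK ?(ltn_trans _ N_gt2)// !mulr1.
by rewrite mulNr !RtoCM RtoCX RtoCn.
Qed.

Lemma poly_bound (P : {poly R}) : exists2 A : R, 0 <= A &
  forall v : R, `|P.[v]| <= A * (1 + v ^+ 2) ^+ size P.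
Proof.
exists (\sum_(i < size P) `|P`_i|); first exact: sumr_ge0.
move=> v; rewrite horner_coef mulr_suml (le_trans (ler_norm_sum _ _ _))//.
apply: ler_sum => i _; rewrite normrM ler_wpM2l// normrX.
have v1 : `|v| <= 1 + v ^+ 2.
  rewrite -(real_normK (num_real v)); have := normr_ge0 v; nra.
have s1 : 1 <= 1 + v ^+ 2 by rewrite lerDl sqr_ge0.
rewrite (@le_trans _ _ ((1 + v ^+ 2) ^+ i))//.
  by apply: lerXn2r => //; rewrite nnegrE ?(le_trans _ v1).
by apply: ler_weXn2l => //; exact/ltnW.
Qed.

Lemma expN_ge (v : R) : v ^+ 2 - 1 <= v ^+ N.
Proof.
rewrite expN_half; set s := v ^+ 2.
have s0 : 0 <= s by exact: sqr_ge0.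
have m1 : (0 < N./2)%N by rewrite half_gt0 ltnW.
have [s1|s1] := leP s 1.
  by rewrite (@le_trans _ _ 0)// ?subr_le0// exprn_ge0.
rewrite (@le_trans _ _ s)//; first by rewrite gerBl.
by rewrite -[leLHS]expr1; apply: ler_weXn2l => //; exact: ltW.
Qed.

(** With [s := 1 + v ^+ 2], the polynomial [Q] absorbs the denominator and is at most [A * s ^+ d].
    The power is beaten by the exponential series, [s ^+ d] being at most [d] factorial times
    [expR s], and [s - v ^+ N <= 2] by [expN_ge], which explains the constant [expR 2]. *)
Lemma poly_expN_bound (P : {poly R}) : exists2 C : R, 0 <= C &
  forall v : R, `|P.[v]| * expR (- (v ^+ N)) <= C / (1 + v ^+ 2).
Proof.
pose Q := P * (1 + 'X^2).
have [A A0 QA] := poly_bound Q.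
set d := size Q in QA.
exists (A * d`!%:R * expR 2); first by rewrite !mulr_ge0// expR_ge0.
move=> v; set s := 1 + v ^+ 2.
have s0 : 0 < s by exact: onesqr_gt0.
rewrite ler_pdivlMr// mulrAC.
have -> : `|P.[v]| * s = `|Q.[v]|.
  have -> : Q.[v] = P.[v] * s by rewrite /Q hornerM !hornerE.
  by rewrite normrM (gtr0_norm s0).
have sd : s ^+ d <= d`!%:R * expR s.
  case: d {QA} => [|d]; first by rewrite expr0 mul1r -expR0 ler_expR ltW.
  have := @expR_ge1Dxn R s d (ltW s0) => h.
  rewrite mulrC -ler_pdivrMr ?ltr0n ?fact_gt0//.
  by rewrite (le_trans _ h)// lerDr.
rewrite (@le_trans _ _ (A * (d`!%:R * expR s) * expR (- v ^+ N)))//.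
  apply: ler_wpM2r; first exact: expR_ge0.
  by rewrite (le_trans (QA v))// ler_wpM2l.
rewrite -!mulrA -expRD; do 2 (apply: ler_wpM2l => //).
by rewrite ler_expR; have := expN_ge v; rewrite /s; lra.
Qed.

Section Scale.
Variables (tau : R) (tau_gt0 : 0 < tau) (y : R).
Let t := tau ^+ N.

(* Integration by parts trades each factor [i y] in front of the kernel for a
   polynomial under the integral; four of them give the decay of the kernel. *)
Definition Aterm (P : {poly R}) (u : R) : R[i] := (P.[tau * u])%:C * ek t y u.
Definition Dpoly (P : {poly R}) : {poly R} := P^`() - (N%:R *: 'X^(N.-1)) * P.

Lemma nm_Aterm P u : nm (Aterm P u) = `|P.[tau * u]| * expR (- ((tau * u) ^+ N)).
Proof. by rewrite nmM nmR nm_ek /t exprMn. Qed.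

Lemma Aterm_bound P : exists2 C : R, 0 <= C & forall u,
  nm (Aterm P u) <= C * (tau / (1 + (tau * u) ^+ 2)).
Proof.
have [C C0 PC] := poly_expN_bound P.
exists (C / tau); first by rewrite divr_ge0// ltW.
move=> u; rewrite nm_Aterm (le_trans (PC _))//.
by rewrite mulrA divfK ?gt_eqF.
Qed.

Lemma cder_Aterm P (x : R) : cder (Aterm P) x
  (tau%:C * Aterm (Dpoly P) x - 'i * y%:C * Aterm P x).
Proof.
have h : is_derive x (1 : R) (fun u : R => tau * u) tau.
  by apply: is_derive_ext (is_deriveZ tau (is_derive_id x (1 : R))) _ _ => //;
    rewrite /GRing.scale /= mulr1.
have hp := is_derive1_comp (is_derive_poly P (tau * x)) h.
apply: cder_ext (cderM (cder_real hp) (cder_ek t y x)) _ _ => //.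
rewrite /Aterm /Dpoly /GRing.scale /= !hornerE /=.
have -> : t = tau * tau ^+ N.-1 by rewrite /t -exprS prednK// (ltn_trans _ N_gt2).
rewrite exprMn !(RtoCM, RtoCD, RtoCN).
ring.
Qed.

Lemma cmeas_Aterm P : cmeas (Aterm P : RT -> R[i]).
Proof.
have := @cder_cmeas R xpredT _ _ (Aterm P) (@exhaustsT R); apply.
by move=> x _; eexists; exact: cder_Aterm.
Qed.

Lemma cintegrable_Aterm P : cintegrable leb (Aterm P : RT -> R[i]).
Proof.
have [C C0 h] := Aterm_bound P.
apply: (cintegrable_dom (cmeas_Aterm P) _ h).
have [i _] := cauchy_integral tau_gt0.
by have := integrableZl measurableT C i.
Qed.

Lemma Aterm_cvg0 P (b : nat -> R) : (forall n, `|b n| = n.+1%:R) ->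
  ccvg (fun n => Aterm P (b n)) 0.
Proof.
move=> bn; have [C C0 h] := Aterm_bound P.
apply: (@ccvg_nm _ _ _ (fun n => C * harmonic n)).
  move=> n; rewrite subr0 (le_trans (h _))//; apply: ler_wpM2l => //.
  rewrite ler_pdivrMr ?onesqr_gt0// /= ler_pdivlMl ?ltr0n// -bn.
  rewrite -(real_normK (num_real (tau * b n))) normrM (gtr0_norm tau_gt0).
  have := normr_ge0 (b n); have := tau_gt0; nra.
rewrite -[X in _ --> X](mulr0 C); apply: cvgM; first exact: cvg_cst.
exact: cvg_harmonic.
Qed.

Lemma Aterm_parts P :
  'i * y%:C * cintegral leb (Aterm P) = tau%:C * cintegral leb (Aterm (Dpoly P)).
Proof.
have i1 := cintegrableZ tau%:C (cintegrable_Aterm (Dpoly P)).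
have i2 := cintegrableZ ('i * y%:C) (cintegrable_Aterm P).
apply/eqP; rewrite eq_sym -subr_eq0; apply/eqP.
rewrite -!cintegralZ; [|exact: cintegrable_Aterm..].
rewrite -cintegralB//.
apply: (@cintegral_exhaust R xpredT _ _ _ (Aterm P) 0 (@exhaustsT R)).
- by move=> x _; exact: cder_Aterm.
- by move=> x _; eexists; apply: cderB; apply: cderZ; exact: cder_Aterm.
- exact: (cintegrableD i1 (cintegrableN i2)).
- rewrite -[X in ccvg _ X](subr0 (0 : R[i])).
  have A := @Aterm_cvg0 P (fun n => n.+1%:R) (fun n => ger0_norm (ler0n _ _)).
  have B := @Aterm_cvg0 P (fun n => - n.+1%:R) (fun n => etrans (normrN _) (ger0_norm (ler0n _ _))).
  apply: ccvg_ext (ccvgD A (ccvgZ (-1) B)) _ _ => [n|]; first by rewrite mulN1r.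
  by rewrite mulr0 addr0 subr0.
Qed.

Lemma Aterm_parts_iter n P : ('i * y%:C) ^+ n * cintegral leb (Aterm P) =
  tau%:C ^+ n * cintegral leb (Aterm (iter n Dpoly P)).
Proof.
elim: n => [|n ih]; first by rewrite !expr0.
by rewrite exprS -mulrA ih mulrCA Aterm_parts mulrA -exprSr.
Qed.

End Scale.

Lemma ek_Aterm (tau y u : R) : ek (tau ^+ N) y u = Aterm tau y 1 u.
Proof.
have -> : Aterm tau y 1 u = 1 * ek (tau ^+ N) y u by rewrite /Aterm hornerC.
by rewrite mul1r.
Qed.

Lemma cmeas_ek (t y : R) : cmeas (ek t y : RT -> R[i]).
Proof.
have := @cder_cmeas R xpredT _ _ (ek t y) (@exhaustsT R); apply.
by move=> x _; eexists; exact: cder_ek.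
Qed.

(** The bound without integration by parts and the bound after four of them are added. Time is
    written [tau ^+ N] because lengths scale like [tau], so that one constant serves all times.
    Decay of order 4 instead of 2 leaves room for the extra factor [|y|] in [hk_bound], and an even
    order avoids absolute values. *)
Lemma heat_kernel_scale_bound : exists2 C : R, 0 <= C & forall tau y, 0 < tau ->
  nm (heat_kernel N (tau ^+ N) y) <= C * (tau^-1 / (1 + (tau^-1 * y) ^+ 4)).
Proof.
pose P4 := iter 4 Dpoly 1.
have [C0 C00 h0] := poly_expN_bound 1.
have [C4 C40 h4] := poly_expN_bound P4.
have pi0 : 0 < (2 * pi : R) by rewrite mulr_gt0// pi_gt0.
exists (C0 + C4) => [|tau y tau0]; first exact: addr_ge0.
have bnd P C : (forall v : R, `|P.[v]| * expR (- (v ^+ N)) <= C / (1 + v ^+ 2)) ->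
    nm (((2 * pi)^-1)%:C * cintegral leb (Aterm tau y P)) <= C * tau^-1.
  move=> h; have [ci ce] := cauchy_integral tau0.
  have h' u : nm (Aterm tau y P u) <= (C / tau) * (tau / (1 + (tau * u) ^+ 2)).
    by rewrite nm_Aterm (le_trans (h _))// mulrA divfK ?gt_eqF.
  have iC : leb.-integrable setT
      (EFin \o (fun u : RT => (C / tau) * (tau / (1 + (tau * u) ^+ 2)))).
    by have := integrableZl measurableT (C / tau) ci.
  have := nm_cintegral (cintegrable_Aterm tau0 y P) iC h'.
  rewrite RintegralZl// ce nmM nmR gtr0_norm ?invr_gt0// => k.
  by rewrite ler_pdivrMl// (le_trans k)// le_eqVlt; apply/orP; left; apply/eqP; ring.
have e0 : heat_kernel N (tau ^+ N) y = ((2 * pi)^-1)%:C * cintegral leb (Aterm tau y 1).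
  by rewrite heat_kernelE; congr (_ * _); apply: eq_cintegral => u; rewrite ek_Aterm.
have b0 := bnd _ _ h0; have b4 := bnd _ _ h4.
have e4 : ('i * y%:C) ^+ 4 * heat_kernel N (tau ^+ N) y =
    tau%:C ^+ 4 * (((2 * pi)^-1)%:C * cintegral leb (Aterm tau y P4)).
  by rewrite e0 mulrCA Aterm_parts_iter// mulrCA.
rewrite -e0 in b0.
have n4 : y ^+ 4 * nm (heat_kernel N (tau ^+ N) y) =
    tau ^+ 4 * nm (((2 * pi)^-1)%:C * cintegral leb (Aterm tau y P4)).
  have i1 : nm ('i : R[i]) = 1 by rewrite /= expr0n/= add0r expr1n sqrtr1.
  have ny : nm ('i * y%:C) = `|y| by rewrite nmM i1 mul1r nmR.
  have y4 : `|y| ^+ 4 = y ^+ 4.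
    by rewrite -normrX ger0_norm// (exprM y 2 2) sqr_ge0.
  rewrite -y4 -ny -nmX -nmM e4 [LHS]nmM nmX nmR (gtr0_norm tau0)//.
move: n4 b0 b4; set k := nm _; set k4 := nm _ => n4 b0 b4.
rewrite mulrA ler_pdivlMr; last first.
  by rewrite ltr_pwDl// (exprM _ 2 2) sqr_ge0.
have -> : k * (1 + (tau^-1 * y) ^+ 4) = k + k4.
  rewrite mulrDr mulr1 exprMn mulrCA [k * _]mulrC n4 mulrA exprVn.
  by rewrite mulVf ?mul1r// expf_neq0// gt_eqF.
by rewrite mulrDl lerD.
Qed.

End Kernel.

(** * Measurability of integrals depending on a parameter *)

Section ParametricMeasurability.
Context {R : realType} d1 d2 (T1 : measurableType d1) (T2 : measurableType d2).
Variable m2 : {sigma_finite_measure set T2 -> \bar R}.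

Lemma cmeas_cintegral (f : T1 * T2 -> R[i]) : cmeas f ->
  cmeas (fun x => cintegral m2 (fun y => f (x, y))).
Proof.
have key (h : T1 * T2 -> R) : measurable_fun setT h ->
    measurable_fun setT (fun x => \int[m2]_y h (x, y)).
  move=> /measurable_EFinP mh.
  apply: (measurableT_comp (fine_measurable measurableT)).
  rewrite (_ : (fun x => _) = (fun x => (\int[m2]_y (EFin \o h)^\+ (x, y)) -
      (\int[m2]_y (EFin \o h)^\- (x, y)))%E).
    apply: emeasurable_funB.
    - by apply: measurable_fun_fubini_tonelli_F => //; exact: measurable_funepos.
    - by apply: measurable_fun_fubini_tonelli_F => //; exact: measurable_funeneg.
  apply/funext => x; rewrite [LHS]integralE.
  by congr (_ - _)%E; apply: eq_integral => y _; rewrite ?funeposE ?funenegE.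
by move=> [f1 f2]; split; [exact: (key _ f1)|exact: (key _ f2)].
Qed.

End ParametricMeasurability.

(** * Fourier inversion *)

Section Fourier.
Context {R : realType}.
Notation RT := (measurableTypeR R).
Notation leb := (@lebesgue_measure R).

Lemma ii : ('i : R[i]) * 'i = -1.
Proof. by apply: cplx_eq => /=; ring. Qed.

Lemma Re_iM (w : R) (z : R[i]) : complex.Re ('i * w%:C + z) = complex.Re z.
Proof. by rewrite cReD cReM /= mul0r mulr0 subr0 add0r. Qed.

Lemma Re_imR (w : R) : complex.Re ('i * w%:C) = 0.
Proof. by rewrite cReM /= mul0r mulr0 subr0. Qed.

Lemma nm_cexp_i (w : R) : nm (cexp ('i * w%:C)) = 1.
Proof. by rewrite nm_cexp Re_imR expR0. Qed.

Lemma ccvg_eps (u : nat -> R[i]) l :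
  (forall e : R, 0 < e -> \forall n \near \oo, nm (u n - l) <= e) -> ccvg u l.
Proof.
move=> h; apply/ccvgP; split; apply/cvgrPdist_le => e e0; have := h e e0;
  apply: filterS => n; apply: le_trans.
- by rewrite -cReN -cReD -nmN opprB Re_le_nm.
- by rewrite -cImN -cImD -nmN opprB Im_le_nm.
Qed.

Lemma cintegral_two_sided (a b : R[i]) : 0 < complex.Re a -> 0 < complex.Re b ->
  cintegrable leb (fun y : RT => if 0 < y then cexp (- a * y%:C) else cexp (b * y%:C)) /\
  cintegral leb (fun y : RT => if 0 < y then cexp (- a * y%:C) else cexp (b * y%:C))
    = a^-1 + b^-1.
Proof.
move=> a0 b0.
have [i1 e1] := cintegral_cexpN_gt0 a0.
have [i2 e2] := cintegral_cexpN_ge0 b0.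
have [i3 e3] := cintegral_opp i2.
have E : (fun y : RT => if 0 < y then cexp (- a * y%:C) else cexp (b * y%:C)) =
  (fun y : RT => (if 0 < y then cexp (- a * y%:C) else 0) +
     (if 0 <= - y then cexp (- b * (- y)%:C) else 0)).
  apply/funext => y; rewrite oppr_ge0; case: ltP => h.
    by rewrite addr0.
  by rewrite add0r RtoCN mulrNN.
rewrite E; split; first exact: cintegrableD.
by rewrite cintegralD// e1 e3 e2.
Qed.

(** The transform of the Abel factor [expR (- e * |y|)] is a Poisson kernel, of mass [2 * pi] in
    [w], which concentrates at 0 as [e] tends to 0. *)
Lemma cauchy_fourier (e w : R) : 0 < e ->
  cintegrable leb (fun y : RT => cexp ('i * (y * w)%:C) * (expR (- e * `|y|))%:C) /\
  cintegral leb (fun y : RT => cexp ('i * (y * w)%:C) * (expR (- e * `|y|))%:C) =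
    (2 * (e^-1 / (1 + (e^-1 * w) ^+ 2)))%:C.
Proof.
move=> e0.
pose a : R[i] := e%:C - 'i * w%:C; pose b : R[i] := e%:C + 'i * w%:C.
have a0 : 0 < complex.Re a by rewrite /a cReD cReN Re_imR oppr0 addr0.
have b0 : 0 < complex.Re b by rewrite /b cReD Re_imR addr0.
have [] := cintegral_two_sided a0 b0.
have -> : (fun y : RT => if 0 < y then cexp (- a * y%:C) else cexp (b * y%:C)) =
    (fun y : RT => cexp ('i * (y * w)%:C) * (expR (- e * `|y|))%:C).
  apply/funext => y; rewrite -cexp_real -cexpD; case: ltP => h.
  - rewrite (gtr0_norm h); congr cexp; rewrite /a !(RtoCM, RtoCN); ring.
  - rewrite (ler0_norm h); congr cexp; rewrite /b !(RtoCM, RtoCN); ring.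
move=> i -> ; split => //.
have an0 : a != 0 by apply/eqP => h; move: a0; rewrite h ltxx.
have bn0 : b != 0 by apply/eqP => h; move: b0; rewrite h ltxx.
have ab : a * b = (e ^+ 2 + w ^+ 2)%:C.
  rewrite RtoCD !RtoCX /a /b.
  have -> : (e%:C - 'i * w%:C) * (e%:C + 'i * w%:C) = e%:C ^+ 2 - ('i * 'i) * w%:C ^+ 2 by ring.
  by rewrite ii mulN1r opprK.
have s0 : e ^+ 2 + w ^+ 2 != 0.
  by rewrite gt_eqF// ltr_pwDl ?exprn_gt0// sqr_ge0.
have -> : 2 * (e^-1 / (1 + (e^-1 * w) ^+ 2)) = 2 * e / (e ^+ 2 + w ^+ 2).
  have e1 : e != 0 by rewrite gt_eqF.
  have : 1 + (e^-1 * w) ^+ 2 != 0 by rewrite gt_eqF// onesqr_gt0.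
  by move=> h; field; rewrite e1 s0.
have -> : a^-1 + b^-1 = (a + b) / (a * b) by field; rewrite an0 bn0.
rewrite ab [in RHS]RtoCM RtoCV; congr (_ / _).
by rewrite /a /b RtoCM RtoCn; ring.
Qed.

Section Inversion.
Variables (f : RT -> R[i]) (B : R) (u : R).
Hypothesis fi : cintegrable leb f.
Hypothesis fB : forall v, nm (f v) <= B.
Hypothesis fc : forall e : R, 0 < e -> exists2 d : R, 0 < d &
  forall v, `|v| < d -> nm (f (v + u) - f u) <= e.
Let F (y : RT) := cintegral leb (fun v : RT => f v * cexp (- ('i * (y * v)%:C))).
Hypothesis Fi : cintegrable leb F.

Let e_ n : R := n.+1%:R^-1.
Let e0 n : 0 < e_ n. Proof. by rewrite invr_gt0. Qed.
Let rho n (y : RT) : R := expR (- e_ n * `|y|).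
(** Abel means of the inversion integral, computed in two ways. Dominated convergence removes the
    damping ([I_cvg]), while Fubini turns the mean into an average of [f] around [u] against a
    Poisson kernel of width [1 / n.+1] ([I_E]), for which continuity of [f] at the single point [u]
    is enough ([I_cvg2]). *)
Let I_ n := cintegral leb (fun y : RT => F y * cexp ('i * (y * u)%:C) * (rho n y)%:C).

Let mrho n : measurable_fun setT (rho n).
Proof.
apply: (measurableT_comp (@measurable_expR R)).
apply: measurable_funM => //.
Qed.

Let mei (w : R) : cmeas (fun y : RT => cexp ('i * (y * w)%:C)).
Proof.
apply: cmeas_cexp; apply: cmeasM; first exact: cmeas_cst.
by apply: cmeas_real; exact: measurable_funM.
Qed.

Let I_cvg : ccvg I_ (cintegral leb (fun y : RT => F y * cexp ('i * (y * u)%:C))).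
Proof.
apply: (cintegral_dct (g := fun y => nm (F y)) _ _ _ _).2.
- move=> n; apply: cmeasM; last by apply: cmeas_real; exact: mrho.
  apply: cmeasM; [exact: (cintegrable_cmeas Fi)|exact: mei].
- move=> y; rewrite -[X in ccvg _ X]mulr1; apply: ccvgM; first exact: ccvg_cst.
  rewrite -[X in ccvg _ X]/((1 : R)%:C); apply: ccvg_real.
  have h : (fun n => - e_ n * `|y|) @ \oo --> - 0 * `|y|.
    by apply: cvgM; [apply: cvgN; exact: cvg_harmonic|exact: cvg_cst].
  have := cvg_comp _ _ h (@continuous_expR R _).
  by rewrite oppr0 mul0r expR0.
- exact: integrable_nm.
- move=> n y; rewrite 2!nmM nm_cexp_i mulr1 nmR ger0_norm ?expR_ge0//.
  rewrite ler_piMr ?nm_ge0// -expR0 ler_expR mulNr oppr_le0.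
  by rewrite mulr_ge0// ltW.
Qed.

Let I_E n : I_ n = cintegral leb (fun v : RT =>
  f (v + u) * (2 * (n.+1%:R / (1 + (n.+1%:R * v) ^+ 2)))%:C).
Proof.
have mf := cintegrable_cmeas fi.
pose H (y v : RT) := f v * (cexp ('i * (y * (u - v))%:C) * (rho n y)%:C).
have -> : I_ n = cintegral leb (fun y : RT => cintegral leb (fun v : RT => H y v)).
  apply: eq_cintegral => y.
  have fe : cintegrable leb (fun v : RT => f v * cexp (- ('i * (y * v)%:C))).
    apply: (cintegrable_dom _ (integrable_nm fi) _) => [|v]; last first.
      by rewrite nmM nm_cexp cReN Re_imR oppr0 expR0 mulr1.
    apply: cmeasM => //; apply: cmeas_cexp.
    under eq_fun do rewrite -mulrN -RtoCN.
    apply: cmeasM; first exact: cmeas_cst.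
    by apply: cmeas_real; apply: measurableT_comp => //; exact: measurable_funM.
  rewrite /F -(cintegralZr _ fe) -(cintegralZr _ (cintegrableZr _ fe)).
  have A (a b c z : R[i]) : a * b * c * z = a * (b * c * z) by ring.
  apply: eq_cintegral => v; rewrite /H A -cexpD; congr (_ * (cexp _ * _)).
  by rewrite mulrBr RtoCD RtoCN; ring.
have [ri _] := cauchy_fourier 0 (e0 n).
have rhoi : leb.-integrable setT (EFin \o rho n).
  have := integrable_nm ri; congr (_.-integrable _ _).
  apply/funext => y; congr EFin.
  by rewrite nmM nm_cexp_i mul1r nmR ger0_norm ?expR_ge0.
rewrite cfubini; last first.
  apply: (cintegrable_prodM (g := fun v => nm (f v)) (h := rho n)) => //.
  - apply: cmeasM; first exact: (cmeas_comp mf (@measurable_snd _ _ _ _)).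
    apply: cmeasM; last first.
      by apply: cmeas_real; exact: (measurableT_comp (mrho n) (@measurable_fst _ _ _ _)).
    apply: cmeas_cexp; apply: cmeasM; first exact: cmeas_cst.
    apply: cmeas_real; apply: measurable_funM => //.
    exact: measurable_funB.
  - by move=> y v; rewrite /H 2!nmM nm_cexp_i mul1r nmR ger0_norm ?expR_ge0// mulrC.
  - exact: integrable_nm.
pose G (v : RT) := f v * (2 * (n.+1%:R / (1 + (n.+1%:R * (u - v)) ^+ 2)))%:C.
have GE (v : RT) : cintegral leb (fun y : RT => H y v) = G v.
  have [i e] := cauchy_fourier (u - v) (e0 n).
  by rewrite /H cintegralZ// e /e_ invrK.
rewrite (eq_cintegral _ GE).
have Gi : cintegrable leb G.
  apply: (@cintegrable_dom _ _ _ _ _ (fun v => nm (f v) * (2 * n.+1%:R))).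
  - apply: cmeasM => //; apply: cmeas_real; apply: measurable_funM => //.
    apply: measurable_funM => //.
    apply: (measurableT_comp (f := fun z : R => (1 + (n.+1%:R * z) ^+ 2)^-1)
      (g := fun v : RT => u - v)); last exact: measurable_funB.
    exact: measurable_cauchyV.
  - by have := integrableZr measurableT (2 * n.+1%:R) (integrable_nm fi).
  - move=> v; rewrite nmM ler_wpM2l ?nm_ge0// nmR ger0_norm.
      rewrite ler_pM2l// ler_pdivrMr ?onesqr_gt0// ler_peMr//.
      by rewrite lerDl sqr_ge0.
    by rewrite mulr_ge0// divr_ge0// ltW// onesqr_gt0.
rewrite -(cintegral_shift u Gi).2; apply: eq_cintegral => v.
by rewrite /G; congr (_ * (2 * (_ / (1 + _)))%:C); rewrite opprD addrCA subrr addr0 mulrN sqrrN.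
Qed.

Let I_cvg2 : ccvg I_ ((2 * pi)%:C * f u).
Proof.
have B0 : 0 <= B by rewrite (le_trans _ (fB u))// nm_ge0.
apply: ccvg_eps => e e_gt0.
have pi0 : 0 < (pi : R) by exact: pi_gt0.
(* The Poisson kernel has mass [2 * pi] and [nm_cintegral] costs a factor 2, so a variation of
   [e / (8 * pi)] near [u] contributes [e / 2]; the rest contributes [K / n.+1]. *)
have [d d0 hd] := fc (divr_gt0 e_gt0 (mulr_gt0 (ltr0n _ 8) pi0)).
pose K : R := 8 * B * (1 + d ^- 2) * pi.
have dd0 : 0 <= 1 + d ^- 2 by rewrite addr_ge0// invr_ge0 sqr_ge0.
have K0 : 0 <= K by rewrite /K mulr_ge0 ?(ltW pi0)// mulr_ge0// mulr_ge0.
near=> n.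
have n0 : 0 < n.+1%:R :> R by rewrite ltr0n.
have [ci ce] := cauchy_integral n0.
have [ci1 ce1] := cauchy_integral (ltr01 : 0 < 1 :> R).
have icc : cintegrable leb (fun v : RT => (2 * (n.+1%:R / (1 + (n.+1%:R * v) ^+ 2)))%:C).
  split; last exact: integrable0.
  by have := integrableZl measurableT 2 ci.
have cE : cintegral leb (fun v : RT => (2 * (n.+1%:R / (1 + (n.+1%:R * v) ^+ 2)))%:C)
    = (2 * pi)%:C.
  apply: cplx_eq => /=; first by rewrite RintegralZl// ce.
  by rewrite /Rintegral integral0.
have [fi' _] := cintegral_shift u fi.
have ifc : cintegrable leb (fun v : RT =>
    f (v + u) * (2 * (n.+1%:R / (1 + (n.+1%:R * v) ^+ 2)))%:C).
  apply: (@cintegrable_dom _ _ _ _ _ (fun v : RT => B *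
     (2 * (n.+1%:R / (1 + (n.+1%:R * v) ^+ 2))))).
  - by apply: cmeasM; [exact: cintegrable_cmeas fi'|exact: cintegrable_cmeas icc].
  - by have := integrableZl measurableT B icc.1.
  - move=> v; rewrite nmM nmR ger0_norm ?ler_wpM2r//.
      by rewrite mulr_ge0// divr_ge0// ltW// onesqr_gt0.
    by rewrite mulr_ge0// divr_ge0// ltW// onesqr_gt0.
rewrite I_E -cE mulrC -cintegralZ// -cintegralB//; last exact: cintegrableZ.
(* The second term covers [d <= |v|]: there the variation of [f] is at most [2 * B], the kernel is
   at most twice [1 / (n.+1 * v ^+ 2)], and [1 / v ^+ 2 <= (1 + d ^- 2) / (1 + v ^+ 2)]. *)
pose g (v : RT) : R := e / (8 * pi) * (2 * (n.+1%:R / (1 + (n.+1%:R * v) ^+ 2))) +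
  4 * B * (1 + d ^- 2) / n.+1%:R * (1 / (1 + (1 * v) ^+ 2)).
have gi : leb.-integrable setT (EFin \o g).
  have h1 := integrableZl measurableT (e / (8 * pi)) icc.1.
  have h2 := integrableZl measurableT (4 * B * (1 + d ^- 2) / n.+1%:R) ci1.
  by have := integrableD measurableT h1 h2.
have gI : \int[leb]_v g v = e / 4 + K / 2 / n.+1%:R.
  have h1 := integrableZl measurableT (e / (8 * pi)) icc.1.
  have h2 := integrableZl measurableT (4 * B * (1 + d ^- 2) / n.+1%:R) ci1.
  rewrite (RintegralD measurableT h1 h2).
  rewrite (RintegralZl (e / (8 * pi)) measurableT icc.1).
  rewrite (RintegralZl 2 measurableT ci) ce.
  rewrite (RintegralZl (4 * B * (1 + d ^- 2) / n.+1%:R) measurableT ci1) ce1 /K.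
  move: (pi : R) pi0 => p p0; field.
  by rewrite nat1r pnatr_eq0 (gt_eqF d0) (gt_eqF p0).
apply: (@le_trans _ _ (2 * \int[leb]_v g v)).
  apply: nm_cintegral => //.
    by apply: cintegrableD => //; apply: cintegrableN; exact: cintegrableZ.
  move=> v; rewrite -mulrBl nmM nmR.
  have q0 : 0 <= n.+1%:R / (1 + (n.+1%:R * v) ^+ 2).
    by rewrite divr_ge0// ltW// onesqr_gt0.
  rewrite (ger0_norm (mulr_ge0 _ q0))//.
  have t1 : 0 <= e / (8 * pi) * (2 * (n.+1%:R / (1 + (n.+1%:R * v) ^+ 2))).
    apply: mulr_ge0; last by rewrite mulr_ge0.
    by rewrite divr_ge0 ?(ltW e_gt0)// mulr_ge0// ltW.
  have t2 : 0 <= 4 * B * (1 + d ^- 2) / n.+1%:R * (1 / (1 + (1 * v) ^+ 2)).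
    apply: mulr_ge0; last by rewrite divr_ge0// ltW// onesqr_gt0.
    by rewrite divr_ge0// mulr_ge0// mulr_ge0.
  have [vd|vd] := ltP `|v| d.
    rewrite /g -[leLHS]addr0; apply: lerD => //.
    by apply: ler_wpM2r; [rewrite mulr_ge0|exact: hd].
  rewrite /g -[leLHS]add0r; apply: lerD => //.
  apply: (@le_trans _ _ ((2 * B) * (2 * (n.+1%:R / (1 + (n.+1%:R * v) ^+ 2))))).
    apply: ler_wpM2r; first by rewrite mulr_ge0.
    by apply: le_trans (nmB _ _) _; rewrite mulrDl mul1r lerD.
  have -> : 2 * B * (2 * (n.+1%:R / (1 + (n.+1%:R * v) ^+ 2))) =
    4 * B * (n.+1%:R / (1 + (n.+1%:R * v) ^+ 2)) by ring.
  rewrite -!mulrA; apply: ler_wpM2l => //; apply: ler_wpM2l => //.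
  have v2 : d ^+ 2 <= v ^+ 2 by rewrite -(real_normK (num_real v)) lerXn2r// nnegrE ltW.
  have v20 : 0 < v ^+ 2 by rewrite (lt_le_trans _ v2)// exprn_gt0.
  rewrite !mul1r.
  have q1 := onesqr_gt0 (n.+1%:R * v); have q2 := onesqr_gt0 v.
  have s1 : n.+1%:R / (1 + (n.+1%:R * v) ^+ 2) <= n.+1%:R^-1 / v ^+ 2.
    rewrite -invfM ler_pdivrMr// ler_pdivlMl; last exact: mulr_gt0.
    by rewrite exprMn; nra.
  apply: (le_trans s1); rewrite mulrCA; apply: ler_wpM2l; first by rewrite invr_ge0.
  rewrite ler_pdivlMr// mulrDr mulr1 mulVf ?gt_eqF//.
  by rewrite addrC lerD2l lef_pV2// posrE exprn_gt0.
rewrite gI mulrDr.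
have -> : 2 * (e / 4) = e / 2 by field.
rewrite [leRHS]splitr lerD2l.
have -> : 2 * (K / 2 / n.+1%:R) = K / n.+1%:R by field.
rewrite ler_pdivrMr// -ler_pdivrMl ?divr_gt0//.
rewrite (@le_trans _ _ n%:R)// ?ler_nat//.
by near: n; exact: nbhs_infty_ger.
Unshelve. all: by end_near. Qed.

Lemma fourier_inversion :
  cintegral leb (fun y : RT => F y * cexp ('i * (y * u)%:C)) = (2 * pi)%:C * f u.
Proof. exact: (ccvg_unique I_cvg I_cvg2). Qed.

End Inversion.
End Fourier.

Lemma cder_eps {R : realType} (f : R -> R[i]) (u : R) d : cder f u d ->
  forall e : R, 0 < e -> exists2 d : R, 0 < d &
  forall v, `|v| < d -> nm (f (v + u) - f u) <= e.
Proof.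
move=> [f1 f2] e e0.
have e2 : 0 < e / 2 by rewrite divr_gt0.
have c1 := is_derive_continuous f1; have c2 := is_derive_continuous f2.
move/cvgrPdist_lt : c1 => /(_ _ e2)/nbhs_ballP[d1 /= d10 h1].
move/cvgrPdist_lt : c2 => /(_ _ e2)/nbhs_ballP[d2 /= d20 h2].
exists (Num.min d1 d2); first by rewrite lt_min d10.
move=> v; rewrite lt_min => /andP[v1 v2].
have b d' : `|v| < d' -> ball u d' (v + u) by rewrite /ball/= opprD addrCA subrr addr0 normrN.
rewrite (le_trans (nm_le _))// [leRHS]splitr lerD// ltW//.
- by rewrite cReD cReN distrC; exact: h1 (b _ v1).
- by rewrite cImD cImN distrC; exact: h2 (b _ v2).
Qed.

(** * Bounds, characteristic function and semigroup property of the kernel *)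

Section KernelFacts.
Context {R : realType} (N : nat) (N_gt2 : (2 < N)%N) (N_even : ~~ odd N).
Notation RT := (measurableTypeR R).
Notation leb := (@lebesgue_measure R).
Notation hk := (@heat_kernel R N).

(** The length scale of the kernel at time [t]. *)
Definition tscale (t : R) : R := t `^ (N%:R^-1).

Lemma tscale_gt0 t : 0 < t -> 0 < tscale t.
Proof. exact: powR_gt0. Qed.

Lemma tscaleX t : 0 < t -> tscale t ^+ N = t.
Proof.
move=> t0; rewrite -powR_mulrn ?ltW ?tscale_gt0// /tscale -powRrM mulVf.
  by rewrite powRr1// ltW.
by rewrite pnatr_eq0 -lt0n (ltn_trans _ N_gt2).
Qed.

Definition cauchyd (c y : R) : R := c / (1 + (c * y) ^+ 2).

(** For [z := y / tscale t], both [1 + z ^+ 2] and [|z| * (1 + z ^+ 2)] are at most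
    [2 * (1 + z ^+ 4)]. The first bound controls the total variation of the kernel uniformly in
    time; the second controls its first absolute moment by [tscale t]. *)
Lemma hk_bound : exists2 C : R, 0 <= C & forall t y : R, 0 < t ->
  nm (hk t y) <= C * cauchyd (tscale t)^-1 y /\
  `|y| * nm (hk t y) <= C * tscale t * cauchyd (tscale t)^-1 y.
Proof.
have [C C0 h] := heat_kernel_scale_bound (R := R) N_gt2 N_even.
exists (2 * C) => [|t y t0]; first by rewrite mulr_ge0.
have := h _ y (tscale_gt0 t0); rewrite tscaleX//.
have := tscale_gt0 t0; set s := tscale t => s0 hb.
rewrite /cauchyd; set k := nm _ in hb *; set z := s^-1 * y in hb *.
have k0 : 0 <= k by exact: nm_ge0.
have si : 0 < s^-1 by rewrite invr_gt0.
have z2 := onesqr_gt0 z.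
have z4 : 0 < 1 + z ^+ 4 by rewrite ltr_pwDl// (exprM z 2 2) sqr_ge0.
have hb' : k * (1 + z ^+ 4) <= C * s^-1 by rewrite -ler_pdivlMr// -mulrA.
have yz : `|y| = s * `|z|.
  by rewrite /z normrM gtr0_norm// mulrA mulfV ?mul1r// gt_eqF.
split; rewrite !mulrA ler_pdivlMr//.
- apply: (@le_trans _ _ (2 * (k * (1 + z ^+ 4)))); last first.
    by rewrite -!mulrA ler_wpM2l// mulrA.
  have : 1 + z ^+ 2 <= 2 * (1 + z ^+ 4) by rewrite (exprM z 2 2); nra.
  by move=> q; rewrite mulrCA ler_wpM2l.
- have -> : 2 * C * s * s^-1 = s * (2 * (C * s^-1)) by ring.
  apply: (@le_trans _ _ (s * (2 * (k * (1 + z ^+ 4))))); last first.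
    by apply: ler_wpM2l (ltW s0) _ _ _; apply: ler_wpM2l.
  have -> : `|y| * k * (1 + z ^+ 2) = s * (k * (`|z| * (1 + z ^+ 2))) by rewrite yz; ring.
  have -> : s * (2 * (k * (1 + z ^+ 4))) = s * (k * (2 * (1 + z ^+ 4))) by ring.
  apply: ler_wpM2l (ltW s0) _ _ _; apply: ler_wpM2l => //.
  have -> : z ^+ 4 = (`|z| ^+ 2) ^+ 2.
    by rewrite -exprM -normrX ger0_norm// (exprM z 2 2) sqr_ge0.
  rewrite -(real_normK (num_real z)).
  by have := normr_ge0 z; nra.
Qed.

Lemma cmeas_hk2 : cmeas (fun q : RT * RT => hk q.1 q.2).
Proof.
rewrite (_ : (fun q => _) = (fun q : RT * RT =>
    ((2 * pi)^-1)%:C * cintegral leb (fun u : RT => ek N q.1 q.2 u))); last first.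
  by apply/funext => q; rewrite heat_kernelE.
apply: cmeasM; first exact: cmeas_cst.
apply: (cmeas_cintegral leb (f := fun p : (RT * RT) * RT => ek N p.1.1 p.1.2 p.2)).
have m1 : measurable_fun setT (fun p : (RT * RT) * RT => p.1.1).
  exact: (measurableT_comp (@measurable_fst _ _ _ _) (@measurable_fst _ _ _ _)).
have m2 : measurable_fun setT (fun p : (RT * RT) * RT => p.1.2).
  exact: (measurableT_comp (@measurable_snd _ _ _ _) (@measurable_fst _ _ _ _)).
have m3 : measurable_fun setT (fun p : (RT * RT) * RT => p.2) by exact: measurable_snd.
apply: cmeas_cexp.
rewrite (_ : (fun t => _) = (fun p : (RT * RT) * RT =>
  (-1) * 'i * (p.1.2 * p.2)%:C + (-1) * (p.1.1 * p.2 ^+ N)%:C)); last first.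
  by apply/funext => p; rewrite mulN1r mulNr mulN1r.
apply: cmeasD; (apply: cmeasM; first exact: cmeas_cst); apply: cmeas_real.
- exact: measurable_funM.
- by apply: measurable_funM => //; exact: measurable_funX.
Qed.

Lemma cmeas_hk t : cmeas (hk t : RT -> R[i]).
Proof. exact: (cmeas_comp cmeas_hk2 (measurable_pair1 (t : RT))). Qed.

Lemma integrable_cauchyd c : 0 < c ->
  leb.-integrable setT (EFin \o (cauchyd c : RT -> R)).
Proof. by move=> c0; have [] := cauchy_integral c0. Qed.

Lemma cintegrable_hk t : 0 < t -> cintegrable leb (hk t : RT -> R[i]).
Proof.
move=> t0; have [C C0 h] := hk_bound.
apply: (cintegrable_dom (cmeas_hk t) _ (fun y => (h t y t0).1)).
have := integrable_cauchyd (c := (tscale t)^-1); rewrite invr_gt0 tscale_gt0// => /(_ isT) i.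
by have := integrableZl measurableT C i.
Qed.

Lemma cintegrable_ek t y : 0 < t -> cintegrable leb (ek N t y : RT -> R[i]).
Proof.
move=> t0; rewrite -(tscaleX t0).
rewrite (_ : ek _ _ _ = Aterm N (tscale t) y 1); last first.
  by apply/funext => u; rewrite ek_Aterm.
exact: (cintegrable_Aterm N_gt2 N_even (tscale_gt0 t0)).
Qed.

Lemma hk_even t y : 0 < t -> hk t (- y) = hk t y.
Proof.
move=> t0; rewrite !heat_kernelE//; congr (_ * _).
rewrite -(cintegral_opp (cintegrable_ek (- y) t0)).2.
by apply: eq_cintegral => u; rewrite /ek expNN// mulrNN.
Qed.

Lemma expN_integrable t : 0 < t ->
  leb.-integrable setT (EFin \o (fun v : RT => expR (- (t * v ^+ N)))).
Proof.
move=> t0; have := integrable_nm (cintegrable_ek 0 t0).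
by under eq_fun do rewrite nm_ek.
Qed.

(** Up to the factor [2 * pi], the kernel is the Fourier transform of [f], so this is Fourier
    inversion for [f]. *)
Lemma hk_charfn t u : 0 < t ->
  cintegral leb (fun y : RT => hk t y * cexp ('i * (y * u)%:C)) =
  (expR (- (t * u ^+ N)))%:C.
Proof.
move=> t0.
pose f (v : RT) : R[i] := (expR (- (t * v ^+ N)))%:C.
have fE v : f v = ek N t 0 v.
  by rewrite /f /ek mul0r mulr0 oppr0 add0r -RtoCN cexp_real.
have fi : cintegrable leb f by rewrite (funext fE); exact: cintegrable_ek.
have FE y : cintegral leb (fun v : RT => f v * cexp (- ('i * (y * v)%:C))) =
    (2 * pi)%:C * hk t y.
  rewrite heat_kernelE// mulrA -RtoCM mulfV ?mul1r; last first.
    by rewrite mulf_neq0// gt_eqF// pi_gt0.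
  rewrite -[RHS]mul1r mul1r; apply: eq_cintegral => v.
  by rewrite /f -cexp_real -cexpD addrC RtoCN.
have := @fourier_inversion R f 1 u fi.
rewrite (_ : (fun y => cintegral leb _) = (fun y : RT => (2 * pi)%:C * hk t y)); last first.
  by apply/funext => y; exact: FE.
have hki := cintegrable_hk t0.
have hke : cintegrable leb (fun y : RT => hk t y * cexp ('i * (y * u)%:C)).
  apply: (cintegrable_dom _ (integrable_nm hki)); last first.
    by move=> y; rewrite nmM nm_cexp_i mulr1.
  apply: cmeasM; first exact: cmeas_hk.
  apply: cmeas_cexp; apply: cmeasM; first exact: cmeas_cst.
  by apply: cmeas_real; exact: measurable_funM.
move=> H.
have pn0 : (2 * pi)%:C != 0 :> R[i].
  by rewrite RtoC_eq0 mulf_neq0// gt_eqF// pi_gt0.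
apply: (mulfI pn0); rewrite -/(f u) -H.
- rewrite -cintegralZ//; apply: eq_cintegral => y.
  have A (a b c : R[i]) : a * (b * c) = a * b * c by ring.
  by rewrite FE; exact: A.
- move=> v; rewrite nmR ger0_norm ?expR_ge0// -expR0 ler_expR oppr_le0.
  by apply: mulr_ge0; [exact: ltW|exact: expN_ge0].
- have cf : cder f u ((- ('i * 0%:C) - (t * (N%:R * u ^+ N.-1))%:C) * ek N t 0 u).
    by apply: cder_ext (cder_ek N_gt2 t 0 u) _ _ => [v|]//; rewrite fE.
  exact: cder_eps cf.
- exact: cintegrableZ.
Qed.

(** Only the first factor is expanded as a Fourier integral. The integral over [y] is then the
    characteristic function of the second factor, and the exponentials in [s] and [t] multiply. *)
Lemma hk_semigroup s t x : 0 < s -> 0 < t ->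
  cintegral leb (fun y : RT => hk s (x - y) * hk t y) = hk (s + t) x.
Proof.
move=> s0 t0; have hti := cintegrable_hk t0.
have A (a b c : R[i]) : a * b * c = a * (b * c) by ring.
have e1 (y : RT) : hk s (x - y) * hk t y = ((2 * pi)^-1)%:C *
    cintegral leb (fun v : RT => ek N s (x - y) v * hk t y).
  by rewrite cintegralZr ?heat_kernelE// ?A//; exact: cintegrable_ek.
have ei : cintegrable (leb \x leb)%E (fun q : RT * RT => ek N s (x - q.1) q.2 * hk t q.1).
  refine (@cintegrable_prodM R _ _ RT RT leb leb
    (fun q : RT * RT => ek N s (x - q.1) q.2 * hk t q.1)
    (fun v => expR (- (s * v ^+ N))) (fun y => nm (hk t y)) _ _ _ _).
  - apply: cmeasM; last exact: (cmeas_comp (cmeas_hk t) (@measurable_fst _ _ _ _)).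
    apply: cmeas_cexp.
    rewrite (_ : (fun q => _) = (fun q : RT * RT =>
      (-1) * 'i * ((x - q.1) * q.2)%:C + (-1) * (s * q.2 ^+ N)%:C)); last first.
      by apply/funext => p; rewrite mulN1r mulNr mulN1r.
    apply: cmeasD; (apply: cmeasM; first exact: cmeas_cst); apply: cmeas_real.
    + apply: measurable_funM; last exact: measurable_snd.
      by apply: measurable_funB => //; exact: measurable_fst.
    + by apply: measurable_funM => //; apply: measurable_funX; exact: measurable_snd.
  - by move=> y v; rewrite nmM nm_ek mulrC.
  - exact: expN_integrable.
  - exact: integrable_nm.
rewrite (eq_cintegral _ e1) cintegralZ; last exact: (cintegral12 ei).1.
rewrite [RHS]heat_kernelE//; congr (_ * _).
rewrite (cfubini ei); apply: eq_cintegral => v.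
have e2 (y : RT) : ek N s (x - y) v * hk t y = ek N s x v * (hk t y * cexp ('i * (y * v)%:C)).
  have -> : ek N s (x - y) v = ek N s x v * cexp ('i * (y * v)%:C).
    by rewrite -cexpD; congr cexp; rewrite mulrBl RtoCD RtoCN; ring.
  by ring.
rewrite (eq_cintegral _ e2) cintegralZ.
  rewrite hk_charfn// -cexp_real -cexpD; congr cexp.
  by rewrite mulrDl !RtoCD RtoCN opprD addrA.
apply: (cintegrable_dom _ (integrable_nm hti)); last first.
  by move=> y; rewrite nmM nm_cexp_i mulr1.
apply: cmeasM; first exact: cmeas_hk.
apply: cmeas_cexp; apply: cmeasM; first exact: cmeas_cst.
by apply: cmeas_real; exact: measurable_funM.
Qed.

End KernelFacts.

(** * The roots of kappa *)

Section Roots.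
Context {R : realType} (N : nat) (N_gt2 : (2 < N)%N) (N_even : ~~ odd N).
Notation theta := (@theta R N).
Notation kappa := (@kappa R N).

Let N_gt0 : (0 < N)%N := ltn_trans (isT : (0 < 2)%N) N_gt2.
Let NR0 : N%:R != 0 :> R. Proof. by rewrite pnatr_eq0 -lt0n. Qed.
Let NRgt0 : 0 < N%:R :> R. Proof. by rewrite ltr0n. Qed.
Let pi0 : 0 < (pi : R) := pi_gt0 R.

Lemma cexp_iMn (w : R) n : cexp ('i * w%:C) ^+ n = cexp ('i * (w * n%:R)%:C).
Proof.
rewrite -cexpMn; congr cexp.
by rewrite RtoCM RtoCn mulrA mulr_natr.
Qed.

Lemma cexp_ipi : cexp ('i * (pi : R)%:C) = -1.
Proof.
by apply: cplx_eq; rewrite ?Re_cexp ?Im_cexp Re_imR expR0 mul1r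
  cImM /= mul0r mul1r add0r ?cospi ?sinpi ?oppr0.
Qed.

Definition omega : R[i] := cexp ('i * (2 * pi / N%:R)%:C).
Definition theta0 : R[i] := cexp ('i * ((N./2 + 1)%:R * pi / N%:R)%:C).

Lemma thetaE l : theta l = theta0 * omega ^+ l.
Proof.
rewrite /omega cexp_iMn /theta0 -cexpD /Defs.theta -mulrDr -RtoCD.
congr (cexp (_ * _%:C)).
by rewrite -addnA natrD natrM; field.
Qed.

Lemma omegaN : omega ^+ N = 1.
Proof.
rewrite /omega cexp_iMn divfK// [2 * _]mulrC -cexp_iMn.
by rewrite cexp_ipi sqrrN expr1n.
Qed.

Lemma omega_half : omega ^+ N./2 = -1.
Proof.
rewrite /omega cexp_iMn -cexp_ipi; congr (cexp (_ * _%:C)).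
have e : N%:R = N./2%:R * 2 :> R.
  by rewrite -natrM muln2 -[in LHS](odd_double_half N) (negbTE N_even).
have h : N./2%:R != 0 :> R by apply/eqP => h; move: NR0; rewrite e h mul0r eqxx.
by rewrite e; move: (pi : R) => p; field.
Qed.

Lemma theta0X : theta0 ^+ N = kappa.
Proof.
rewrite /theta0 cexp_iMn divfK// [X in X%:C]mulrC -cexp_iMn cexp_ipi.
by rewrite /Defs.kappa addnC.
Qed.

Lemma thetaX l : theta l ^+ N = kappa.
Proof.
by rewrite thetaE exprMn theta0X -exprM mulnC exprM omegaN expr1n mulr1.
Qed.

(** If the power were 1, its real part [cos (2 * y)] with [y := pi * m / N] would be 1, forcing
    [sin y = 0] although [y] lies strictly between 0 and [pi]. *)
Lemma omegaX_neq1 m : (0 < m < N)%N -> omega ^+ m != 1.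
Proof.
move=> /andP[m0 mN]; apply/eqP; rewrite /omega cexp_iMn => e.
have : complex.Re (cexp ('i * (2 * pi / N%:R * m%:R)%:C) : R[i]) = 1 by rewrite e.
rewrite Re_cexp Re_imR expR0 mul1r cImM /= mul0r mul1r add0r.
pose y : R := pi * (m%:R / N%:R).
have -> : 2 * pi / N%:R * m%:R = y *+ 2.
  by rewrite -[RHS]mulr_natr /y; move: (pi : R) => p; field.
have mNR : 0 < (m%:R / N%:R : R) < 1.
  by rewrite divr_gt0 ?ltr0n// ltr_pdivrMr// mul1r ltr_nat.
have s0 : 0 < sin y.
  apply: sin_gt0_pi; move: mNR => /andP[h1 h2].
  by rewrite mulr_gt0//= /y gtr_pMr.
rewrite cos_mulr2n cos2sin2 => h.
have := exprn_gt0 2 s0; move: h; rewrite -mulr_natr; lra.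
Qed.

Lemma theta_neq0 l : theta l != 0.
Proof. exact: cexp_neq0. Qed.

Lemma theta_inj : injective theta.
Proof.
have key (a b : 'I_N) : (a < b)%N -> theta a <> theta b.
  move=> ab; rewrite !thetaE => /(mulfI (cexp_neq0 _)) e.
  have : omega ^+ (b - a) = 1.
    have o0 : omega ^+ a != 0 by rewrite expf_neq0// cexp_neq0.
    by apply: (mulfI o0); rewrite -exprD subnKC ?mulr1// ltnW.
  apply/eqP/omegaX_neq1; rewrite subn_gt0 ab/=.
  by rewrite (leq_ltn_trans (leq_subr _ _)).
move=> a b e; apply/val_inj.
by have [/key|/key|//] := ltngtP a b; rewrite e.
Qed.

Lemma sum_thetaX m : (0 < m < N)%N -> \sum_(l < N) theta l ^+ m = 0.
Proof.
move=> mN; under eq_bigr do rewrite thetaE exprMn -exprM mulnC exprM.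
rewrite -mulr_sumr.
have h : omega ^+ m - 1 != 0 by rewrite subr_eq0 omegaX_neq1.
suff -> : \sum_(i < N) (omega ^+ m) ^+ i = 0 by rewrite mulr0.
apply: (mulfI h); rewrite -subrX1 mulr0 -exprM mulnC exprM omegaN expr1n.
by rewrite subrr.
Qed.

(** The real part is [- sin ((2 l + 1) pi / N + b)]. As [2 l + 1] is odd and [N] even, the
    unperturbed angle is at distance at least [pi / N] from the multiples of [pi], so a rotation by
    less than [pi / N] cannot change the sign. *)
Lemma Re_theta_rot (l : 'I_N) (b : R) : `|b| < pi / N%:R ->
  if (2 * l + 1 < N)%N then complex.Re (theta l * cexp ('i * b%:C)) < 0
  else 0 < complex.Re (theta l * cexp ('i * b%:C)).
Proof.
rewrite ltr_norml => /andP[b1 b2].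
pose a : R := (2 * l + 1)%:R * pi / N%:R + b.
have -> : complex.Re (theta l * cexp ('i * b%:C)) = - sin a.
  rewrite /Defs.theta -cexpD -mulrDr -RtoCD Re_cexp Re_imR expR0 mul1r.
  rewrite cImM /= mul0r mul1r add0r -cosDpihalf; congr cos.
  have e : N%:R = N./2%:R * 2 :> R.
    by rewrite -natrM muln2 -[in LHS](odd_double_half N) (negbTE N_even).
  have h : N./2%:R != 0 :> R by apply/eqP => h; move: NR0; rewrite e h mul0r eqxx.
  rewrite /a e addnAC natrD.
  by move: (pi : R) => p; field.
pose p : R := pi / N%:R.
have p0 : 0 < p by rewrite divr_gt0.
have pN : pi = N%:R * p by rewrite /p mulrCA mulfV// mulr1.
have aE : a = (2 * l + 1)%:R * p + b by rewrite /a /p mulrA.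
have b1' : - p < b by []. have b2' : b < p by [].
case: ltnP => hl.
- rewrite oppr_lt0; apply: sin_gt0_pi; rewrite aE pN.
  have h1 : 1 <= (2 * l + 1)%:R :> R by rewrite ler1n addn1.
  have h2 : (2 * l + 1)%:R + 1 <= N%:R :> R by rewrite natr1 ler_nat.
  by apply/andP; split; nra.
- have hl' : (N < 2 * l + 1)%N.
    rewrite ltn_neqAle hl andbT; apply/eqP => e; move: N_even.
    by rewrite e oddD mul2n odd_double.
  rewrite oppr_gt0 -[a](subrK pi) sinDpi oppr_lt0; apply: sin_gt0_pi; rewrite aE.
  have h1 : N%:R + 1 <= (2 * l + 1)%:R :> R by rewrite natr1 ler_nat.
  have h2 : (2 * l + 1)%:R + 1 <= 2 * N%:R :> R.
    by rewrite natr1 -natrM ler_nat; have := ltn_ord l; lia.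
  by rewrite pN; apply/andP; split; nra.
Qed.

Lemma inJE (l : 'I_N) : inJ R l = ~~ (2 * l + 1 < N)%N.
Proof.
have b0 : `|0 : R| < pi / N%:R by rewrite normr0 divr_gt0.
have := Re_theta_rot l b0; rewrite mulr0 cexp0 mulr1 /inJ.
by case: ltnP => // _ /ltW h; rewrite ltNge h.
Qed.

Lemma inKE (l : 'I_N) : inK R l = ~~ inJ R l.
Proof.
rewrite inJE negbK.
have b0 : `|0 : R| < pi / N%:R by rewrite normr0 divr_gt0.
have := Re_theta_rot l b0; rewrite mulr0 cexp0 mulr1 /inK.
by case: ltnP => // _ /ltW h; rewrite ltNge h.
Qed.

(** The index of [- theta l]: a shift by half a turn multiplies by [omega ^+ N./2 = -1]. *)
Definition ord_opp (l : 'I_N) : 'I_N := Ordinal (ltn_pmod (l + N./2) N_gt0).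

Lemma theta_opp l : theta (ord_opp l) = - theta l.
Proof.
rewrite !thetaE /= (expr_mod _ omegaN) exprD omega_half mulrA mulrN1.
by [].
Qed.

Lemma ord_oppK : involutive ord_opp.
Proof. by move=> l; apply: theta_inj; rewrite !theta_opp opprK. Qed.

Lemma inJ_opp l : inJ R (ord_opp l) = inK R l.
Proof. by rewrite /inJ /inK theta_opp cReN oppr_gt0. Qed.

Lemma inK_opp l : inK R (ord_opp l) = inJ R l.
Proof. by rewrite -{2}(ord_oppK l) inJ_opp. Qed.

(** Negation carries [K] onto [J] and does not affect the quotients
    [theta l / (theta l - theta j)]. *)
Lemma coefA_opp l : Defs.coefA R (ord_opp l) = Defs.coefB R l.
Proof.
rewrite /Defs.coefA /Defs.coefB (reindex_inj (inv_inj ord_oppK)) /=.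
apply: eq_big => [k|k _]; first by rewrite inJ_opp (inj_eq (inv_inj ord_oppK)).
by rewrite !theta_opp -opprD invrN mulrNN.
Qed.

Lemma psiE (lam : R[i]) (xi : R) : psi N lam xi = phi N lam (- xi).
Proof.
rewrite /psi /phi (reindex_inj (inv_inj ord_oppK)) /= mulNr -mulrN -sumrN.
congr (_ * _); apply: eq_big => [k|k _]; first by rewrite inK_opp.
rewrite -coefA_opp ord_oppK theta_opp !mulNr opprK.
by rewrite RtoCN mulrN.
Qed.

Section PrincipalRoot.
Variables (lam : R[i]) (lam_re : 0 < complex.Re lam).

Let n0 : 0 < nm lam.
Proof. by rewrite nm_gt0; apply/eqP => h; move: lam_re; rewrite h ltxx. Qed.

Let c := complex.Re lam / nm lam.

Let c1 : 0 < c <= 1.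
Proof.
rewrite divr_gt0//= ler_pdivrMr// mul1r.
by rewrite (le_trans _ (Re_le_nm _))// ler_norm.
Qed.

Let c11 : -1 <= c <= 1.
Proof. by move: c1 => /andP[h ->]; rewrite andbT (le_trans _ (ltW h)). Qed.

Lemma cexp_Arg : cexp ('i * (Arg lam)%:C) = lam / (nm lam)%:C.
Proof.
have nn0 : nm lam != 0 by rewrite gt_eqF.
have sq : nm lam ^+ 2 = complex.Re lam ^+ 2 + complex.Im lam ^+ 2.
  by case: (lam) => a b /=; rewrite sqr_sqrtr// addr_ge0// sqr_ge0.
have s : sin (acos c) = `|complex.Im lam| / nm lam.
  rewrite sin_acos//.
  have -> : 1 - c ^+ 2 = (complex.Im lam / nm lam) ^+ 2.
    rewrite !exprMn exprVn; apply: (mulIf (expf_neq0 2 nn0)).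
    rewrite mulrBl !divfK ?expf_neq0// mul1r sq.
    by rewrite addrAC subrr add0r.
  by rewrite sqrtr_sqr normf_div (gtr0_norm n0).
have q : cos (acos c) = c by rewrite acosK// in_itv.
rewrite -RtoCV; apply: cplx_eq; rewrite ?Re_cexp ?Im_cexp Re_imR expR0 mul1r
  cImM /= mul0r mul1r add0r [lam * _]mulrC ?cReZ ?cImZ.
- by rewrite /Arg; case: ifP => _; rewrite ?cosN -/c q /c mulrC.
- rewrite /Arg -/c; case: ifPn => h.
    by rewrite s ger0_norm// mulrC.
  by rewrite sinN s ltr0_norm ?ltNge// mulNr opprK mulrC.
Qed.

Lemma Arg_lt_pi : `|Arg lam| < pi.
Proof.
have h0 : 0 <= acos c by exact: acos_ge0.
have h : acos c < pi.
  apply: acos_ltpi; move: c1 => /andP[h ->]; rewrite andbT.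
  by rewrite (lt_trans _ h).
by rewrite /Arg -/c; case: ifP => _; rewrite ?normrN ger0_norm.
Qed.

Lemma principal_rootX : principal_root N lam ^+ N = lam.
Proof.
rewrite /principal_root exprMn -RtoCX cexp_iMn divfK// cexp_Arg.
rewrite -powR_mulrn ?powR_ge0// -powRrM mulVf// powRr1 ?nm_ge0//.
by rewrite mulrCA mulfV ?mulr1// RtoC_eq0 gt_eqF.
Qed.

Lemma principal_root_neq0 : principal_root N lam != 0.
Proof.
apply/eqP => h; move: lam_re; rewrite -principal_rootX h expr0n eqn0Ngt N_gt0.
by rewrite ltxx.
Qed.

(** Apart from a positive factor, the principal root rotates by [Arg lam / N], less than [pi / N] in
    modulus. The roots scaled by it therefore lie on the same side of the imaginary axis as the
    [theta l], and the exponentials in [phi] and [psi] decay where needed. *)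
Lemma Re_theta_root l :
  if inJ R l then 0 < complex.Re (theta l * principal_root N lam)
  else complex.Re (theta l * principal_root N lam) < 0.
Proof.
rewrite /principal_root mulrCA cReZ inJE.
have r0 : 0 < nm lam `^ N%:R^-1 by rewrite powR_gt0.
have b : `|Arg lam / N%:R| < pi / N%:R.
  by rewrite normrM normfV (gtr0_norm NRgt0) ltr_pM2r ?invr_gt0// Arg_lt_pi.
have := Re_theta_rot l b; case: ltnP => /= _ h.
- by rewrite pmulr_rlt0.
- by rewrite mulr_gt0.
Qed.

End PrincipalRoot.

(* Expanding theta / (theta - X) geometrically, only the constant term has a
   non-vanishing power sum. *)
Lemma sum_resolvent (r : R[i]) (X : R[i]) : r != 0 ->
  X ^+ N != kappa * r ^+ N ->
  \sum_(l < N) (theta l * r) / (theta l * r - X) =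
  N%:R * (kappa * r ^+ N) / (kappa * r ^+ N - X ^+ N).
Proof.
move=> r0 XN.
have tX l : (theta l * r) ^+ N = kappa * r ^+ N by rewrite exprMn thetaX.
have D0 : kappa * r ^+ N - X ^+ N != 0 by rewrite subr_eq0 eq_sym.
have E l : (theta l * r) / (theta l * r - X) =
    (kappa * r ^+ N - X ^+ N)^-1 *
    \sum_(i < N) (theta l * r) ^+ (N - i) * X ^+ i.
  have h : theta l * r - X != 0.
    by rewrite subr_eq0; apply: contraNneq XN => <-; rewrite tX.
  have S : (theta l * r - X) * \sum_(i < N) (theta l * r) ^+ (N.-1 - i) * X ^+ i =
      kappa * r ^+ N - X ^+ N by rewrite -subrXX tX.
  have -> : \sum_(i < N) (theta l * r) ^+ (N - i) * X ^+ i =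
      theta l * r * \sum_(i < N) (theta l * r) ^+ (N.-1 - i) * X ^+ i.
    rewrite mulr_sumr; apply: eq_bigr => i _; rewrite mulrA -exprS; congr (_ ^+ _ * _).
    by have := ltn_ord i; lia.
  move: S; set G := \sum_(i < N) _ => S.
  have G0 : G != 0 by apply/eqP => g0; move: D0; rewrite -S g0 mulr0 eqxx.
  by rewrite -S; move: (theta l * r - X) h => w w0; field; rewrite w0 G0.
under eq_bigr do rewrite E.
rewrite -mulr_sumr exchange_big /= [RHS]mulrC; congr (_ * _).
rewrite (bigD1 (Ordinal N_gt0)) //= [X in _ + X]big1 ?addr0 => [|i i0].
  under eq_bigr do rewrite subn0 tX expr0 mulr1.
  by rewrite sumr_const card_ord mulr_natl.
have i1 : (0 < i)%N.
  by rewrite lt0n; apply: contraNneq i0 => e; apply/eqP/val_inj.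
rewrite -mulr_suml; under eq_bigr do rewrite exprMn.
rewrite -mulr_suml sum_thetaX ?mul0r//.
by have := ltn_ord i; lia.
Qed.

End Roots.

Section AlmostEverywhere.
Context {R : realType}.
Notation RT := (measurableTypeR R).
Notation leb := (@lebesgue_measure R).

(** Needed because the resolvent density is identified only away from 0. *)
Lemma eq_cintegral_but (a : R) (f g : RT -> R[i]) : cmeas f -> cmeas g ->
  (forall y, y != a -> f y = g y) -> cintegral leb f = cintegral leb g.
Proof.
move=> [f1 f2] [g1 g2] fg.
have key (u v : RT -> R) : measurable_fun setT u -> measurable_fun setT v ->
    (forall y, y != a -> u y = v y) -> \int[leb]_y u y = \int[leb]_y v y.
  move=> mu mv uv; congr fine; apply: ae_eq_integral => //.
  - exact/measurable_EFinP.
  - exact/measurable_EFinP.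
  exists [set a]; split => //; first exact: lebesgue_measure_set1.
  move=> y /= h; apply: contrapT => /eqP ya; apply: h => _.
  by rewrite uv.
by apply: cplx_eq => /=; apply: key => // y /fg ->.
Qed.

End AlmostEverywhere.

(** * The resolvent density *)

Section Resolvent.
Context {R : realType} (N : nat) (N_gt2 : (2 < N)%N) (N_even : ~~ odd N).
Notation RT := (measurableTypeR R).
Notation leb := (@lebesgue_measure R).
Notation hk := (@heat_kernel R N).
Notation theta := (@theta R N).
Variables (w Lam : R[i]).
Hypothesis wN : w ^+ N = Lam.
Hypothesis Lam_re : 0 < complex.Re Lam.
Hypothesis w_re : forall l, if inJ R l then 0 < complex.Re (theta l * w)
  else complex.Re (theta l * w) < 0.

Let r (l : 'I_N) : R[i] := theta l * w.
Let Lam0 : Lam != 0. Proof. by apply/eqP => h; move: Lam_re; rewrite h ltxx. Qed.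
Let NC0 : N%:R != 0 :> R[i].
Proof. by rewrite pnatr_eq0 -lt0n (ltn_trans _ N_gt2). Qed.
Let w0 : w != 0.
Proof.
apply/eqP => h; move: Lam0; rewrite -wN h expr0n.
by rewrite (gtn_eqF (ltn_trans (isT : (0 < 2)%N) N_gt2)) eqxx.
Qed.

(** Here [w] is any [N]-th root of [Lam] with the sign pattern [w_re]. It is kept abstract so that
    it can later be [r0 * s], a root of [lam * s ^+ N]. Each half-line carries the exponentials that
    are bounded on it. *)
Definition resolvent_pos (y : R) : R[i] :=
  \sum_(l < N | inJ R l) theta l * w * cexp (- (theta l * w) * y%:C).
Definition resolvent_neg (y : R) : R[i] :=
  - \sum_(l < N | inK R l) theta l * w * cexp (- (theta l * w) * y%:C).
(** The value chosen at [y = 0] is immaterial, since [resolventE] concerns [y != 0] only. *)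
Definition resolvent (y : R) : R[i] :=
  (N%:R * Lam)^-1 * (if 0 < y then resolvent_pos y else resolvent_neg y).

Definition ladder_weight (mu nu : R) (y : R) : R[i] :=
  cexp ('i * (mu * y)%:C - (nu * Num.max y 0)%:C).

Lemma nm_ladder_weight mu nu y : 0 <= nu -> nm (ladder_weight mu nu y) <= 1.
Proof.
move=> nu0; rewrite nm_cexp Re_iM cReN /= -expR0 ler_expR oppr_le0.
by rewrite mulr_ge0// le_max lexx orbT.
Qed.

Lemma cmeas_ladder_weight mu nu : cmeas (ladder_weight mu nu : RT -> R[i]).
Proof.
apply: cmeas_cexp.
rewrite (_ : (fun t => _) = (fun t : RT => 'i * (mu * t)%:C + (-1) * (nu * Num.max t 0)%:C)); last first.
  by apply/funext => t; rewrite mulN1r.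
apply: cmeasD; (apply: cmeasM; first exact: cmeas_cst); apply: cmeas_real.
- exact: measurable_funM.
- by apply: measurable_funM => //; exact: measurable_maxr.
Qed.

Definition resolvent_value (mu nu : R) : R[i] :=
  (N%:R * Lam)^-1 *
  (\sum_(l < N | inJ R l) theta l * w / (theta l * w + nu%:C - 'i * mu%:C) +
   \sum_(l < N | inK R l) theta l * w / (theta l * w - 'i * mu%:C)).

Lemma resolvent_integral (mu nu : R) : 0 <= nu ->
  cintegrable leb (fun y : RT => resolvent y * ladder_weight mu nu y) /\
  cintegral leb (fun y : RT => resolvent y * ladder_weight mu nu y) = resolvent_value mu nu.
Proof.
move=> nu0.
pose cJ l := theta l * w + nu%:C - 'i * mu%:C.
pose cK l := - (theta l * w - 'i * mu%:C).
pose fJ l (y : RT) : R[i] := theta l * w * (if 0 < y then cexp (- cJ l * y%:C) else 0).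
pose fK l (y : RT) : R[i] := - (theta l * w) * (if 0 <= - y then cexp (- cK l * (- y)%:C) else 0).
have E : (fun y : RT => resolvent y * ladder_weight mu nu y) = (fun y : RT => (N%:R * Lam)^-1 *
   (\sum_(l < N | inJ R l) fJ l y + \sum_(l < N | inK R l) fK l y)).
  apply/funext => y; rewrite /resolvent -mulrA; congr (_ * _).
  rewrite /fJ /fK /ladder_weight oppr_ge0; case: ltP => y0.
  - rewrite [X in _ = _ + X]big1 ?addr0 => [|l _]; last by rewrite mulr0.
    rewrite /resolvent_pos mulr_suml; apply: eq_bigr => l _.
    rewrite -[LHS]mulrA -cexpD /cJ; congr (_ * cexp _).
    by rewrite !RtoCM; ring.
  - rewrite [X in _ = X + _]big1 ?add0r => [|l _]; last by rewrite mulr0.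
    rewrite /resolvent_neg mulNr mulr_suml -sumrN; apply: eq_bigr => l _.
    have A (t c1 c2 : R[i]) : - (t * c1 * c2) = - t * (c1 * c2) by ring.
    rewrite A -cexpD /cK; congr (_ * cexp _).
    by rewrite mulr0 subr0 RtoCN !RtoCM; ring.
have iJ l : inJ R l -> cintegrable leb (fJ l) /\
    cintegral leb (fJ l) = theta l * w / cJ l.
  move=> Jl; have c0 : 0 < complex.Re (cJ l).
    rewrite /cJ cReD cReN Re_imR oppr0 addr0 cReD /= ltr_pwDl//.
    by have := w_re l; rewrite Jl.
  have [i e] := cintegral_cexpN_gt0 c0.
  by split; [exact: cintegrableZ|rewrite cintegralZ// e].
have iK l : inK R l -> cintegrable leb (fK l) /\
    cintegral leb (fK l) = theta l * w / (theta l * w - 'i * mu%:C).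
  move=> Kl; have c0 : 0 < complex.Re (cK l).
    rewrite /cK cReN cReD cReN Re_imR oppr0 addr0 oppr_gt0.
    by have := w_re l; rewrite -[inJ R l]negbK -inKE// Kl.
  have [i e] := cintegral_cexpN_ge0 c0.
  have [i' e'] := cintegral_opp i.
  split; first exact: cintegrableZ.
  by rewrite cintegralZ// e' e /cK invrN mulrNN.
have iS : cintegrable leb (fun y : RT => \sum_(l < N | inJ R l) fJ l y).
  by apply: cintegrable_sum => l /iJ[].
have iS' : cintegrable leb (fun y : RT => \sum_(l < N | inK R l) fK l y).
  by apply: cintegrable_sum => l /iK[].
rewrite E; split; first by apply: cintegrableZ; exact: cintegrableD.
rewrite cintegralZ; last exact: cintegrableD.
rewrite cintegralD// !cintegral_sum; [|by move=> l /iK[]|by move=> l /iJ[]].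
congr (_ * (_ + _)); apply: eq_bigr => l; first by move=> /iJ[_ ->].
by move=> /iK[_ ->].
Qed.

Let DN (v : R) : Lam + (v ^+ N)%:C != 0.
Proof.
apply/eqP => h; have := congr1 (@complex.Re R) h; rewrite cReD /= => h'.
by move: Lam_re (expN_ge0 N_even v); lra.
Qed.

(** Without [nu] the weight is the same on both half-lines, so the two sums merge into one over all
    the roots, which [sum_resolvent] evaluates. *)
Lemma resolvent_value0 (u : R) : resolvent_value (- u) 0 = (Lam + (u ^+ N)%:C)^-1.
Proof.
rewrite /resolvent_value.
have -> : \sum_(l < N | inJ R l) theta l * w / (theta l * w + 0%:C - 'i * (- u)%:C) +
    \sum_(l < N | inK R l) theta l * w / (theta l * w - 'i * (- u)%:C) =
    \sum_(l < N) theta l * w / (theta l * w - 'i * (- u)%:C).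
  rewrite [RHS](bigID (fun l => inJ R l)) /=; congr (_ + _).
    by apply: eq_bigr => l _; rewrite addr0.
  by apply: eq_bigl => l; rewrite inKE.
have kX : kappa R N * ('i * (- u)%:C) ^+ N = - (u ^+ N)%:C.
  by rewrite RtoCN mulrN -mulNr kappaE.
have k2 : kappa R N * kappa R N = 1 by rewrite -expr2 /kappa -exprM mulnC exprM sqrrN !expr1n.
have k0 : kappa R N != 0.
  by apply/eqP => h; move: k2; rewrite h mulr0 => /eqP; rewrite eq_sym oner_eq0.
have X : ('i * (- u)%:C) ^+ N = - (kappa R N * (u ^+ N)%:C).
  by apply: (mulfI k0); rewrite kX mulrN mulrA k2 mul1r.
rewrite sum_resolvent//; last first.
  rewrite X wN -subr_eq0 -opprD oppr_eq0 -mulrDr mulf_neq0// addrC.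
  exact: DN.
rewrite X wN opprK -mulrDr.
move: (kappa R N) k0 (DN u) => k k0; set D := Lam + _ => D0.
by field; rewrite D0 k0 Lam0 NC0.
Qed.

Lemma cintegrable_resolvent : cintegrable leb (resolvent : RT -> R[i]).
Proof.
have [i _] := resolvent_integral 0 (lexx 0).
move: i; under eq_fun do rewrite /ladder_weight !mul0r mulr0 subr0 cexp0 mulr1.
by [].
Qed.

Lemma resolvent_fourier (u : R) :
  cintegral leb (fun y : RT => resolvent y * cexp (- ('i * (u * y)%:C))) =
  (Lam + (u ^+ N)%:C)^-1.
Proof.
rewrite -resolvent_value0 -(resolvent_integral (- u) (lexx 0)).2.
apply: eq_cintegral => y; rewrite /ladder_weight mul0r subr0; congr (_ * cexp _).
by rewrite mulNr RtoCN mulrN.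
Qed.

Lemma resolvent_bounded : exists B : R, forall y, nm (resolvent y) <= B.
Proof.
exists (nm (N%:R * Lam)^-1 * (\sum_(l < N) nm (theta l * w))) => y.
rewrite nmM; apply: ler_wpM2l; first exact: nm_ge0.
have S (P : pred 'I_N) : \sum_(l < N | P l) nm (theta l * w) <= \sum_(l < N) nm (theta l * w).
  rewrite [leRHS](bigID P) /= lerDl; apply: sumr_ge0 => l _; exact: nm_ge0.
case: ltP => y0.
- apply: le_trans (nm_sum _ _ _) _; apply: le_trans (S (fun l => inJ R l)).
  apply: ler_sum => l Jl; rewrite [leLHS]nmM; apply: ler_piMr; first exact: nm_ge0.
  rewrite nm_cexp -expR0 ler_expR cReM /= mulr0 subr0 cReN mulNr oppr_le0.
  by rewrite mulr_ge0 ?ltW//; have := w_re l; rewrite Jl.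
- rewrite nmN; apply: le_trans (nm_sum _ _ _) _; apply: le_trans (S (fun l => inK R l)).
  apply: ler_sum => l Kl; rewrite [leLHS]nmM; apply: ler_piMr; first exact: nm_ge0.
  rewrite nm_cexp -expR0 ler_expR cReM /= mulr0 subr0 cReN.
  apply: mulr_ge0_le0 => //; rewrite oppr_ge0 ltW//.
  by have := w_re l; rewrite -[inJ R l]negbK -inKE// Kl.
Qed.

Lemma resolvent_local (y : R) : y != 0 -> forall e : R, 0 < e ->
  exists2 d : R, 0 < d & forall v, `|v| < d -> nm (resolvent (v + y) - resolvent y) <= e.
Proof.
move=> y0 e e0.
have [f [d fd fE]] : exists f : R -> R[i], exists2 d, cder f y d &
    forall v : R, `|v| < `|y| -> resolvent (v + y) = f (v + y).
  have [y1|y1] := ltP 0 y.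
  - exists (fun y => (N%:R * Lam)^-1 * resolvent_pos y).
    eexists; first by apply: cderZ; apply: cder_sum => l _; apply: cderZ; exact: cder_cexpM.
    move=> v; rewrite (gtr0_norm y1) ltr_norml => /andP[h _].
    by rewrite /resolvent -ltrBlDr sub0r h.
  - have y2 : y < 0 by rewrite lt_neqAle y0.
    exists (fun y => (N%:R * Lam)^-1 * resolvent_neg y).
    eexists.
      by apply: cderZ; apply: cderN; apply: cder_sum => l _; apply: cderZ; exact: cder_cexpM.
    move=> v; rewrite (ltr0_norm y2) ltr_norml => /andP[_ h].
    by rewrite /resolvent -ltrBlDr sub0r ltNge ltW.
have [d1 d10 h1] := cder_eps fd e0.
exists (Num.min d1 `|y|); first by rewrite lt_min d10 normr_gt0.
move=> v; rewrite lt_min => /andP[v1 v2].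
have := fE 0; rewrite normr0 normr_gt0 add0r => /(_ y0) ->.
by rewrite fE//; exact: h1.
Qed.

Let a := complex.Re Lam.

(** Since [v ^+ N >= v ^+ 2 - 1], the product [(a + v ^+ N) * (1 + 2 / a)] exceeds [v ^+ N + 2],
    hence [1 + v ^+ 2]. *)
Let invD_bound (v : R) : (a + v ^+ N)^-1 <= (1 + 2 / a) * cauchyd 1 v.
Proof.
have v0 := expN_ge0 N_even v; have v2 := expN_ge N_gt2 N_even v.
have d0 : 0 < a + v ^+ N by rewrite ltr_pwDl.
rewrite /cauchyd !mul1r ler_pdivlMr ?onesqr_gt0// ler_pdivrMl//.
have -> : (a + v ^+ N) * (1 + 2 / a) = a + v ^+ N + 2 + v ^+ N * (2 / a).
  by field; rewrite gt_eqF.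
have q : 0 <= v ^+ N * (2 / a) by rewrite mulr_ge0// divr_ge0// ltW.
by have : 0 < a := Lam_re; lra.
Qed.

Let real_exp (b : R) : 0 < b ->
  leb.-integrable setT (EFin \o (fun t : RT => if 0 < t then expR (- b * t) else 0)) /\
  \int[leb]_t (if 0 < t then expR (- b * t) else 0) = b^-1.
Proof.
move=> b0; have [i e] := @cintegral_cexpN_gt0 R b%:C b0.
have E : (fun t : RT => complex.Re (if 0 < t then cexp (- b%:C * t%:C) else 0)) =
    (fun t : RT => if 0 < t then expR (- b * t) else 0).
  by apply/funext => t; case: ifP => // _; rewrite -RtoCN -RtoCM cexp_real.
split; first by have := i.1; rewrite E.
by rewrite -RtoCV in e; have := congr1 (@complex.Re R) e; rewrite /= E.
Qed.

(** Expanding the kernel and exchanging the integrals turns the left side into the inverse Fourier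
    transform of [(Lam + v ^+ N)^-1], which is the Fourier transform of [resolvent]. Inversion needs
    continuity at [y], known from the exponential formulas only off 0. *)
Lemma resolventE (y : R) : y != 0 ->
  cintegral leb (fun t : RT => if 0 < t then cexp (- Lam * t%:C) * hk t y else 0) =
  resolvent y.
Proof.
move=> y0.
(* The kernel is even, and taking it at [- y] gives the phase [exp (i v y)] of the inversion
   formula. *)
pose H (v t : RT) : R[i] :=
  if 0 < t then cexp (- Lam * t%:C) * ek N t (- y) v else 0.
have HE v t : H v t = (if 0 < t then cexp (- (Lam + (v ^+ N)%:C) * t%:C) else 0) *
    cexp ('i * (v * y)%:C).
  rewrite /H; case: ifP => _; last by rewrite mul0r.
  by rewrite /ek -!cexpD; congr cexp; rewrite !(RtoCM, RtoCN); ring.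
have nmH v t : nm (H v t) = if 0 < t then expR (- (a + v ^+ N) * t) else 0.
  rewrite HE nmM nm_cexp_i mulr1; case: ifP => _; last exact: nm0.
  by rewrite nm_cexp cReM /= mulr0 subr0 cReN cReD.
have dv v : 0 < a + v ^+ N by rewrite ltr_pwDl// expN_ge0.
have mH : cmeas (fun q : RT * RT => H q.1 q.2).
  have m1 : measurable_fun setT (fun q : RT * RT => q.1) by exact: measurable_fst.
  have m2 : measurable_fun setT (fun q : RT * RT => q.2) by exact: measurable_snd.
  rewrite /H; apply: cmeas_if; [|apply: cmeasM|exact: cmeas_cst].
  - exact: measurable_fun_ltr.
  - by apply: cmeas_cexp; apply: cmeasM; [exact: cmeas_cst|exact: cmeas_real].
  - apply: cmeas_cexp.
    rewrite (_ : (fun q => _) = (fun q : RT * RT =>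
      (-1) * 'i * (- y * q.1)%:C + (-1) * (q.2 * q.1 ^+ N)%:C)); last first.
      by apply/funext => p; rewrite mulN1r mulNr mulN1r.
    apply: cmeasD; (apply: cmeasM; first exact: cmeas_cst); apply: cmeas_real.
    + exact: measurable_funM.
    + by apply: measurable_funM => //; exact: measurable_funX.
have iH : cintegrable (leb \x leb)%E (fun q : RT * RT => H q.1 q.2).
  refine (@cintegrable_prod R _ _ RT RT leb leb (fun q : RT * RT => H q.1 q.2)
    (fun v t => if 0 < t then expR (- (a + v ^+ N) * t) else 0)
    (fun v => (1 + 2 / a) * cauchyd 1 v) mH _ _ _ _).
  - by move=> v t; rewrite nmH.
  - by move=> v; exact: (real_exp (dv v)).1.
  - by move=> v; rewrite (real_exp (dv v)).2.
  - by have := integrableZl measurableT (1 + 2 / a) (integrable_cauchyd ltr01).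
have := cfubini iH.
have -> : cintegral leb (fun t : RT => cintegral leb (fun v : RT => H v t)) =
    cintegral leb (fun t : RT => (2 * pi)%:C *
      (if 0 < t then cexp (- Lam * t%:C) * hk t y else 0)).
  apply: eq_cintegral => t; rewrite /H; case: ifPn => t0; last by rewrite mulr0 cintegral0.
  rewrite cintegralZ; last exact: cintegrable_ek.
  rewrite -(hk_even N_gt2 N_even y t0) heat_kernelE// mulrCA; congr (_ * _).
  rewrite mulrA -RtoCM mulfV ?mul1r//.
  by rewrite mulf_neq0// gt_eqF// pi_gt0.
have FE v : cintegral leb (fun t : RT => H v t) =
    (Lam + (v ^+ N)%:C)^-1 * cexp ('i * (v * y)%:C).
  have c0 : 0 < complex.Re (Lam + (v ^+ N)%:C) by rewrite cReD; exact: dv.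
  have [i e] := cintegral_cexpN_gt0 c0.
  by under eq_cintegral do rewrite HE; rewrite cintegralZr// e.
rewrite (eq_cintegral _ FE) cintegralZ; last first.
  have [it _] := cintegral21 iH.
  have := cintegrableZ ((2 * pi)^-1)%:C it; congr (cintegrable _ _).
  apply/funext => t; rewrite -[cintegral _ _]/(cintegral leb (fun v : RT => H v t)).
  rewrite /H; case: ifPn => t0; last by rewrite cintegral0 mulr0.
  rewrite cintegralZ; last exact: cintegrable_ek.
  by rewrite mulrCA -(hk_even N_gt2 N_even y t0) heat_kernelE.
have [B hB] := resolvent_bounded.
have := @fourier_inversion R resolvent B y cintegrable_resolvent hB (resolvent_local y0).
rewrite (_ : (fun v => cintegral leb _) = (fun v : RT => (Lam + (v ^+ N)%:C)^-1)); last first.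
  by apply/funext => v; exact: resolvent_fourier.
move=> inv H1.
have pn0 : (2 * pi)%:C != 0 :> R[i].
  by rewrite RtoC_eq0 mulf_neq0// gt_eqF// pi_gt0.
apply: (mulfI pn0); rewrite -H1 -inv.
- by apply: eq_cintegral => v; rewrite resolvent_fourier.
have c1 (v : RT) : (Lam + (v ^+ N)%:C)^-1 = cintegral leb (fun t : RT => if 0 < t then
    cexp (- (Lam + (v ^+ N)%:C) * t%:C) else 0).
  have c0 : 0 < complex.Re (Lam + (v ^+ N)%:C) by rewrite cReD; exact: dv.
  by rewrite (cintegral_cexpN_gt0 c0).2.
have i1 : cintegrable leb (fun v : RT => (Lam + (v ^+ N)%:C)^-1 * cexp ('i * (v * y)%:C)).
  have [i1 _] := cintegral12 iH; have := i1; congr (cintegrable _ _).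
  by apply/funext => v; exact: FE.
apply: (cintegrable_dom _ (integrable_nm i1)); last first.
  by move=> v; rewrite nmM nm_cexp_i mulr1.
have E (v : RT) : (Lam + (v ^+ N)%:C)^-1 =
    ((Lam + (v ^+ N)%:C)^-1 * cexp ('i * (v * y)%:C)) * cexp ('i * (v * - y)%:C).
  have A (z1 z2 z3 : R[i]) : z1 * z2 * z3 = z1 * (z2 * z3) by ring.
  by rewrite A -cexpD mulrN RtoCN mulrN subrr cexp0 mulr1.
rewrite (funext E); apply: (cmeasM (cintegrable_cmeas i1)).
apply: cmeas_cexp; apply: cmeasM; first exact: cmeas_cst.
by apply: cmeas_real; exact: measurable_funM.
Qed.

Definition Phi (mu nu t : R) : R[i] :=
  cintegral leb (fun y : RT => hk t y * ladder_weight mu nu y).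

Lemma Phi_laplace (mu nu : R) : 0 <= nu ->
  cintegrable leb (fun t : RT => if 0 < t then cexp (- Lam * t%:C) * Phi mu nu t else 0) /\
  cintegral leb (fun t : RT => if 0 < t then cexp (- Lam * t%:C) * Phi mu nu t else 0) =
  resolvent_value mu nu.
Proof.
move=> nu0.
pose H (t y : RT) : R[i] := (if 0 < t then cexp (- Lam * t%:C) * hk t y else 0) * ladder_weight mu nu y.
have mH0 : cmeas (fun q : RT * RT => if 0 < q.1 then cexp (- Lam * q.1%:C) * hk q.1 q.2 else 0).
  have m1 : measurable_fun setT (fun q : RT * RT => q.1) by exact: measurable_fst.
  apply: cmeas_if; [|apply: cmeasM|exact: cmeas_cst].
  - exact: measurable_fun_ltr.
  - by apply: cmeas_cexp; apply: cmeasM; [exact: cmeas_cst|exact: cmeas_real].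
  - exact: cmeas_hk2.
have mH : cmeas (fun q : RT * RT => H q.1 q.2).
  apply: cmeasM => //.
  exact: (cmeas_comp (cmeas_ladder_weight mu nu) (@measurable_snd _ _ _ _)).
have [C C0 hC] := hk_bound (R := R) N_gt2 N_even.
have ts (t : R) : 0 < t -> 0 < (tscale N t)^-1 by move=> t0; rewrite invr_gt0 tscale_gt0.
have [ie _] := real_exp Lam_re.
have iH : cintegrable (leb \x leb)%E (fun q : RT * RT => H q.1 q.2).
  refine (@cintegrable_prod R _ _ RT RT leb leb (fun q : RT * RT => H q.1 q.2)
    (fun t y => (if 0 < t then expR (- a * t) * (C * cauchyd (tscale N t)^-1 y) else 0))
    (fun t => (if 0 < t then expR (- a * t) else 0) * (C * pi)) mH _ _ _ _).
  - move=> t y /=; rewrite /H nmM; case: ifPn => t0; last by rewrite nm0 mul0r.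
    rewrite -[leRHS]mulr1; apply: ler_pM => //; try exact: nm_ge0; last exact: nm_ladder_weight.
    rewrite [leLHS]nmM nm_cexp cReM /= mulr0 subr0 cReN; apply: ler_wpM2l; first exact: expR_ge0.
    exact: (hC t y t0).1.
  - move=> t; case: (boolP (0 < t)) => t0; last exact: integrable0.
    have := integrableZl measurableT C (integrable_cauchyd (ts t t0)) => i.
    by have := integrableZl measurableT (expR (- a * t)) i.
  - move=> t; case: (boolP (0 < t)) => t0; last by rewrite mul0r /Rintegral integral0.
    have [i e] := cauchy_integral (ts t t0).
    rewrite RintegralZl//; last by have := integrableZl measurableT C i.
    by rewrite RintegralZl// e.
  - by have := integrableZr measurableT (C * pi) ie.
have HPhi (t : RT) : cintegral leb (H t) =
    if 0 < t then cexp (- Lam * t%:C) * Phi mu nu t else 0.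
  rewrite /H; case: ifPn => t0; last by under eq_cintegral do rewrite mul0r; rewrite cintegral0.
  rewrite -cintegralZ; last first.
    apply: (cintegrable_dom _ (integrable_nm (cintegrable_hk N_gt2 N_even t0))).
      by apply: cmeasM; [exact: cmeas_hk|exact: cmeas_ladder_weight].
    by move=> y; rewrite nmM ler_piMr ?nm_ge0// nm_ladder_weight.
  have A (z1 z2 z3 : R[i]) : z1 * z2 * z3 = z1 * (z2 * z3) by ring.
  by apply: eq_cintegral => y; exact: A.
have [i1 _] := cintegral12 iH.
have HE : (fun t : RT => cintegral leb (fun y : RT => H t y)) =
    (fun t : RT => if 0 < t then cexp (- Lam * t%:C) * Phi mu nu t else 0).
  by apply/funext => t; exact: HPhi.
split; first by move: i1; rewrite -HE.
rewrite -HE (cfubini iH) -(resolvent_integral mu nu0).2.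
have [i2 _] := cintegral21 iH.
apply: (@eq_cintegral_but R 0).
- exact: cintegrable_cmeas i2.
- exact: cintegrable_cmeas (resolvent_integral mu nu0).1.
- move=> y y0; rewrite -(resolventE y0) /H.
  rewrite -cintegralZr//.
  (* For fixed [y != 0] the kernel is bounded in time: [c * |y| <= 1 + (c * y) ^+ 2] gives
     [cauchyd c y <= 1 / |y|] for every scale [c]. *)
  apply: (@cintegrable_dom _ _ _ _ _ (fun t : RT =>
      (if 0 < t then expR (- a * t) else 0) * (C / `|y|))).
  + exact: (cmeas_comp mH0 (measurable_pair2 (y : RT))).
  + by have := integrableZr measurableT (C / `|y|) ie.
  + move=> t; case: ifPn => t0; last by rewrite nm0 mul0r.
    rewrite [leLHS]nmM nm_cexp cReM /= mulr0 subr0 cReN; apply: ler_wpM2l; first exact: expR_ge0.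
    apply: (le_trans (hC t y t0).1); apply: ler_wpM2l => //.
    have ya : 0 < `|y| by rewrite normr_gt0.
    rewrite /cauchyd ler_pdivrMr ?onesqr_gt0// ler_pdivlMl//.
    rewrite -(real_normK (num_real (_ * y))) normrM (gtr0_norm (ts t t0)).
    have := ts t t0; move: (tscale N t)^-1 => c c0; nra.
Qed.

End Resolvent.

(** * Boundedness of [Phi], its behaviour near time 0 and its continuity *)

Section PhiBounds.
Context {R : realType} (N : nat) (N_gt2 : (2 < N)%N) (N_even : ~~ odd N).
Notation RT := (measurableTypeR R).
Notation leb := (@lebesgue_measure R).
Notation hk := (@heat_kernel R N).
Notation Phi := (@Phi R N).
Variables (mu nu : R) (nu0 : 0 <= nu).

Lemma ladder_weight_sub1 (y : R) : nm (ladder_weight mu nu y - 1) <= 2 * (`|mu| + nu) * `|y|.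
Proof.
have m0 : 0 <= Num.max y 0 by rewrite le_max lexx orbT.
have my : Num.max y 0 <= `|y| by rewrite ge_max ler_norm normr_ge0.
apply: le_trans (nm_cexp_sub1 _) _.
  by rewrite Re_iM cReN /= oppr_le0 mulr_ge0.
rewrite -mulrA; apply: ler_wpM2l => //; apply: le_trans (nmB _ _) _.
rewrite nmM !nmR !normrM (_ : nm 'i = 1); last by rewrite /= expr0n/= add0r expr1n sqrtr1.
rewrite mul1r mulrDl lerD2l (ger0_norm nu0) (ger0_norm m0).
exact: ler_wpM2l.
Qed.

Lemma cintegrable_hk_ladder_weight t : 0 < t ->
  cintegrable leb (fun y : RT => hk t y * ladder_weight mu nu y).
Proof.
move=> t0; apply: (cintegrable_dom _ (integrable_nm (cintegrable_hk N_gt2 N_even t0))).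
  by apply: cmeasM; [exact: cmeas_hk|exact: cmeas_ladder_weight].
by move=> y; rewrite nmM ler_piMr ?nm_ge0// nm_ladder_weight.
Qed.

(** The kernel has integral 1, so [Phi - 1] integrates the weight minus 1, which is at most a
    multiple of [|y|]; the first absolute moment of the kernel is of order [tscale N t]. The other
    bound is the total variation, uniform in time because a Cauchy density has integral [pi] at
    every scale. *)
Lemma Phi_bound : exists2 C : R, 0 <= C & forall t : R, 0 < t ->
  nm (Phi mu nu t) <= C /\ nm (Phi mu nu t - 1) <= C * tscale N t.
Proof.
have [C C0 hC] := hk_bound (R := R) N_gt2 N_even.
pose A := 2 * (C * pi); pose B := 2 * (2 * (`|mu| + nu) * (C * pi)).
have pi0 : 0 <= (pi : R) := pi_ge0 R.
have A0 : 0 <= A by rewrite !mulr_ge0.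
have mn0 : 0 <= `|mu| + nu by rewrite addr_ge0.
have B0 : 0 <= B.
  rewrite /B; apply: mulr_ge0 => //; apply: mulr_ge0; last exact: mulr_ge0.
  exact: mulr_ge0.
exists (A + B) => [|t t0]; first exact: addr_ge0.
have ts := tscale_gt0 N t0.
have c0 : 0 < (tscale N t)^-1 by rewrite invr_gt0.
have [ci ce] := cauchy_integral c0.
have hgi := cintegrable_hk_ladder_weight t0.
split.
- have iC : leb.-integrable setT (EFin \o (fun y : RT => C * cauchyd (tscale N t)^-1 y)).
    by have := integrableZl measurableT C ci.
  apply: (@le_trans _ _ A); last by rewrite lerDl.
  have := nm_cintegral hgi iC; rewrite RintegralZl// ce; apply => y.
  rewrite nmM (le_trans _ (hC t y t0).1)// ler_piMr ?nm_ge0// nm_ladder_weight//.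
- pose K := 2 * (`|mu| + nu) * (C * tscale N t).
  have iK : leb.-integrable setT (EFin \o (fun y : RT => K * cauchyd (tscale N t)^-1 y)).
    by have := integrableZl measurableT K ci.
  have hi := cintegrable_hk N_gt2 N_even t0.
  have e1 : cintegral leb (hk t) = 1.
    have := hk_charfn N_gt2 N_even 0 t0.
    rewrite expr0n (gtn_eqF (ltn_trans (isT : (0 < 2)%N) N_gt2)) mulr0 oppr0 expR0 => e.
    rewrite -[RHS]e; apply: eq_cintegral => y.
    by rewrite mulr0 mulr0 cexp0 mulr1.
  have -> : Phi mu nu t - 1 = cintegral leb (fun y : RT => hk t y * (ladder_weight mu nu y - 1)).
    rewrite -[X in Phi mu nu t - X]e1 -cintegralB//; apply: eq_cintegral => y.
    by rewrite mulrBr mulr1.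
  apply: (@le_trans _ _ (B * tscale N t)); last first.
    by apply: ler_wpM2r; [exact: ltW|rewrite lerDr].
  have iB : cintegrable leb (fun y : RT => hk t y * (ladder_weight mu nu y - 1)).
    have := cintegrableD hgi (cintegrableN hi); congr (cintegrable _ _).
    by apply/funext => y; rewrite mulrBr mulr1.
  have := nm_cintegral iB iK; rewrite RintegralZl// ce.
  have -> : 2 * (K * pi) = B * tscale N t by rewrite /K /B; ring.
  apply => y; rewrite nmM.
  apply: (@le_trans _ _ (nm (hk t y) * (2 * (`|mu| + nu) * `|y|))).
    by apply: ler_wpM2l; [exact: nm_ge0|exact: ladder_weight_sub1].
  have -> : nm (hk t y) * (2 * (`|mu| + nu) * `|y|) =
    2 * (`|mu| + nu) * (`|y| * nm (hk t y)) by ring.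
  rewrite /K -!mulrA; apply: ler_wpM2l => //; apply: ler_wpM2l => //.
  by rewrite mulrA; exact: (hC t y t0).2.
Qed.

Lemma cmeas_Phi : cmeas (Phi mu nu : RT -> R[i]).
Proof.
apply: (cmeas_cintegral leb (f := fun q : RT * RT => hk q.1 q.2 * ladder_weight mu nu q.2)).
apply: cmeasM; first exact: cmeas_hk2.
exact: (cmeas_comp (cmeas_ladder_weight mu nu) (@measurable_snd _ _ _ _)).
Qed.

Lemma tscale_le (s t : R) : 0 <= s -> s <= t -> tscale N s <= tscale N t.
Proof.
move=> s0 st; apply: ge0_ler_powR => //; rewrite ?nnegrE ?(le_trans s0)//.
Qed.

(** Approaching from the right, all integrands are dominated by the one at time [t]. One side is
    enough because the grids below round times up. *)
Lemma hk_cvg (tn : nat -> R) (t y : R) : 0 < t -> (forall n, t <= tn n) ->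
  tn @ \oo --> t -> ccvg (fun n => hk (tn n) y) (hk t y).
Proof.
move=> t0 ttn tnt.
have K : ccvg (fun n => cintegral leb (ek N (tn n) y)) (cintegral leb (ek N t y)).
  refine (@cintegral_dct R _ RT leb (fun n => ek N (tn n) y) (ek N t y)
    (fun u => expR (- (t * u ^+ N))) _ _ _ _).2.
  - by move=> n; exact: cmeas_ek.
  - move=> u; apply: ccvg_cexp; apply: ccvgD; first exact: ccvg_cst.
    rewrite -RtoCN; under eq_fun do rewrite -RtoCN.
    by apply: ccvg_real; apply: cvgN; apply: cvgM => //; exact: cvg_cst.
  - exact: expN_integrable.
  - move=> n u; rewrite nm_ek ler_expR lerN2; apply: ler_wpM2r => //.
    exact: expN_ge0.
by apply: ccvg_ext (ccvgZ ((2 * pi)^-1)%:C K) _ _ => [n|]; rewrite heat_kernelE.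
Qed.

Lemma Phi_cvg (tn : nat -> R) (t : R) : 0 < t -> (forall n, t <= tn n <= t + 1) ->
  tn @ \oo --> t -> ccvg (fun n => Phi mu nu (tn n)) (Phi mu nu t).
Proof.
move=> t0 tnb tnt.
have [C C0 hC] := hk_bound (R := R) N_gt2 N_even.
have t10 : 0 < t + 1 by rewrite addr_gt0.
have tn0 n : 0 < tn n by have /andP[h _] := tnb n; exact: lt_le_trans h.
pose c1 := (tscale N (t + 1))^-1; pose c2 := (tscale N t)^-1.
have c10 : 0 < c1 by rewrite invr_gt0 tscale_gt0.
have c20 : 0 < c2 by rewrite invr_gt0 tscale_gt0.
(* The majorant combines the greatest height [c2] and the greatest width [c1^-1] of the Cauchy
   densities for times between [t] and [t + 1]. *)
refine (@cintegral_dct R _ RT leb (fun n y => hk (tn n) y * ladder_weight mu nu y)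
  (fun y => hk t y * ladder_weight mu nu y) (fun y => C * (c2 / c1) * cauchyd c1 y) _ _ _ _).2.
- by move=> n; apply: cmeasM; [exact: cmeas_hk|exact: cmeas_ladder_weight].
- move=> y; apply: ccvgM; last exact: ccvg_cst.
  by apply: hk_cvg => // n; have /andP[] := tnb n.
- by have := integrableZl measurableT (C * (c2 / c1)) (integrable_cauchyd c10).
- move=> n y; rewrite nmM (@le_trans _ _ (nm (hk (tn n) y)))//.
    by rewrite ler_piMr ?nm_ge0// nm_ladder_weight.
  apply: (le_trans (hC _ y (tn0 n)).1); rewrite -mulrA; apply: ler_wpM2l => //.
  have /andP[h1 h2] := tnb n.
  set c := (tscale N (tn n))^-1.
  have cc1 : c1 <= c by rewrite lef_pV2 ?posrE ?tscale_gt0// tscale_le// ltW.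
  have cc2 : c <= c2 by rewrite lef_pV2 ?posrE ?tscale_gt0// tscale_le// ltW.
  have c0 : 0 < c by exact: lt_le_trans cc1.
  have -> : c2 / c1 * cauchyd c1 y = c2 / (1 + (c1 * y) ^+ 2).
    by rewrite /cauchyd mulrA divfK// gt_eqF.
  rewrite /cauchyd; apply: ler_pM => //; first exact: ltW.
    by rewrite invr_ge0 ltW// onesqr_gt0.
  rewrite lef_pV2 ?posrE ?onesqr_gt0// lerD2l !exprMn; apply: ler_wpM2r; first exact: sqr_ge0.
  by apply: lerXn2r => //; rewrite nnegrE ltW.
Qed.

(** With [g = 1/N], the integrand [t ^ (g - 1) * E t] has no elementary primitive, but [F] is a
    primitive of [g] times it plus [b * (1 + t - t ^ g) * E t], where [A] is a primitive of
    [(1 + t) * E t]. The added term is nonnegative because [t ^ g <= 1 + t], so integrability of the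
    sum [f] suffices. *)
Lemma integrable_singular (b : R) : 0 < b -> leb.-integrable setT
  (EFin \o (fun t : RT => if 0 < t then expR (- b * t) * (tscale N t / t) else 0)).
Proof.
move=> b0.
pose g : R := N%:R^-1.
have N0 : 0 < N%:R :> R by rewrite ltr0n (ltn_trans _ N_gt2).
have g0 : 0 < g by rewrite invr_gt0.
have g1 : g <= 1 by rewrite invf_le1// ler1n (ltn_trans _ N_gt2).
pose E t := expR (- b * t).
pose A t := - ((1 + t) / b + b^-1 ^+ 2) * E t.
pose f t := (g * (t `^ (g - 1))) * E t + b * ((1 + t - t `^ g) * E t).
pose F t := t `^ g * E t + b * A t.
have dE (t : R) : is_derive t (1 : R) E (- b * E t) := is_derive_expM (- b) t.
have dp (p t : R) : 0 < t -> is_derive t (1 : R) (fun t => t `^ p) (p * t `^ (p - 1)).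
  exact: is_derive1_powR.
have dl (t : R) : is_derive t (1 : R) (fun t : R => - ((1 + t) / b + b^-1 ^+ 2)) (- b^-1).
  have h := is_deriveN (is_deriveD (is_deriveZ b^-1 (is_deriveD (is_derive_cst (1 : R) t (1 : R))
    (is_derive_id t (1 : R)))) (is_derive_cst (b^-1 ^+ 2 : R) t (1 : R))).
  apply: is_derive_ext h _ _ => [x|]; rewrite /GRing.scale /=.
    by congr (- (_ + _)); rewrite mulrC.
  by rewrite add0r addr0 mulr1.
have dF (t : R) : 0 < t -> is_derive t (1 : R) F (f t).
  move=> t0; have h := is_deriveD (is_deriveM (dp g t t0) (dE t))
    (is_deriveZ b (is_deriveM (dl t) (dE t))).
  apply: is_derive_ext h _ _ => //; rewrite /GRing.scale /f /=.
  by field; rewrite gt_eqF.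
have cf (t : R) : 0 < t -> {for t, continuous f}.
  move=> t0.
  have h1 := is_deriveM (is_deriveZ g (dp (g - 1) t t0)) (dE t).
  have h2 := is_deriveZ b (is_deriveM (is_deriveB (is_deriveD
    (is_derive_cst (1 : R) t (1 : R)) (is_derive_id t (1 : R))) (dp g t t0)) (dE t)).
  by apply: is_derive_continuous (is_derive_ext (is_deriveD h1 h2) _ erefl) => x.
have E0 (t : R) : 0 <= E t := expR_ge0 _.
have pg (t : R) : 0 < t -> t `^ g <= 1 + t.
  move=> t0; have [t1|t1] := leP 1 t.
    by rewrite (le_trans (ler1_powR t1 g1))// lerDr.
  rewrite (@le_trans _ _ 1)//; last by rewrite lerDl ltW.
  have p1 : (1 : R) `^ g = 1 by rewrite powR1.
  by rewrite -[leRHS]p1; apply: ge0_ler_powR; rewrite ?nnegrE ?ltW.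
have f0 (t : R) : 0 < t -> 0 <= f t.
  move=> t0; apply: addr_ge0.
    by apply: mulr_ge0 => //; apply: mulr_ge0; [exact: ltW|exact: powR_ge0].
  apply: mulr_ge0; first exact: ltW.
  by apply: mulr_ge0 => //; rewrite subr_ge0 pg.
(* The constant adds [F u <= 1 + b^-1] at the right end [u] and [- F v <= b * (2 / b + b^-1 ^+ 2)]
   at the left end [v <= 1]. *)
have i := @integrable_exhaust R _ _ _ (@exhausts_gt0 R) f F dF cf
  (1 + b^-1 + b * (2 / b + b^-1 ^+ 2)) f0.
have {i} i : leb.-integrable setT (EFin \o (fun x : RT => if 0 < x then f x else 0)).
  apply: i => n; set u := n.+2%:R; set v := n.+1%:R^-1.
  have u0 : 0 < u :> R by rewrite ltr0n.
  have v0 : 0 < v :> R by rewrite invr_gt0 ltr0n.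
  have v1 : v <= 1 :> R by rewrite invf_le1 ?ler1n.
  have F1 : F u <= 1 + b^-1.
    rewrite /F -[leRHS]addr0; apply: lerD.
      apply: (@le_trans _ _ ((1 + u) * E u)); first by apply: ler_wpM2r; [exact: E0|exact: pg].
      rewrite /E mulNr expRN -ler_pdivlMr ?invr_gt0 ?expR_gt0// invrK.
      have := expR_ge1Dx (b * u) => h.
      apply: (@le_trans _ _ ((1 + b^-1) * (1 + b * u))); last first.
        by apply: ler_wpM2l => //; rewrite addr_ge0// invr_ge0 ltW.
      have -> : (1 + b^-1) * (1 + b * u) = 1 + u + (b^-1 + b * u) by field; rewrite gt_eqF.
      by rewrite lerDl addr_ge0 ?invr_ge0 ?mulr_ge0// ltW.
    apply: mulr_ge0_le0; first exact: ltW.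
    apply: mulr_le0_ge0 => //; rewrite oppr_le0; apply: addr_ge0; last exact: sqr_ge0.
    by apply: divr_ge0; [apply: addr_ge0 => //; exact: ltW|exact: ltW].
  apply: lerD => //; rewrite /F opprD -[leRHS]add0r; apply: lerD.
    by rewrite oppr_le0 mulr_ge0// powR_ge0.
  rewrite -mulrN; apply: ler_wpM2l; first exact: ltW.
  rewrite /A mulNr opprK -[leRHS]mulr1; apply: ler_pM => //.
  - apply: addr_ge0; last exact: sqr_ge0.
    by apply: divr_ge0; [apply: addr_ge0 => //; exact: ltW|exact: ltW].
  - by rewrite lerD2r ler_pM2r ?invr_gt0// (_ : 2 = 1 + 1)// lerD2l.
  - rewrite /E -expR0 ler_expR mulNr oppr_le0.
    by apply: mulr_ge0; exact: ltW.
have mf : measurable_fun setT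
   (fun t : RT => if 0 < t then expR (- b * t) * (tscale N t / t) else 0).
  apply: (measurable_exhaust (@exhausts_gt0 R)) => t t0.
  have h := is_deriveM (dE t) (is_deriveM (dp g t t0)
    (is_deriveV (lt0r_neq0 t0) (is_derive_id t (1 : R)))).
  by apply: is_derive_continuous (is_derive_ext h _ erefl) => x.
have iZ := integrableZl measurableT g^-1 i.
apply: (le_integrable measurableT _ _ iZ); first exact/measurable_EFinP.
move=> t _; rewrite /= lee_fin; case: ifPn => t0; last by rewrite normr0.
have q : tscale N t / t = t `^ (g - 1).
  by rewrite /tscale -/g -(mulr_powRB1 (ltW t0) g0) mulrAC mulfV ?mul1r// gt_eqF.
have l0 : 0 <= expR (- b * t) * (tscale N t / t).
  by rewrite q mulr_ge0 ?expR_ge0 ?powR_ge0.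
rewrite (ger0_norm l0) ger0_norm; last first.
  by apply: mulr_ge0; [rewrite invr_ge0 ltW|exact: f0].
have qE : g * (expR (- b * t) * t `^ (g - 1)) = g * t `^ (g - 1) * E t.
  by rewrite mulrCA mulrC.
rewrite q ler_pdivlMl// qE /f lerDl; apply: mulr_ge0; first exact: ltW.
by apply: mulr_ge0 => //; rewrite subr_ge0 pg.
Qed.

End PhiBounds.

(** * The exponential formula *)

Section ExponentialFormula.
Context {R : realType} (N : nat) (N_gt2 : (2 < N)%N) (N_even : ~~ odd N).
Notation RT := (measurableTypeR R).
Notation leb := (@lebesgue_measure R).
Notation theta := (@theta R N).
Notation Phi := (@Phi R N).
Variables (mu nu : R) (nu0 : 0 <= nu) (lam : R[i]) (lam_re : 0 < complex.Re lam).

Let N_gt0 : (0 < N)%N := ltn_trans (isT : (0 < 2)%N) N_gt2.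
Let NC0 : N%:R != 0 :> R[i]. Proof. by rewrite pnatr_eq0 -lt0n. Qed.
Let r0 := principal_root N lam.
Let a := complex.Re lam.

Definition posinv (t : R) : R := if 0 < t then t^-1 else 0.

Lemma measurable_posinv : measurable_fun setT (posinv : RT -> R).
Proof.
apply: (measurable_exhaust (@exhausts_gt0 R)) => t t0.
have h := is_deriveV (lt0r_neq0 t0) (is_derive_id t (1 : R)).
by apply: is_derive_continuous (is_derive_ext h _ erefl) => x.
Qed.

(* The parameter [s] rescales [lam] to [lam * s ^ N]; the quotient by [t] cancels
   in the derivative with respect to [s]. *)
Definition frullani (s t : R) : R[i] :=
  cexp (- (lam * t%:C) * s%:C ^+ N) * (Phi mu nu t - 1) * (posinv t)%:C.
Definition frullani_deriv (s t : R) : R[i] :=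
  if 0 < t then - (lam * (N%:R * s%:C ^+ N.-1)) *
    (cexp (- (lam * t%:C) * s%:C ^+ N) * (Phi mu nu t - 1)) else 0.

Lemma nm_cexp_lam (s t : R) :
  nm (cexp (- (lam * t%:C) * s%:C ^+ N)) = expR (- (a * s ^+ N) * t).
Proof.
rewrite nm_cexp -RtoCX cReM /= mulr0 subr0 cReN cReM /= mulr0 subr0.
by congr expR; rewrite -/a; ring.
Qed.

Lemma cmeas_frullani s : cmeas (frullani s : RT -> R[i]).
Proof.
apply: cmeasM; last by apply: cmeas_real; exact: measurable_posinv.
apply: cmeasM.
  apply: cmeas_cexp; apply: cmeasM; last exact: cmeas_cst.
  under eq_fun do rewrite -mulNr.
  by apply: cmeasM; [exact: cmeas_cst|exact: cmeas_real].
under eq_fun do rewrite -[_ - 1]/(_ + (- 1)).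
by apply: cmeasD; [exact: cmeas_Phi|exact: cmeas_cst].
Qed.

(** The free rate [b] provides one majorant for all [s] with [b <= a * s ^+ N], as dominated
    convergence in [s] requires. *)
Lemma frullani_bound : exists2 C : R, 0 <= C & forall (b s t : R),
  b <= a * s ^+ N ->
  nm (frullani s t) <= C * (if 0 < t then expR (- b * t) * (tscale N t / t) else 0).
Proof.
have [C C0 hC] := Phi_bound N_gt2 N_even mu nu0.
exists C => // b s t bs; rewrite /frullani /posinv; case: ifPn => t0; last first.
  by rewrite !mulr0 nm0.
rewrite 2!nmM nm_cexp_lam nmR ger0_norm; last by rewrite invr_ge0 ltW.
have -> : C * (expR (- b * t) * (tscale N t / t)) = expR (- b * t) * (C * tscale N t) * t^-1 by ring.
apply: ler_wpM2r; first by rewrite invr_ge0 ltW.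
apply: ler_pM; rewrite ?expR_ge0 ?nm_ge0//; last exact: (hC t t0).2.
by rewrite ler_expR !mulNr lerN2; apply: ler_wpM2r => //; exact: ltW.
Qed.

Let as0 s : 0 < s -> 0 < a * s ^+ N.
Proof. by move=> s0; rewrite mulr_gt0// exprn_gt0. Qed.

Lemma cintegrable_frullani s : 0 < s -> cintegrable leb (frullani s : RT -> R[i]).
Proof.
move=> s0; have [C C0 hC] := frullani_bound.
apply: (cintegrable_dom (cmeas_frullani s) _ (fun t => hC _ s t (lexx _))).
by have := integrableZl measurableT C (integrable_singular N_gt2 (as0 s0)).
Qed.

(** The bound [1/2] could be any number in []0, 1[]: it leaves [s = 1] inside while keeping the
    derivative in [s] under a fixed integrable exponential in [t]. *)
Lemma cder_cintegral_frullani (s : R) : 2^-1 < s ->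
  cder (fun s => cintegral leb (frullani s)) s (cintegral leb (frullani_deriv s)).
Proof.
move=> s2; have [C C0 hC] := Phi_bound N_gt2 N_even mu nu0.
have h0 : 0 < 2^-1 :> R by rewrite invr_gt0.
pose b := a * 2^-1 ^+ N.
have b0 : 0 < b by exact: as0.
pose K := nm lam * (N%:R * (s + 1) ^+ N.-1) * (C + 1).
apply: (@cder_under_integral R frullani frullani_deriv s 2^-1 (s + 1)
  (fun t : RT => K * (if 0 < t then expR (- b * t) else 0))).
- by rewrite s2 /= ltrDl ltr01.
- by move=> x /andP[x0 _]; apply: cintegrable_frullani; exact: lt_trans x0.
- move=> x t _; rewrite /frullani /frullani_deriv /posinv; case: ifPn => t0; last first.
    apply: cder_ext (cder_cst 0 x) _ _ => [u|//]; by rewrite mulr0.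
  have h := cder_cexp (cderZ (- (lam * t%:C)) (cderX N.-1 (cder_id x))).
  have h2 := cderZ ((Phi mu nu t - 1) * (t^-1)%:C) h.
  have tn0 : t%:C != 0 :> R[i] by rewrite RtoC_eq0 gt_eqF.
  apply: cder_ext h2 _ _ => [u|]; first by rewrite prednK//; ring.
  rewrite prednK// RtoCV mulr1; move: (cexp _) => ce; field.
  exact: tn0.
- move=> x t /andP[x0 x1]; rewrite /frullani_deriv; case: ifPn => t0; last by rewrite nm0 mulr0.
  have xp : 0 < x by exact: lt_trans x0.
  rewrite nmM nmN [nm (lam * _)]nmM -RtoCn -RtoCX -RtoCM nmR.
  rewrite !ger0_norm ?mulr_ge0 ?exprn_ge0 ?(ltW xp)//.
  rewrite [nm (cexp _ * _)]nmM nm_cexp_lam.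
  have -> : K * expR (- b * t) = nm lam * (N%:R * (s + 1) ^+ N.-1) * (expR (- b * t) * (C + 1)).
    by rewrite /K; ring.
  apply: ler_pM; rewrite ?mulr_ge0 ?nm_ge0 ?expR_ge0 ?exprn_ge0 ?(ltW xp)//.
    apply: ler_wpM2l; first exact: nm_ge0.
    apply: ler_wpM2l => //; apply: lerXn2r; rewrite ?nnegrE ?(ltW xp)//.
      by rewrite addr_ge0// ltW// (lt_trans h0).
    exact: ltW.
  apply: ler_pM; rewrite ?nm_ge0 ?expR_ge0//.
    rewrite ler_expR !mulNr lerN2; apply: ler_wpM2r; first exact: ltW.
    apply: ler_wpM2l; first exact: ltW.
    by apply: lerXn2r; rewrite ?nnegrE ?(ltW xp) ?(ltW h0)// ltW.
  by rewrite (le_trans (nmB _ _))// nm1 lerD2r (hC t t0).1.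
- have bC : 0 < complex.Re (b%:C) by [].
  have [ie _] := cintegral_cexpN_gt0 bC.
  have := integrableZl measurableT K ie.1; congr (_.-integrable _ _).
  apply/funext => t; rewrite /= -EFinM; congr (_%:E); case: ifP => // _.
  by rewrite -RtoCN -RtoCM cexp_real.
Qed.

Definition cshift (l : 'I_N) : R[i] := if inJ R l then nu%:C - 'i * mu%:C else - ('i * mu%:C).

Let W (s : R) : R[i] := r0 * s%:C.

Lemma rootX s : W s ^+ N = lam * (s ^+ N)%:C.
Proof. by rewrite /W exprMn principal_rootX// RtoCX. Qed.

Lemma root_re s l : 0 < s -> if inJ R l then 0 < complex.Re (theta l * W s)
  else complex.Re (theta l * W s) < 0.
Proof.
move=> s0; have := Re_theta_root N_gt2 N_even lam_re l.
rewrite /W mulrA [_ * s%:C]mulrC cReZ -/r0; case: ifP => _ h.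
  by rewrite mulr_gt0.
by rewrite pmulr_rlt0.
Qed.

Lemma root_shift_neq0 s l : 0 < s -> theta l * W s + cshift l != 0.
Proof.
move=> s0; apply/eqP => h; have := congr1 (@complex.Re R) h; rewrite cReD /cshift.
have := root_re l s0; move: (complex.Re (_ * _)) => X; case: ifP => _ k.
  rewrite cReD cReN Re_imR oppr0 addr0 [complex.Re nu%:C]/= [RHS]/=; move: k nu0; lra.
by rewrite cReN Re_imR oppr0 addr0 [RHS]/=; move: k; lra.
Qed.

Lemma resolvent_valueE s : resolvent_value N (W s) (lam * (s ^+ N)%:C) mu nu =
  (N%:R * (lam * (s ^+ N)%:C))^-1 *
    \sum_(l < N) theta l * W s / (theta l * W s + cshift l).
Proof.
rewrite /resolvent_value; congr (_ * _).
rewrite [RHS](bigID (fun l => inJ R l)) /=; congr (_ + _).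
  by apply: eq_bigr => l Jl; rewrite /cshift Jl addrA.
apply: eq_big => [l|l]; first by rewrite inKE.
by rewrite inKE// => Kl; rewrite /cshift (negbTE Kl).
Qed.

(** With [1 / t] gone, what remains is the Laplace transform of [Phi - 1] at [lam * s ^+ N]. The
    transform of 1 supplies one unit per root, and [1 - b / (b + c) = c / (b + c)] for
    [b := theta l * W s] and [c := cshift l]. *)
Lemma cintegral_frullani_deriv (s : R) : 0 < s -> cintegral leb (frullani_deriv s) =
  \sum_(l < N) cshift l / (s%:C * (theta l * W s + cshift l)).
Proof.
move=> s0.
pose Lam := lam * (s ^+ N)%:C.
have Lre : 0 < complex.Re Lam by rewrite /Lam mulrC cReZ mulr_gt0// exprn_gt0.
have sC : s%:C != 0 :> R[i] by rewrite RtoC_eq0 gt_eqF.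
have lam0 : lam != 0 by apply/eqP => h; move: lam_re; rewrite h ltxx.
have Lam0 : Lam != 0 by rewrite mulf_neq0// RtoC_eq0 expf_neq0// gt_eqF.
have [i1 e1] := Phi_laplace N_gt2 N_even (rootX s) Lre (fun l => root_re l s0) mu nu0.
have [i2 e2] := cintegral_cexpN_gt0 Lre.
have -> : cintegral leb (frullani_deriv s) = cintegral leb (fun t : RT =>
   - (lam * (N%:R * s%:C ^+ N.-1)) *
   ((if 0 < t then cexp (- Lam * t%:C) * Phi mu nu t else 0) -
    (if 0 < t then cexp (- Lam * t%:C) else 0))).
  apply: eq_cintegral => t; rewrite /frullani_deriv; case: ifP => _; last by rewrite subrr mulr0.
  congr (_ * _); rewrite mulrBr mulr1; congr (cexp _ * _ - cexp _).
  - by rewrite /Lam RtoCX; ring.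
  - by rewrite /Lam RtoCX; ring.
rewrite cintegralZ; last exact: cintegrableD i1 (cintegrableN i2).
rewrite cintegralB// e1 e2 resolvent_valueE -/Lam.
have LE : Lam = lam * s%:C ^+ N.-1 * s%:C by rewrite /Lam RtoCX -[in LHS](prednK N_gt0) exprSr mulrA.
have E l : cshift l / (s%:C * (theta l * W s + cshift l)) =
    s%:C^-1 * (1 - theta l * W s / (theta l * W s + cshift l)).
  have := root_shift_neq0 l s0; move: (W s) (cshift l) (theta l) s%:C sC => w c t z z0 h.
  by field; rewrite z0 h.
under [RHS]eq_bigr do rewrite E.
rewrite -mulr_sumr sumrB sumr_const card_ord.
set S := \sum_(i < N) _.
have X0 : lam * s%:C ^+ N.-1 != 0 by rewrite mulf_neq0// expf_neq0.
rewrite LE -[1 *+ N]/(N%:R : R[i]).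
have -> : - (lam * (N%:R * s%:C ^+ N.-1)) = - (N%:R * (lam * s%:C ^+ N.-1)) by ring.
move: (lam * s%:C ^+ N.-1) X0 => X X0.
by move: (N%:R : R[i]) NC0 => n n0; field; rewrite X0 sC n0.
Qed.

(** For [s != 0] this is the inverse of the [l]-th factor, [(theta l * W s + cshift l) / (theta l *
    W s)], in a form whose limit at infinity is visible. *)
Let q (l : 'I_N) (s : R) : R[i] := 1 + cshift l / (theta l * r0) * (s^-1)%:C.

Let r00 : r0 != 0. Proof. exact: principal_root_neq0. Qed.

Lemma cder_q l (s : R) : 0 < s ->
  cder (q l) s (q l s * (- (cshift l / (s%:C * (theta l * W s + cshift l))))).
Proof.
move=> s0.
have h := is_deriveV (lt0r_neq0 s0) (is_derive_id s (1 : R)).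
have h1 := cderD (cder_cst 1 s) (cderZ (cshift l / (theta l * r0)) (cder_real h)).
apply: cder_ext h1 _ _ => // ; rewrite add0r /q /W.
have sC : s%:C != 0 :> R[i] by rewrite RtoC_eq0 gt_eqF.
have k := root_shift_neq0 l s0; rewrite /W in k.
have t0 := theta_neq0 l (R := R).
rewrite /GRing.scale /= mulr1 RtoCN RtoCV RtoCX [(s^-1)%:C]RtoCV.
move: (cshift l) k t0 r00 sC; move: (theta l) (s%:C) r0 => t z r c k t0 r1 z0.
by field; rewrite z0 r1 t0 k.
Qed.

(* Constant in [s], and tending to 1 at infinity. *)
Let H (s : R) : R[i] := cexp (cintegral leb (frullani s)) * \prod_(l < N) q l s.

Lemma cder_H (s : R) : 2^-1 < s -> cder H s 0.
Proof.
move=> s2; have s0 : 0 < s by rewrite (lt_trans _ s2)// invr_gt0.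
have h1 := cder_cexp (cder_cintegral_frullani s2).
have h2 := @cder_prod_log R _ (index_enum 'I_N) xpredT (fun l => q l) _ s (fun l _ => cder_q l s0).
apply: cder_ext (cderM h1 h2) _ _ => //.
rewrite cintegral_frullani_deriv// sumrN; move: (cexp _) (\prod_(l < N) _) (\sum_(l < N) _) => x y z.
by ring.
Qed.

Lemma H_cvg : ccvg (fun n => H n.+1%:R) 1.
Proof.
rewrite -[X in ccvg _ X]mulr1; apply: ccvgM.
  rewrite -[X in ccvg _ X]cexp0; apply: ccvg_cexp.
  have [C C0 hC] := frullani_bound.
  have := @cintegral_dct R _ RT leb (fun n => frullani n.+1%:R) (fun=> 0)
    (fun t => C * (if 0 < t then expR (- a * t) * (tscale N t / t) else 0)).
  rewrite cintegral0 => D; apply: (D _ _ _ _).2.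
  - by move=> n; exact: cmeas_frullani.
  - move=> t; rewrite /frullani /posinv; case: ifPn => t0; last first.
      by under eq_fun do rewrite mulr0; exact: ccvg_cst.
    rewrite -[X in ccvg _ X](mul0r ((Phi mu nu t - 1) * (t^-1)%:C)).
    under eq_fun do rewrite -mulrA.
    apply: ccvgM; last exact: ccvg_cst.
    apply: (ccvg_nm (e := fun n => expR (- (a * t * n.+1%:R)))).
      move=> n; rewrite subr0 nm_cexp_lam ler_expR mulNr lerN2.
      have -> : a * n.+1%:R ^+ N * t = a * t * n.+1%:R ^+ N by ring.
      apply: ler_wpM2l; first by rewrite mulr_ge0// ltW.
      by apply: ler_eXnr => //; rewrite ler1n.
    have ct : 0 < a * t by rewrite mulr_gt0.
    exact: (cvg_comp _ _ (cvgMl_pinfty ct cvg_natS_pinfty) (@cvgr_expR R)).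
  - by have := integrableZl measurableT C (integrable_singular N_gt2 lam_re).
  - move=> n t; apply: hC; rewrite -[leLHS]mulr1; apply: ler_wpM2l; first exact: ltW.
    by rewrite exprn_ege1// ler1n.
have Q l : ccvg (fun n => q l n.+1%:R) 1.
  rewrite -[X in ccvg _ X]addr0; apply: ccvgD; first exact: ccvg_cst.
  rewrite -[X in ccvg _ X](mulr0 (cshift l / (theta l * r0))).
  by apply: ccvgZ; apply: (ccvg_real (l := 0)); exact: cvg_harmonic.
elim: (index_enum _) => [|l ls ih].
  by apply: ccvg_ext (ccvg_cst 1) _ _ => // n; rewrite big_nil.
by apply: ccvg_ext (ccvgM (Q l) ih) _ _ => [n|]; rewrite ?big_cons ?mulr1.
Qed.

Lemma cexp_cintegral_frullani : cexp (cintegral leb (frullani 1)) =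
  \prod_(l < N) (theta l * r0 / (theta l * r0 + cshift l)).
Proof.
have h2 : 2^-1 < 1 :> R by rewrite invf_lt1// ltr1n.
have H1 : H 1 = 1.
  have e n : H n.+1%:R = H 1.
    apply: (cder0_cst cder_H) => //.
    by rewrite (lt_le_trans h2)// ler1n.
  by have := H_cvg; rewrite (funext e) => /(ccvg_unique (ccvg_cst (H 1))).
have P0 : \prod_(l < N) q l 1 != 0.
  by apply/eqP => h; move: H1; rewrite /H h mulr0 => /eqP; rewrite eq_sym oner_eq0.
apply: (mulIf P0); rewrite [LHS]H1 -big_split /= big1// => l _.
have := root_shift_neq0 l (ltr01 : 0 < 1 :> R); rewrite /W mulr1 /q invr1 mulr1 => k.
have t0 := theta_neq0 l (R := R).
move: k t0 r00; move: (theta l) r0 (cshift l) => t r c k t0 r1.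
by field; rewrite k r1 t0.
Qed.

End ExponentialFormula.

(** * The exponential of a power series *)

Section PolynomialGeometric.
Context {R : realType}.

Lemma geometric_sum_le (r : R) n : 0 <= r -> r < 1 -> \sum_(i < n) r ^+ i <= (1 - r)^-1.
Proof.
move=> r0 r1; have s0 : 0 < 1 - r by rewrite subr_gt0.
rewrite -[leRHS]mul1r ler_pdivlMr//.
have := subrX1 r n; set S := \sum_(i < n) _ => h.
have -> : S * (1 - r) = 1 - r ^+ n by rewrite -[r ^+ n](subrK 1) h; ring.
by rewrite gerBl exprn_ge0.
Qed.

Lemma bernoulli_le (x : R) n : 0 <= x -> 1 + n%:R * x <= (1 + x) ^+ n.
Proof.
move=> x0; elim: n => [|n ih]; first by rewrite mul0r addr0 expr0.
have p : 0 <= 1 + x by rewrite addr_ge0.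
rewrite exprS; apply: le_trans (ler_wpM2l p ih).
have -> : (1 + x) * (1 + n%:R * x) = 1 + n.+1%:R * x + n%:R * x ^+ 2.
  by rewrite -natr1; ring.
by rewrite lerDl mulr_ge0// sqr_ge0.
Qed.

(** Half of the decay, [s ^+ n] with [s := Num.sqrt r], is spent on one factor [n.+1]: indeed
    [n.+1 * s ^+ n] is at most the geometric sum of [s]. The other half is left to the induction. *)
Lemma poly_geometric_bounded p (r : R) : 0 <= r -> r < 1 ->
  exists C : R, forall n, n.+1%:R ^+ p * r ^+ n <= C.
Proof.
elim: p r => [|p ih] r r0 r1.
  by exists 1 => n; rewrite expr0 mul1r exprn_ile1// ltW.
pose s := Num.sqrt r.
have s0 : 0 <= s := sqrtr_ge0 r.
have sE : s ^+ 2 = r by rewrite sqr_sqrtr.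
have s1 : s < 1 by rewrite -[ltRHS](sqrtr1 R) ltr_sqrt.
have [C hC] := ih s s0 s1.
exists (C * (1 - s)^-1) => n.
have -> : n.+1%:R ^+ p.+1 * r ^+ n = (n.+1%:R ^+ p * s ^+ n) * (n.+1%:R * s ^+ n).
  by rewrite -sE -exprM mulnC exprM exprSr expr2; ring.
apply: ler_pM => //; rewrite ?mulr_ge0 ?exprn_ge0//.
apply: le_trans (geometric_sum_le n.+1 s0 s1).
have -> : n.+1%:R * s ^+ n = \sum_(i < n.+1) s ^+ n.
  by rewrite sumr_const card_ord mulr_natl.
apply: ler_sum => i _; apply: ler_wiXn2l => //; first exact: ltW.
by rewrite -ltnS.
Qed.

Lemma cvg_poly_geometric p (r : R) : 0 <= r -> r < 1 ->
  (fun n => n.+1%:R ^+ p * r ^+ n) @ \oo --> (0 : R).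
Proof.
move=> r0 r1; pose s := Num.sqrt r.
have s0 : 0 <= s := sqrtr_ge0 r.
have sE : s ^+ 2 = r by rewrite sqr_sqrtr.
have s1 : s < 1 by rewrite -[ltRHS](sqrtr1 R) ltr_sqrt.
have [C hC] := poly_geometric_bounded p s0 s1.
have h : (fun n => C * s ^+ n) @ \oo --> (0 : R).
  rewrite -[X in _ --> X](mulr0 C); apply: cvgM; first exact: cvg_cst.
  by apply: cvg_expr; rewrite ger0_norm.
apply: (squeeze_cvgr _ (cvg_cst 0) h); near=> n.
rewrite mulr_ge0 ?exprn_ge0//=.
have -> : n.+1%:R ^+ p * r ^+ n = (n.+1%:R ^+ p * s ^+ n) * s ^+ n.
  by rewrite -sE -exprM mulnC exprM expr2; ring.
by apply: ler_wpM2r => //; rewrite exprn_ge0.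
Unshelve. all: by end_near.
Qed.

Lemma triangle_sum (V : nmodType) (G : nat -> nat -> V) n :
  \sum_(k < n) \sum_(j < k.+1) G j (k - j)%N = \sum_(j < n) \sum_(i < n - j) G j i.
Proof.
elim: n => [|n ih]; first by rewrite !big_ord0.
rewrite big_ord_recr /= ih [RHS]big_ord_recr /= subSnn big_ord1.
under [in RHS]eq_bigr => j _ do rewrite (subSn (ltnW (ltn_ord j))) big_ord_recr /=.
by rewrite big_split /= -addrA; congr (_ + _); rewrite big_ord_recr /= subnn.
Qed.

End PolynomialGeometric.

Section NewtonRecursion.
Context {R : realType} (a c : nat -> R[i]) (A : nat).
Hypothesis aA : forall j, nm (a j) <= A%:R.
Hypothesis c0 : c 0%N = 1.
Hypothesis cS : forall k, k.+1%:R * c k.+1 = \sum_(j < k.+1) a j.+1 * c (k - j)%N.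

(** By the recursion, each new term multiplies the sum by at most [1 + A / k.+1], which Bernoulli's
    inequality bounds by [(1 + 1 / k.+1) ^+ A]; these factors telescope to a power of degree [A].
    Hence the choice of a natural number for [A]. *)
Lemma newton_coef_sum k : \sum_(i < k.+1) nm (c i) <= k.+1%:R ^+ A.
Proof.
elim: k => [|k ih]; first by rewrite big_ord1 c0 nm1 expr1n.
rewrite big_ord_recr /=; set S := \sum_(i < k.+1) _ in ih *.
have k0 : 0 < k.+1%:R :> R by [].
have h : nm (c k.+1) <= A%:R * S / k.+1%:R.
  rewrite ler_pdivlMr// mulrC -[X in X * _](ger0_norm (ltW k0)) -nmR RtoCn -nmM cS.
  apply: le_trans (nm_sum _ _ _) _.
  have -> : S = \sum_(j < k.+1) nm (c (k - j)%N).
    by rewrite /S (reindex_inj rev_ord_inj); apply: eq_bigr => j _; rewrite [nat_of_ord _]/= subSS.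
  rewrite mulr_sumr; apply: ler_sum => j _.
  by rewrite nmM; apply: (ler_wpM2r (nm_ge0 _)); exact: aA.
apply: (@le_trans _ _ (S * (1 + A%:R / k.+1%:R))).
  by rewrite mulrDr mulr1 lerD2l (le_trans h)// mulrA [S * _]mulrC.
apply: (@le_trans _ _ (k.+1%:R ^+ A * (1 + k.+1%:R^-1) ^+ A)).
  apply: ler_pM => //; first by apply: sumr_ge0 => i _; exact: nm_ge0.
  by apply: bernoulli_le; rewrite invr_ge0.
by rewrite -exprMn mulrDr mulr1 divff ?gt_eqF// natr1.
Qed.

(* Along the segment from 0 to [z], only the terms of index [i + j > n] survive in
   the derivative of the truncated [f * exp (- A)]. *)
Lemma newton_series (z : R[i]) : nm z < 1 ->
  ccvg (fun n => (\sum_(k < n.+1) c k * z ^+ k) *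
    cexp (- \sum_(j < n) a j.+1 * z ^+ j.+1 / j.+1%:R)) 1.
Proof.
move=> z1; have z0 : 0 <= nm z := nm_ge0 z.
pose B := expR (A%:R * (1 - nm z)^-1).
pose e n : R := 2 * (A%:R * B) * (n.+1%:R ^+ A.+1 * nm z ^+ n).
have e0 : e @ \oo --> 0.
  rewrite -[X in _ --> X](mulr0 (2 * (A%:R * B))); apply: cvgM; first exact: cvg_cst.
  exact: cvg_poly_geometric.
apply: ccvg_nm e0 => n.
pose f (r : R) := 1 + \sum_(k < n) c k.+1 * z ^+ k.+1 * r%:C ^+ k.+1.
pose E (r : R) := \sum_(j < n) a j.+1 * z ^+ j.+1 / j.+1%:R * r%:C ^+ j.+1.
pose df (r : R) := \sum_(k < n) k.+1%:R * c k.+1 * z ^+ k.+1 * r%:C ^+ k.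
pose dE (r : R) := \sum_(j < n) a j.+1 * z ^+ j.+1 * r%:C ^+ j.
have nC j : j.+1%:R != 0 :> R[i] by rewrite pnatr_eq0.
have Df r : cder f r (df r).
  rewrite -[df r]add0r; apply: cderD; first exact: cder_cst.
  apply: cder_sum => k _.
  apply: cder_ext (cderZ (c k.+1 * z ^+ k.+1) (cderX k (cder_id r))) _ _; first by [].
  by ring.
have DE r : cder E r (dE r).
  apply: cder_sum => j _.
  apply: cder_ext (cderZ (a j.+1 * z ^+ j.+1 / j.+1%:R) (cderX j (cder_id r))) _ _; first by [].
  move: (z ^+ j.+1) (j.+1%:R : R[i]) (r%:C ^+ j) (nC j) => x y w h.
  by field.
have fE r : f r = \sum_(k < n.+1) c k * z ^+ k * r%:C ^+ k.
  by rewrite big_ord_recl c0 !expr0 !mulr1.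
pose F r := f r * cexp (- E r).
pose dF r := (df r - dE r * f r) * cexp (- E r).
have DF r : cder F r (dF r).
  apply: cder_ext (cderM (Df r) (cder_cexp (cderN (DE r)))) _ _ => //.
  by rewrite /dF; move: (cexp _) => x; ring.
have nE r : 0 <= r <= 1 -> nm (cexp (- E r)) <= B.
  move=> /andP[r0 r1]; rewrite nm_cexp ler_expR.
  apply: le_trans (le_trans (ler_norm _) (Re_le_nm _)) _; rewrite nmN.
  apply: le_trans (nm_sum _ _ _) _.
  apply: (@le_trans _ _ (\sum_(j < n) A%:R * nm z ^+ j)); last first.
    by rewrite -mulr_sumr; apply: ler_wpM2l => //; exact: geometric_sum_le.
  apply: ler_sum => j _.
  rewrite [nm (_ * _ ^+ _)]nmM -RtoCX nmR ger0_norm ?exprn_ge0//.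
  rewrite -[leRHS]mulr1; apply: ler_pM; rewrite ?nm_ge0 ?exprn_ge0 ?exprn_ile1//.
  rewrite nmM -[leRHS]mulr1; apply: ler_pM; rewrite ?nm_ge0//; last first.
    rewrite nmV -RtoCn nmR ger0_norm// invf_le1 ?ler1n//.
  rewrite nmM; apply: ler_pM; rewrite ?nm_ge0//.
  rewrite nmX; apply: ler_wiXn2l => //; exact: ltW.
pose G (r : R) j i := a j.+1 * c i * z ^+ (j + i).+1 * r%:C ^+ (j + i).
have dfE r : df r - dE r * f r = - \sum_(j < n) \sum_(i < n.+1 | (n - j <= i)%N) G r j i.
  have -> : df r = \sum_(j < n) \sum_(i < n - j) G r j i.
    rewrite -triangle_sum; apply: eq_bigr => k _.
    rewrite cS -mulrA mulr_suml; apply: eq_bigr => j _.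
    by rewrite /G subnKC ?mulrA// -ltnS.
  have -> : dE r * f r = \sum_(j < n) \sum_(i < n.+1) G r j i.
    rewrite fE mulr_suml; apply: eq_bigr => j _; rewrite mulr_sumr; apply: eq_bigr => i _.
    by rewrite /G -addSn 2!exprD; ring.
  rewrite -sumrB -sumrN; apply: eq_bigr => j _.
  have jn : (n - j <= n.+1)%N by rewrite (leq_trans (leq_subr _ _)).
  rewrite (big_ord_widen _ (G r j) jn) [X in _ - X](bigID (fun i : 'I__ => (i < n - j)%N)) /=.
  rewrite opprD addNKr; congr (- _); apply: eq_bigl => i; by rewrite -leqNgt.
have dFb r : 0 <= r <= 1 -> nm (dF r) <= A%:R * B * (n.+1%:R ^+ A.+1 * nm z ^+ n).
  move=> r01; rewrite /dF nmM dfE nmN.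
  have -> : A%:R * B * (n.+1%:R ^+ A.+1 * nm z ^+ n) =
      n.+1%:R * (A%:R * (n.+1%:R ^+ A * nm z ^+ n)) * B by rewrite exprS; ring.
  apply: ler_pM; rewrite ?nm_ge0//; last exact: nE.
  apply: le_trans (nm_sum _ _ _) _.
  have Q0 : 0 <= A%:R * (n.+1%:R ^+ A * nm z ^+ n) by rewrite !mulr_ge0 ?exprn_ge0.
  apply: (@le_trans _ _ (\sum_(j < n) A%:R * (n.+1%:R ^+ A * nm z ^+ n))); last first.
    rewrite sumr_const card_ord -[leLHS]mulr_natl; apply: (ler_wpM2r Q0).
    by rewrite ler_nat.
  apply: ler_sum => j _; apply: le_trans (nm_sum _ _ _) _.
  have /andP[r0 r1] := r01.
  apply: (@le_trans _ _ (\sum_(i < n.+1) A%:R * nm z ^+ n * nm (c i))); last first.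
    rewrite -mulr_sumr -mulrA; apply: ler_wpM2l => //.
    rewrite mulrC; apply: ler_wpM2r; [exact: exprn_ge0|exact: newton_coef_sum].
  rewrite [leRHS](bigID (fun i : 'I__ => (n - j <= i)%N)) /= -[leLHS]addr0; apply: lerD; last first.
    by apply: sumr_ge0 => i _; rewrite !mulr_ge0 ?nm_ge0 ?exprn_ge0.
  apply: ler_sum => i hi; rewrite /G.
  rewrite [nm (_ * _%:C ^+ _)]nmM -RtoCX nmR ger0_norm ?exprn_ge0//.
  rewrite -[leRHS]mulr1; apply: ler_pM; rewrite ?nm_ge0 ?exprn_ge0 ?exprn_ile1//.
  rewrite [nm (_ * _)]nmM [nm (a _ * _)]nmM nmX.
  have -> : A%:R * nm z ^+ n * nm (c i) = A%:R * nm (c i) * nm z ^+ n by ring.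
  apply: ler_pM; rewrite ?mulr_ge0 ?nm_ge0 ?exprn_ge0//.
    by apply: ler_wpM2r; rewrite ?nm_ge0.
  apply: ler_wiXn2l => //; [exact: ltW|lia].
have := cder_mvt ler01 (fun x _ => DF x) dFb.
have -> : F 0 = 1.
  rewrite /F /f /E !big1 => [|k _|k _]; rewrite ?expr0n ?mulr0//.
  by rewrite addr0 oppr0 cexp0 mulr1.
rewrite subr0 mulr1 /e mulrA; congr (nm (_ - 1) <= _).
rewrite /F fE; congr (_ * cexp (- _)); apply: eq_bigr => k _; by rewrite expr1n mulr1.
Qed.

End NewtonRecursion.

(** * Spitzer's identity *)

Section Spitzer.
Context {R : realType}.
Notation RT := (measurableTypeR R).
Notation leb := (@lebesgue_measure R).
Variables (q : nat -> RT -> R[i]) (g : RT -> R[i]).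
Hypothesis qi : forall j, cintegrable leb (q j).
Hypothesis qqi : forall j x, cintegrable leb (fun y : RT => q 0%N (x - y) * q j y).
Hypothesis qS : forall j x, cintegral leb (fun y : RT => q 0%N (x - y) * q j y) = q j.+1 x.
Hypothesis gm : cmeas g.
Hypothesis g1 : forall s, nm (g s) <= 1.
Hypothesis g_le0 : forall s, s <= 0 -> g s = 1.
Hypothesis gD : forall s t, 0 <= s -> 0 <= t -> g (s + t) = g s * g t.

Definition bounded_cmeas (f : RT -> R[i]) :=
  cmeas f /\ exists B : R, forall s, nm (f s) <= B.

(** With [q j] as law of the walk after [j + 1] steps, this is the expectation of [f] at that moment
    from the start [s]; hence the argument [s + y]. *)
Definition convol j (f : RT -> R[i]) (s : RT) : R[i] :=
  cintegral leb (fun y : RT => q j y * f (s + y)).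

Lemma cintegrable_kernelM (p f : RT -> R[i]) : cintegrable leb p -> bounded_cmeas f ->
  cintegrable leb (fun y : RT => p y * f y).
Proof.
move=> pin [mf [B fB]].
apply: (@cintegrable_dom _ _ _ _ _ (fun y => B * nm (p y))).
- by apply: cmeasM => //; exact: cintegrable_cmeas pin.
- by have := integrableZl measurableT B (integrable_nm pin).
- by move=> y; rewrite nmM mulrC; apply: ler_wpM2r; rewrite ?nm_ge0.
Qed.

Lemma bounded_cmeas_comp (f : RT -> R[i]) (h : RT -> RT) :
  bounded_cmeas f -> measurable_fun setT h -> bounded_cmeas (fun s => f (h s)).
Proof.
by move=> [mf [B fB]] mh; split; [exact: cmeas_comp mf mh|exists B => s].
Qed.

Lemma bounded_cmeasM (f h : RT -> R[i]) :
  bounded_cmeas f -> bounded_cmeas h -> bounded_cmeas (fun s => f s * h s).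
Proof.
move=> [mf [B fB]] [mh [C hC]]; split; first exact: cmeasM.
by exists (B * C) => s; rewrite nmM; apply: ler_pM; rewrite ?nm_ge0.
Qed.

Lemma bounded_cintegral (p : RT -> R[i]) (h : RT * RT -> R[i]) (B : R) :
  cintegrable leb p -> cmeas h -> (forall z, nm (h z) <= B) ->
  bounded_cmeas (fun x => cintegral leb (fun y : RT => p y * h (x, y))).
Proof.
move=> pin mh hB; split.
  apply: (cmeas_cintegral leb (f := fun z : RT * RT => p z.2 * h z)).
  apply: cmeasM => //.
  exact: (cmeas_comp (cintegrable_cmeas pin) (@measurable_snd _ _ _ _)).
exists (2 * \int[leb]_y (B * nm (p y))) => s.
apply: nm_cintegral.
- apply: cintegrable_kernelM => //; split; last by exists B.
  exact: (cmeas_comp mh (measurable_pair1 s)).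
- by have := integrableZl measurableT B (integrable_nm pin).
- by move=> y; rewrite nmM mulrC; apply: ler_wpM2r; rewrite ?nm_ge0.
Qed.

Lemma bounded_convol j f : bounded_cmeas f -> bounded_cmeas (convol j f).
Proof.
move=> [mf [B fB]].
apply: (@bounded_cintegral _ (fun z : RT * RT => f (z.1 + z.2)) B) => //.
apply: (cmeas_comp mf (phi := fun z : RT * RT => z.1 + z.2 : RT)).
by apply: measurable_funD; [exact: measurable_fst|exact: measurable_snd].
Qed.

Lemma kernel_swap (p r : RT -> R[i]) (h : RT * RT -> R[i]) (B : R) :
  cintegrable leb p -> cintegrable leb r -> cmeas h -> (forall z, nm (h z) <= B) ->
  cintegral leb (fun y : RT => p y * cintegral leb (fun x : RT => r x * h (x, y))) =
  cintegral leb (fun x : RT => r x * cintegral leb (fun y : RT => p y * h (x, y))).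
Proof.
move=> pin rin mh hB.
have bh1 y : bounded_cmeas (fun x => h (x, y)).
  by split; [exact: (cmeas_comp mh (measurable_pair2 y))|exists B].
have bh2 x : bounded_cmeas (fun y => h (x, y)).
  by split; [exact: (cmeas_comp mh (measurable_pair1 x))|exists B].
have e1 (y : RT) : p y * cintegral leb (fun x : RT => r x * h (x, y)) =
    cintegral leb (fun x : RT => p y * r x * h (x, y)).
  rewrite -cintegralZ; last exact: cintegrable_kernelM.
  by apply: eq_cintegral => x; ring.
have e2 (x : RT) : r x * cintegral leb (fun y : RT => p y * h (x, y)) =
    cintegral leb (fun y : RT => p y * r x * h (x, y)).
  rewrite -cintegralZ; last exact: cintegrable_kernelM.
  by apply: eq_cintegral => y; ring.
rewrite (eq_cintegral _ e1) (eq_cintegral _ e2) -(@cfubini R _ _ RT RT leb leb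
  (fun x y => p y * r x * h (x, y)))//.
refine (@cintegrable_prodM R _ _ RT RT leb leb
    (fun z : RT * RT => p z.2 * r z.1 * h (z.1, z.2))
    (fun y => nm (p y)) (fun x => B * nm (r x)) _ _ _ _).
- apply: cmeasM; last by rewrite (_ : (fun t => _) = h)//; apply/funext => -[].
  apply: cmeasM.
    exact: (cmeas_comp (cintegrable_cmeas pin) (@measurable_snd _ _ _ _)).
  exact: (cmeas_comp (cintegrable_cmeas rin) (@measurable_fst _ _ _ _)).
- move=> x y; rewrite 2!nmM /=.
  have -> : B * nm (r x) * nm (p y) = nm (p y) * nm (r x) * B by ring.
  by apply: ler_wpM2l; rewrite ?mulr_ge0 ?nm_ge0.
- exact: integrable_nm.
- by have := integrableZl measurableT B (integrable_nm rin).
Qed.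

(** Recentring the inner integral at [s] and exchanging the two leaves the semigroup identity
    [qS]. *)
Lemma convol_comp j f s : bounded_cmeas f -> convol j (convol 0 f) s = convol j.+1 f s.
Proof.
move=> bf; have [mf [B fB]] := bf.
have B0 : 0 <= B := le_trans (nm_ge0 _) (fB 0).
have bfs a : bounded_cmeas (fun y => f (a + y)).
  by apply: bounded_cmeas_comp => //; exact: measurable_funD.
have e1 (x : RT) : q j x * convol 0 f (s + x) =
    cintegral leb (fun y : RT => q j x * (q 0%N (y - x) * f (s + y))).
  have i1 := cintegrable_kernelM (qi 0) (bfs (s + x)).
  have [i2 e2] := cintegral_shift (- x) i1.
  have E : (fun y : RT => q 0%N (y - x) * f (s + y)) =
      (fun t : RT => q 0%N (t - x) * f (s + x + (t - x))).
    by apply/funext => t; congr (_ * f _); ring.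
  by rewrite cintegralZ E// e2.
rewrite [LHS](eq_cintegral _ e1).
have ei : cintegrable (leb \x leb)%E
    (fun z : RT * RT => q j z.1 * (q 0%N (z.2 - z.1) * f (s + z.2))).
  have in0 x := integrable_shift (- x) (integrable_nm (qi 0)).
  pose I := \int[leb]_y nm (q 0%N y).
  refine (@cintegrable_prod R _ _ RT RT leb leb
    (fun z : RT * RT => q j z.1 * (q 0%N (z.2 - z.1) * f (s + z.2)))
    (fun x y => (nm (q j x) * B) * nm (q 0%N (y - x))) (fun x => (B * I) * nm (q j x)) _ _ _ _ _).
  - apply: cmeasM.
      exact: (cmeas_comp (cintegrable_cmeas (qi j)) (@measurable_fst _ _ _ _)).
    apply: cmeasM.
      apply: (cmeas_comp (cintegrable_cmeas (qi 0)) (phi := fun z : RT * RT => z.2 - z.1 : RT)).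
      by apply: measurable_funB; [exact: measurable_snd|exact: measurable_fst].
    exact: (cmeas_comp (bfs s).1 (@measurable_snd _ _ _ _)).
  - move=> x y; rewrite 2!nmM /= -mulrA; apply: ler_wpM2l; first exact: nm_ge0.
    by rewrite mulrC; apply: ler_wpM2r; rewrite ?nm_ge0.
  - by move=> x; have := integrableZl measurableT (nm (q j x) * B) (in0 x).1.
  - move=> x; rewrite RintegralZl//; last exact: (in0 x).1.
    have -> : B * I * nm (q j x) = nm (q j x) * B * I by ring.
    by rewrite (in0 x).2.
  - by have := integrableZl measurableT (B * I) (integrable_nm (qi j)).
rewrite (cfubini ei); apply: eq_cintegral => y.
have e2 (x : RT) : q j x * (q 0%N (y - x) * f (s + y)) =
    (q 0%N (y - x) * q j x) * f (s + y) by ring.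
by rewrite (eq_cintegral _ e2) cintegralZr// qS.
Qed.

(* For a walk S with step law [q 0], the expectation of
   g(max(0, s + S_1, ..., s + S_k)), where [s <= 0] is the height of the starting
   point relative to the maximum already reached. *)
Fixpoint spitzer_fun k (s : RT) : R[i] :=
  if k is k'.+1 then g s * convol 0 (spitzer_fun k') (Num.min s 0) else g s.
Notation w := spitzer_fun.

Lemma bounded_spitzer_fun k : bounded_cmeas (w k).
Proof.
have bg : bounded_cmeas g by split => //; exists 1.
elim: k => [|k ih] //=; apply: bounded_cmeasM => //.
apply: bounded_cmeas_comp; first exact: bounded_convol.
exact: measurable_minr.
Qed.

Lemma spitzer_fun_ge0 k s : 0 <= s -> w k s = g s * w k 0.
Proof.
move=> s0; case: k => [|k] /=; first by rewrite (g_le0 (lexx 0)) mulr1.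
by rewrite (min_r s0) (min_r (lexx 0)) (g_le0 (lexx 0)) mul1r.
Qed.

Lemma spitzer_fun_le0 k s : s <= 0 -> w k.+1 s = convol 0 (w k) s.
Proof. by move=> s0 /=; rewrite (min_l s0) g_le0// mul1r. Qed.

Let pos (x : RT) : RT := Num.max x 0.

Let pos_ge0 x : 0 <= pos x. Proof. by rewrite /pos le_max lexx orbT. Qed.

(** The right side of Spitzer's identity for an arbitrary start [s], which the induction on [k]
    requires. At [s = 0] the second factor is [w (k - j.+1) (pos x) = g x * w (k - j.+1) 0], and the
    terms factor. *)
Definition spitzer_sum k (s : RT) : R[i] :=
  \sum_(j < k) cintegral leb (fun x : RT => q j x * w (k - j.+1) (pos x + s)).

Let mpos (s : RT) : measurable_fun setT (fun x => pos x + s : RT).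
Proof. by apply: measurable_funD => //; exact: measurable_maxr. Qed.

Let ipos j k s : cintegrable leb (fun x : RT => q j x * w k (pos x + s)).
Proof.
apply: cintegrable_kernelM => //.
by apply: bounded_cmeas_comp; [exact: bounded_spitzer_fun|exact: mpos].
Qed.

(* This makes [spitzer_sum k.+1 s - convol 0 (spitzer_sum k) s] telescope. *)
Lemma spitzer_fun_split m x s : s <= 0 -> w m.+1 (pos x + s) =
  w m.+1 (s + x) + convol 0 (w m) (pos x + s) - convol 0 (w m) (s + x).
Proof.
move=> s0; rewrite /pos; case: leP => x0.
  have h : s + x <= 0 by rewrite -[leRHS]addr0 lerD.
  by rewrite add0r !spitzer_fun_le0//; ring.
by rewrite [x + s]addrC; ring.
Qed.

Lemma spitzer_sum_rec k s : s <= 0 ->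
  spitzer_sum k.+1 s = convol 0 (w k) s + convol 0 (spitzer_sum k) s.
Proof.
move=> s0.
have bw := bounded_spitzer_fun.
have -> : convol 0 (spitzer_sum k) s =
    \sum_(j < k) cintegral leb (fun x : RT => q j x * convol 0 (w (k - j.+1)) (pos x + s)).
  rewrite /convol /spitzer_sum.
  rewrite (eq_cintegral _ (fun y => mulr_sumr _ _ _ _)).
  have mh m : cmeas (fun z : RT * RT => w m (pos z.1 + (s + z.2))).
    apply: (cmeas_comp (bw m).1 (phi := fun z : RT * RT => pos z.1 + (s + z.2) : RT)).
    apply: measurable_funD.
      by apply: measurable_maxr => //; exact: measurable_fst.
    by apply: measurable_funD => //; exact: measurable_snd.
  rewrite cintegral_sum => [|j _].
    apply: eq_bigr => j _; have [B hB] := (bw (k - j.+1)%N).2.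
    apply: etrans (kernel_swap (qi 0) (qi j) (mh (k - j.+1)%N) (fun z => hB _)) _.
    by apply: eq_cintegral => x; congr (_ * _); apply: eq_cintegral => y; rewrite addrA.
  apply: cintegrable_kernelM => //; have [B hB] := (bw (k - j.+1)%N).2.
  apply: (@bounded_cintegral (q j) (fun z => w (k - j.+1) (pos z.2 + (s + z.1))) B) => //.
  apply: (cmeas_comp (bw _).1 (phi := fun z : RT * RT => pos z.2 + (s + z.1) : RT)).
  apply: measurable_funD.
    by apply: measurable_maxr => //; exact: measurable_snd.
  by apply: measurable_funD => //; exact: measurable_fst.
rewrite /spitzer_sum big_ord_recr /= subnn.
(* [T j] lets the walk run freely for [j + 1] steps and records the maximum only afterwards. The
   differences sum to [T 0 - T k]: here [T 0] is the term [convol 0 (w k) s] of the claim, and [T k]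
   cancels against the last summand, because [g] is 1 on nonpositive heights. *)
pose T j := convol j (w (k - j)) s.
have E (j : 'I_k) : cintegral leb (fun x : RT => q j x * w (k.+1 - j.+1) (pos x + s)) =
    (T j - T j.+1) + cintegral leb (fun x : RT => q j x * convol 0 (w (k - j.+1)) (pos x + s)).
  rewrite subSS -[(k - j)%N]prednK ?subn_gt0// -subnS.
  set m := (k - j.+1)%N.
  have bK := bounded_convol 0 (bw m).
  have bs f : bounded_cmeas f -> bounded_cmeas (fun x => f (s + x)).
    by move=> bf; apply: bounded_cmeas_comp => //; exact: measurable_funD.
  have i1 := cintegrable_kernelM (qi j) (bs _ (bw m.+1)).
  have i2 := cintegrable_kernelM (qi j) (bs _ bK).
  have i3 := cintegrable_kernelM (qi j) (bounded_cmeas_comp bK (mpos s)).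
  have -> : T j = cintegral leb (fun x : RT => q j x * w m.+1 (s + x)).
    by rewrite /T /m subnS prednK ?subn_gt0.
  have -> : T j.+1 = cintegral leb (fun x : RT => q j x * convol 0 (w m) (s + x)).
    by rewrite /T -convol_comp.
  rewrite addrAC -cintegralD// -cintegralB//; last exact: cintegrableD.
  by apply: eq_cintegral => x; rewrite spitzer_fun_split//; ring.
rewrite (eq_bigr _ (fun j _ => E j)) big_split /=.
have telescope (U : nat -> R[i]) n : \sum_(j < n) (U j - U j.+1) = U 0%N - U n.
  elim: n => [|n ih]; first by rewrite big_ord0 subrr.
  by rewrite big_ord_recr /= ih; ring.
rewrite telescope.
have -> : cintegral leb (fun x : RT => q k x * g (pos x + s)) = T k.
  rewrite /T subnn; apply: eq_cintegral => x /=; congr (_ * _).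
  rewrite /pos; case: leP => x0; last by rewrite addrC.
  by rewrite !g_le0// ?add0r// -[leRHS]addr0 lerD.
rewrite /T subn0; ring.
Qed.

(** For [s <= 0] both sides obey the recursion of [spitzer_sum_rec]. Positive starts reduce to 0,
    since multiplicativity of [g] extracts [g s] from every term. *)
Lemma spitzer_sumE k s : spitzer_sum k s = k%:R * w k s.
Proof.
elim: k s => [|k ih] s; first by rewrite /spitzer_sum big_ord0 mul0r.
have le0 t : t <= 0 -> spitzer_sum k.+1 t = k.+1%:R * w k.+1 t.
  move=> t0; rewrite spitzer_sum_rec// (spitzer_fun_le0 k t0) -natr1 mulrDl mul1r addrC.
  congr (_ + _); rewrite /convol -cintegralZ; last first.
    apply: cintegrable_kernelM => //.
    by apply: bounded_cmeas_comp; [exact: bounded_spitzer_fun|exact: measurable_funD].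
  by apply: eq_cintegral => y; rewrite ih; ring.
have [s0|s0] := leP s 0; first exact: le0.
rewrite spitzer_fun_ge0; last exact: ltW.
rewrite mulrCA -le0// /spitzer_sum mulr_sumr; apply: eq_bigr => j _.
rewrite -cintegralZ//; apply: eq_cintegral => x.
rewrite spitzer_fun_ge0; last by rewrite addr_ge0// ltW.
rewrite gD//; last exact: ltW.
by rewrite addr0 [in RHS]spitzer_fun_ge0//; ring.
Qed.

Lemma spitzer_identity k : k.+1%:R * w k.+1 0 =
  \sum_(j < k.+1) cintegral leb (fun x : RT => q j x * g x) * w (k - j) 0.
Proof.
rewrite -spitzer_sumE; apply: eq_bigr => j _.
have gpos x : g (pos x) = g x by rewrite /pos; case: leP => // x0; rewrite !g_le0.
rewrite -cintegralZr; last by apply: cintegrable_kernelM => //; split => //; exists 1.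
by apply: eq_cintegral => x; rewrite addr0 spitzer_fun_ge0// gpos subSS mulrA.
Qed.

End Spitzer.

(** * Integration against an image measure *)

Section Pushforward.
Context {R : realType} d1 d2 (T1 : measurableType d1) (T2 : measurableType d2).
Variables (m1 : {measure set T1 -> \bar R}) (m2 : {measure set T2 -> \bar R}).
Variables (phi : T1 -> T2) (mphi : measurable_fun setT phi).
Hypothesis m2E : forall A, measurable A -> m2 A = m1 (phi @^-1` A).

Lemma integrable_image (h : T2 -> R) : measurable_fun setT h ->
  m1.-integrable setT (EFin \o (fun t => h (phi t))) ->
  m2.-integrable setT (EFin \o h) /\ \int[m2]_t h t = \int[m1]_t h (phi t).
Proof.
move=> mh i1; have /integrableP[_ ih] := i1.
have mhE : measurable_fun setT (EFin \o h) by exact/measurable_EFinP.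
split.
  apply/integrableP; split => //.
  apply: le_lt_trans ih.
  have := @ge0_integral_pushforward _ _ _ _ R phi mphi m1 setT
    (abse \o (EFin \o h)) measurableT.
  rewrite preimage_setT => <- //.
  - rewrite le_eqVlt; apply/orP; left; apply/eqP.
    by apply: eq_measure_integral => A mA _; exact: m2E.
  - exact: measurableT_comp.
  - by move=> x _; exact: abse_ge0.
rewrite /Rintegral; congr fine.
have := @integral_pushforward _ _ _ _ R phi mphi m1 setT (EFin \o h) mhE.
rewrite preimage_setT => <- //.
by apply: eq_measure_integral => A mA _; exact: m2E.
Qed.

Lemma cintegral_image (f : T2 -> R[i]) : cmeas f ->
  cintegrable m1 (fun t => f (phi t)) ->
  cintegrable m2 f /\ cintegral m2 f = cintegral m1 (fun t => f (phi t)).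
Proof.
move=> [/integrable_image h1 /integrable_image h2] [/h1[i1 e1] /h2[i2 e2]].
by split; [split|apply: cplx_eq].
Qed.

End Pushforward.

(** * Expectations along the dyadic grid *)

Section PathIntegral.
Context {R : realType}.
Notation RT := (measurableTypeR R).
Notation leb := (@lebesgue_measure R).
Notation lt := (lebesgue_tuple R).

Lemma cintegral_tuple0 (f : 0.-tuple RT -> R[i]) : cmeas f ->
  cintegrable (lt 0) f /\ cintegral (lt 0) f = f [tuple].
Proof.
move=> [m1 m2].
have key (h : 0.-tuple RT -> R) : measurable_fun setT h ->
    (lt 0).-integrable setT (EFin \o h) /\ \int[lt 0]_v h v = h [tuple].
  move=> mh; have mE : measurable_fun setT (EFin \o h) by exact/measurable_EFinP.
  split; last by rewrite /Rintegral integral_dirac// diracE in_setT mul1e.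
  apply/integrableP; split => //.
  have mA : measurable_fun setT (fun v => `|(EFin \o h) v|%E) by exact: measurableT_comp.
  by rewrite (@integral_dirac _ _ _ _ _ _ _ mA)// diracE in_setT mul1e ltry.
by have [i1 e1] := key _ m1; have [i2 e2] := key _ m2; split; [split|apply: cplx_eq].
Qed.

Lemma cintegral_tupleS k (f : k.+1.-tuple RT -> R[i]) : cmeas f ->
  cintegrable (leb \x lt k)%E (fun z : RT * k.-tuple RT => f (cons_pair z)) ->
  cintegrable (lt k.+1) f /\
  cintegral (lt k.+1) f =
    cintegral leb (fun a : RT => cintegral (lt k) (fun v => f (cons_pair (a, v)))).
Proof.
move=> mf fi.
have [i e] := @cintegral_image R _ _ _ _ (leb \x lt k)%E (lt k.+1) (@cons_pair R k)
  (@measurable_cons_pair R k) (fun A mA => erefl) f mf fi.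
by split => //; rewrite e (cintegral12 fi).2.
Qed.

Lemma measurable_nth k i (x : RT) : measurable_fun setT (fun v : k.-tuple RT => nth x v i : RT).
Proof.
case: (ltnP i k) => ik.
  rewrite (_ : (fun v => _) = (fun v : k.-tuple RT => tnth v (Ordinal ik))).
    exact: measurable_tnth.
  by apply/funext => v; rewrite (tnth_nth x).
rewrite (_ : (fun v => _) = cst x); first exact: measurable_cst.
by apply/funext => v; rewrite nth_default// size_tuple.
Qed.

Lemma measurable_last k (x : RT) : measurable_fun setT (fun v : k.-tuple RT => last x v : RT).
Proof.
rewrite (_ : (fun v => _) = (fun v : k.-tuple RT => nth x v k.-1)).
  exact: measurable_nth.
by apply/funext => v; rewrite -nth_last size_tuple.
Qed.

Lemma measurable_bigmax k (c e : R) :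
  measurable_fun setT (fun v : k.-tuple RT => \big[Num.max/c]_(y <- v) (e * y) : RT).
Proof.
rewrite (_ : (fun v => _) = (fun v : k.-tuple RT => \big[Num.max/c]_(i < k) (e * tnth v i))).
  elim: (index_enum _) => [|i s ih].
    by rewrite (_ : (fun v => _) = cst c)//; apply/funext => v; rewrite big_nil.
  rewrite (_ : (fun v => _) = (fun v : k.-tuple RT =>
    Num.max (e * tnth v i) (\big[Num.max/c]_(j <- s) (e * tnth v j)))); last first.
    by apply/funext => v; rewrite big_cons.
  apply: measurable_maxr => //; apply: measurable_funM => //; exact: measurable_tnth.
by apply/funext => v; rewrite big_tuple.
Qed.

Lemma measurable_tcons k (a : RT) :
  measurable_fun setT (fun v : k.-tuple RT => cons_pair (a, v)).
Proof.
apply: (measurableT_comp (@measurable_cons_pair R k)).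
exact: measurable_pair1.
Qed.

Variables (p : RT -> R[i]) (pin : cintegrable leb p).

Definition chain k (x : R) (v : seq R) : R[i] :=
  \prod_(i < k) p (nth 0 (x :: v) i - nth 0 v i).

Lemma chain_cons k x a v : chain k.+1 x (a :: v) = p (x - a) * chain k a v.
Proof. by rewrite /chain big_ord_recl. Qed.

Lemma cmeas_chain k x : cmeas (fun v : k.-tuple RT => chain k x v).
Proof.
rewrite /chain; elim: (index_enum _) => [|i s ih].
  rewrite (_ : (fun v => _) = (fun=> 1)); first exact: cmeas_cst.
  by apply/funext => v; rewrite big_nil.
rewrite (_ : (fun v => _) = (fun v : k.-tuple RT => p (nth 0 (x :: v : seq R) i - nth 0 (v : seq R) i) *
  \prod_(j <- s) p (nth 0 (x :: v : seq R) j - nth 0 (v : seq R) j))); last first.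
  by apply/funext => v; rewrite big_cons.
apply: cmeasM => //.
apply: (cmeas_comp (cintegrable_cmeas pin)
  (phi := fun v : k.-tuple RT => nth 0 (x :: v : seq R) i - nth 0 (v : seq R) i : RT)).
apply: measurable_funB; last exact: measurable_nth.
case: i => -[|i] ik /=; first exact: measurable_cst.
exact: measurable_nth.
Qed.

Lemma cmeas_chain_pair k x : cmeas (fun z : RT * k.-tuple RT => chain k.+1 x (cons_pair z)).
Proof. exact: (cmeas_comp (cmeas_chain k.+1 x) (@measurable_cons_pair R k)). Qed.

Let I := \int[leb]_y nm (p y).

Let pshift x : leb.-integrable setT (EFin \o (fun a : RT => nm (p (x - a)))) /\
  \int[leb]_a nm (p (x - a)) = I.
Proof.
have [i1 e1] := integrable_opp (integrable_nm pin).
have [i2 e2] := integrable_shift (- x) i1.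
rewrite -/I in e1; rewrite e1 in e2.
have E : (fun t => nm (p (- (t - x)))) = (fun t => nm (p (x - t))).
  by apply/funext => t; rewrite opprB.
by rewrite E in i2 e2.
Qed.

(** [I] is the total variation of the step law and may exceed 1. The geometric bound serves only for
    integrability at fixed [k], never for summation over [k]. *)
Lemma integrable_chain k x :
  (lt k).-integrable setT (EFin \o (fun v => nm (chain k x v))) /\
  \int[lt k]_v nm (chain k x v) = I ^+ k.
Proof.
elim: k x => [|k ih] x.
  have m0 : cmeas (fun v : 0.-tuple RT => (nm (chain 0 x v))%:C).
    by apply: cmeas_real; exact: measurable_nm (cmeas_chain 0 x).
  have [[i _] /(congr1 (@complex.Re R)) e] := cintegral_tuple0 m0.
  split => //; rewrite expr0 -[RHS](@nm1 R).
  by move: e; rewrite [chain 0 x [tuple]]big_ord0.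
have mc := measurable_nm (cmeas_chain k.+1 x).
have fi : cintegrable (leb \x lt k)%E
    (fun z : RT * k.-tuple RT => (nm (chain k.+1 x (cons_pair z)))%:C).
  refine (@cintegrable_prod R _ _ RT (k.-tuple RT) leb (lt k) 
    (fun z : RT * k.-tuple RT => (nm (chain k.+1 x (cons_pair z)))%:C)
    (fun a v => nm (p (x - a)) * nm (chain k a v)) (fun a => I ^+ k * nm (p (x - a))) _ _ _ _ _).
  - by apply: cmeas_real; exact: measurable_nm (cmeas_chain_pair k x).
  - by move=> a v; rewrite nmR ger0_norm ?nm_ge0// chain_cons nmM.
  - by move=> a; have := integrableZl measurableT (nm (p (x - a))) (ih a).1.
  - by move=> a; rewrite RintegralZl ?(ih a).2 1?mulrC//; exact: (ih a).1.
  - by have := integrableZl measurableT (I ^+ k) (pshift x).1.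
have [[i _] /(congr1 (@complex.Re R)) e] := cintegral_tupleS (cmeas_real mc) fi.
have [i1 e1] := pshift x.
have -> : I ^+ k.+1 = \int[leb]_a (I ^+ k * nm (p (x - a))).
  by rewrite RintegralZl// e1 -exprSr.
split => //; rewrite [LHS]e /=; apply: eq_Rintegral => a _.
rewrite -(ih a).2 mulrC -RintegralZl//; last exact: (ih a).1.
by apply: eq_Rintegral => v _; rewrite chain_cons nmM.
Qed.

Definition path_integral k (F : seq R -> R[i]) (x : R) : R[i] :=
  cintegral (lt k) (fun v => F v * chain k x v).

Lemma cintegrable_path k (F : seq R -> R[i]) B x :
  cmeas (fun v : k.-tuple RT => F v) -> (forall v, nm (F v) <= B) ->
  cintegrable (lt k) (fun v => F v * chain k x v).
Proof.
move=> mF FB; refine (@cintegrable_dom R _ (k.-tuple RT) (lt k) (fun v => F v * chain k x v)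
  (fun v => B * nm (chain k x v)) _ _ _).
- by apply: cmeasM => //; exact: cmeas_chain.
- by have := integrableZl measurableT B (integrable_chain k x).1.
- by move=> v; rewrite nmM; apply: ler_wpM2r; rewrite ?nm_ge0.
Qed.

Lemma path_integral0 F x : path_integral 0 F x = F [::].
Proof.
have m : cmeas (fun v : 0.-tuple RT => F v * chain 0 x v).
  rewrite (_ : (fun v => _) = (fun=> F [::] * chain 0 x [::])); first exact: cmeas_cst.
  by apply/funext => v; rewrite (tuple0 v).
by rewrite /path_integral (cintegral_tuple0 m).2 /chain big_ord0 mulr1.
Qed.

Lemma path_integralS k (F : seq R -> R[i]) B x :
  cmeas (fun v : k.+1.-tuple RT => F v) -> (forall v, nm (F v) <= B) ->
  path_integral k.+1 F x =
  cintegral leb (fun a : RT => p (x - a) * path_integral k (fun v => F (a :: v)) a).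
Proof.
move=> mF FB.
have B0 : 0 <= B := le_trans (nm_ge0 _) (FB [::]).
have mFp := cmeas_comp mF (@measurable_cons_pair R k).
have fi : cintegrable (leb \x lt k)%E
    (fun z : RT * k.-tuple RT => F (cons_pair z) * chain k.+1 x (cons_pair z)).
  refine (@cintegrable_prod R _ _ RT (k.-tuple RT) leb (lt k) 
    (fun z : RT * k.-tuple RT => F (cons_pair z) * chain k.+1 x (cons_pair z))
    (fun a v => B * nm (p (x - a)) * nm (chain k a v))
    (fun a => B * I ^+ k * nm (p (x - a))) _ _ _ _ _).
  - by apply: cmeasM => //; exact: cmeas_chain_pair.
  - move=> a v; rewrite nmM chain_cons [nm (_ * chain _ _ _)]nmM -mulrA.
    by apply: ler_wpM2r; rewrite ?mulr_ge0 ?nm_ge0.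
  - by move=> a; have := integrableZl measurableT (B * nm (p (x - a))) (integrable_chain k a).1.
  - move=> a; rewrite RintegralZl ?(integrable_chain k a).2//.
      by rewrite mulrAC.
    exact: (integrable_chain k a).1.
  - by have := integrableZl measurableT (B * I ^+ k) (pshift x).1.
rewrite /path_integral (cintegral_tupleS (cmeasM mF (cmeas_chain k.+1 x)) fi).2.
apply: eq_cintegral => a; rewrite -cintegralZ.
  by apply: eq_cintegral => v; rewrite chain_cons mulrCA.
apply: (@cintegrable_path k (fun v => F (a :: v)) B) => //.
exact (@cmeas_comp R _ _ _ _ (fun v : k.+1.-tuple RT => F v) _ mF (@measurable_tcons k a)).
Qed.

End PathIntegral.

(** * The maximum of the walk on a grid of mesh [delta] *)

Section WalkMaximum.
Context {R : realType} (N : nat) (N_gt2 : (2 < N)%N) (N_even : ~~ odd N).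
Notation RT := (measurableTypeR R).
Notation leb := (@lebesgue_measure R).
Notation hk := (@heat_kernel R N).
Variables (mu nu : R) (nu0 : 0 <= nu) (delta : R) (delta0 : 0 < delta).

(* The index [j] stands for the time [(j + 1) * delta]. *)
Definition twisted_kernel (j : nat) (y : RT) : R[i] :=
  hk (j.+1%:R * delta) y * cexp ('i * (mu * y)%:C).
Definition max_weight (s : RT) : R[i] := cexp (- (nu * Num.max s 0)%:C).
Notation q := twisted_kernel.
Notation g := max_weight.
Notation w := (spitzer_fun q g).

Let jd0 (j : nat) : 0 < j.+1%:R * delta. Proof. exact: mulr_gt0. Qed.

Let mphase : cmeas (fun y : RT => cexp ('i * (mu * y)%:C)).
Proof.
apply: cmeas_cexp; apply: cmeasM; first exact: cmeas_cst.
by apply: cmeas_real; exact: measurable_funM.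
Qed.

Lemma cintegrable_twisted j : cintegrable leb (q j).
Proof.
apply: (cintegrable_dom _ (integrable_nm (cintegrable_hk N_gt2 N_even (jd0 j)))).
  by apply: cmeasM => //; exact: cmeas_hk.
by move=> y; rewrite nmM nm_cexp_i mulr1.
Qed.

Lemma hk_le_cst t : 0 < t -> exists B : R, forall y, nm (hk t y) <= B.
Proof.
move=> t0; have [C C0 hC] := hk_bound (R := R) N_gt2 N_even.
exists (C * (tscale N t)^-1) => y; apply: le_trans (hC t y t0).1 _.
apply: ler_wpM2l => //; rewrite /cauchyd ler_pdivrMr ?onesqr_gt0//.
rewrite -[leLHS]mulr1; apply: ler_wpM2l; first by rewrite invr_ge0 ltW// tscale_gt0.
by rewrite lerDl sqr_ge0.
Qed.

Lemma cintegrable_twisted2 j (x : RT) : cintegrable leb (fun y : RT => q 0%N (x - y) * q j y).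
Proof.
have [B hB] := hk_le_cst (jd0 0%N).
under eq_fun do rewrite mulrC.
apply: (cintegrable_kernelM (cintegrable_twisted j)); split; last first.
  by exists B => y; rewrite nmM nm_cexp_i mulr1.
refine (@cmeas_comp R _ _ RT RT (q 0%N) (fun y : RT => x - y : RT)
  (cintegrable_cmeas (cintegrable_twisted 0%N)) _).
by apply: measurable_funB.
Qed.

Lemma twisted_semigroup j (x : RT) :
  cintegral leb (fun y : RT => q 0%N (x - y) * q j y) = q j.+1 x.
Proof.
have -> : q j.+1 x = cexp ('i * (mu * x)%:C) *
    cintegral leb (fun y : RT => hk (1%:R * delta) (x - y) * hk (j.+1%:R * delta) y).
  rewrite (hk_semigroup N_gt2 N_even _ (jd0 0%N) (jd0 j)) mulrC -mulrDl.
  by congr (hk (_ * _) _ * _); rewrite -natrD.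
have [B hB] := hk_le_cst (jd0 0%N).
rewrite -cintegralZ.
  apply: eq_cintegral => y; rewrite /q.
  have -> : cexp ('i * (mu * x)%:C) = cexp ('i * (mu * (x - y))%:C) * cexp ('i * (mu * y)%:C).
    rewrite -cexpD; congr cexp; rewrite -mulrDr -RtoCD; congr ('i * _%:C); ring.
  by move: (cexp ('i * (mu * (x - y))%:C)) (cexp _) => a b; ring.
under eq_fun do rewrite mulrC.
apply: (cintegrable_kernelM (cintegrable_hk N_gt2 N_even (jd0 j))); split; last by exists B.
refine (@cmeas_comp R _ _ RT RT (hk (1%:R * delta)) (fun y : RT => x - y : RT)
  (cmeas_hk N_even _) _).
by apply: measurable_funB.
Qed.

Lemma cmeas_max_weight : cmeas g.
Proof.
apply: cmeas_cexp; under eq_fun do rewrite -RtoCN; apply: cmeas_real.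
apply: (measurableT_comp (@oppr_measurable R _)) => //.
by apply: measurable_funM => //; exact: measurable_maxr.
Qed.

Let max0_ge0 (s : R) : 0 <= Num.max s 0. Proof. by rewrite le_max lexx orbT. Qed.

Lemma nm_max_weight s : nm (g s) <= 1.
Proof. by rewrite nm_cexp -RtoCN /= -expR0 ler_expR oppr_le0 mulr_ge0. Qed.

Lemma max_weight_le0 s : s <= 0 -> g s = 1.
Proof. by move=> s0; rewrite /g max_r// mulr0 oppr0 cexp0. Qed.

Lemma max_weightD s t : 0 <= s -> 0 <= t -> g (s + t) = g s * g t.
Proof.
move=> s0 t0; rewrite /g !max_l ?addr_ge0// -cexpD mulrDr RtoCD opprD.
by [].
Qed.

Let bw := bounded_spitzer_fun cintegrable_twisted cmeas_max_weight nm_max_weight.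

Let w_min k s : w k s = g s * w k (Num.min s 0).
Proof.
have [s0|s0] := leP s 0; first by rewrite max_weight_le0 ?mul1r.
exact: (spitzer_fun_ge0 _ max_weight_le0 _ (ltW s0)).
Qed.

Lemma walk_recursion k : k.+1%:R * w k.+1 0 =
  \sum_(j < k.+1) Phi N mu nu (j.+1%:R * delta) * w (k - j) 0.
Proof.
rewrite (spitzer_identity cintegrable_twisted cintegrable_twisted2 twisted_semigroup
  cmeas_max_weight nm_max_weight max_weight_le0 max_weightD).
apply: eq_bigr => j _; congr (_ * _); apply: eq_cintegral => y.
by rewrite /ladder_weight /q /g cexpD mulrA.
Qed.

(* The sign [e = 1] gives the maximum of the path, [e = -1] the opposite of its
   minimum. *)
Definition max_functional (e c x : R) (v : seq R) : R[i] :=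
  cexp ('i * (mu * (e * last x v))%:C - (nu * \big[Num.max/c]_(y <- v) (e * y))%:C).

Lemma cmeas_max_functional e c x k :
  cmeas (fun v : k.-tuple RT => max_functional e c x v).
Proof.
apply: cmeas_cexp; apply: cmeasD.
  apply: cmeasM; first exact: cmeas_cst.
  apply: cmeas_real; apply: measurable_funM => //; apply: measurable_funM => //.
  exact: measurable_last.
under eq_fun do rewrite -RtoCN; apply: cmeas_real.
apply: (measurableT_comp (@oppr_measurable R _)) => //.
by apply: measurable_funM => //; exact: measurable_bigmax.
Qed.

Lemma nm_max_functional e c x v : nm (max_functional e c x v) <= expR (- (nu * c)).
Proof.
rewrite nm_cexp Re_iM cReN /= ler_expR lerN2; apply: ler_wpM2l => //.
by elim: v => [|y v ih]; rewrite ?big_nil// big_cons le_max ih orbT.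
Qed.

(** A visited point is absorbed into the initial value of the maximum. This is why [c] is a
    parameter separate from the position [x]. *)
Lemma max_functional_cons e c x a v :
  max_functional e c x (a :: v) = max_functional e (Num.max c (e * a)) a v.
Proof.
rewrite /max_functional /= big_cons; congr cexp; congr (_ - (_ * _)%:C).
elim: v => [|y v ih]; first by rewrite !big_nil maxC.
by rewrite !big_cons maxCA ih.
Qed.

(** Induction on the first step [a]. Only the height [e * x - c] below the current maximum matters:
    raising the maximum to [e * a] costs exactly the factor [g (e * a - c)]. Evenness of the kernel
    lets the same step law serve both signs. *)
Lemma walk_max_value (e : R) (e1 : e = 1 \/ e = -1) k (x c : R) : e * x <= c ->
  path_integral (hk delta) k (max_functional e c x) x =
  cexp ('i * (mu * (e * x))%:C - (nu * c)%:C) * w k (e * x - c).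
Proof.
have hi := cintegrable_hk N_gt2 N_even delta0.
have hE (y : R) : hk delta (e * y) = hk delta y.
  by case: e1 => ->; rewrite ?mul1r// mulN1r (hk_even N_gt2 N_even).
elim: k x c => [|k ih] x c xc.
  by rewrite path_integral0// /= max_weight_le0 ?subr_le0// mulr1 /max_functional big_nil.
rewrite (path_integralS hi x (cmeas_max_functional e c x k.+1) (nm_max_functional e c x)).
rewrite (spitzer_fun_le0 _ max_weight_le0) ?subr_le0//.
pose s := e * x - c.
pose G (y : RT) : R[i] := q 0%N y * w k (s + y).
have Gi : cintegrable leb G.
  apply: (cintegrable_kernelM (cintegrable_twisted 0%N)).
  by apply: bounded_cmeas_comp; [exact: bw|exact: measurable_funD].
pose Z := cexp ('i * (mu * (e * x))%:C - (nu * c)%:C).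
have E (a : RT) : hk delta (x - a) * path_integral (hk delta) k (fun v => max_functional e c x (a :: v)) a
    = Z * G (e * (a - x)).
  rewrite (_ : (fun v => _) = max_functional e (Num.max c (e * a)) a); last first.
    by apply/funext => v; exact: max_functional_cons.
  rewrite ih ?le_max ?lexx ?orbT// /G /q mul1r hE.
  rewrite -(hk_even N_gt2 N_even (x - a))// opprB.
  have -> : s + e * (a - x) = e * a - c by rewrite /s; ring.
  have -> : e * a - Num.max c (e * a) = Num.min (e * a - c) 0.
    by case: leP => h; case: leP => h'; move: h h'; lra.
  rewrite [in RHS]w_min.
  have -> : cexp ('i * (mu * (e * a))%:C - (nu * Num.max c (e * a))%:C) =
      Z * cexp ('i * (mu * (e * (a - x)))%:C) * g (e * a - c).
    rewrite /Z /g -cexpD -cexpD; congr cexp.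
    have -> : Num.max c (e * a) = c + Num.max (e * a - c) 0.
      by case: leP => h; case: leP => h'; move: h h'; lra.
    by rewrite !(mulrDr, mulrN, RtoCD, RtoCN); ring.
  move: Z (cexp _) (g _) (w _ _) => z b c' d; ring.
rewrite (eq_cintegral _ E) cintegralZ -/Z /convol -/s.
  congr (_ * _).
  case: e1 {E} => e1; rewrite e1.
    rewrite -(cintegral_shift (- x) Gi).2; apply: eq_cintegral => a; by rewrite mul1r.
  have [Gi' <-] := cintegral_opp Gi.
  rewrite -(cintegral_shift (- x) Gi').2; apply: eq_cintegral => a; by rewrite mulN1r.
case: e1 {E} => ->.
  have [h _] := cintegral_shift (- x) Gi.
  by under eq_fun do rewrite mul1r.
have [Gi' _] := cintegral_opp Gi; have [h _] := cintegral_shift (- x) Gi'.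
by under eq_fun do rewrite mulN1r.
Qed.

End WalkMaximum.

(** * Path expectations at dyadic times *)

Section DyadicWalk.
Context {R : realType} (N : nat) (N_gt2 : (2 < N)%N) (N_even : ~~ odd N).
Notation RT := (measurableTypeR R).
Variables (mu nu : R) (nu0 : 0 <= nu) (x : R).

Let dyadicB n i : dyadic R n i.+1 - dyadic R n i = 2^-1 ^+ n.
Proof. by rewrite /dyadic -natr1 -mulrBl addrAC subrr add0r mul1r exprVn. Qed.

Let delta0 n : 0 < 2^-1 ^+ n :> R. Proof. by rewrite exprn_gt0// invr_gt0. Qed.

Definition walk_coef n k : R[i] :=
  spitzer_fun (twisted_kernel N mu (2^-1 ^+ n)) (max_weight nu) k 0.

Lemma pp_expectationE k n F :
  pp_expectation N x k (dyadic R n) F = path_integral (heat_kernel N (2^-1 ^+ n)) k F x.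
Proof.
apply: eq_cintegral => v; congr (_ * _); apply: eq_bigr => i _.
by rewrite dyadicB.
Qed.

Lemma pp_expectation_max n k :
  pp_expectation N x k (dyadic R n)
    (fun v => cexp ('i * (mu * last x v)%:C - (nu * path_max x v)%:C)) =
  cexp ('i * (mu * x)%:C - (nu * x)%:C) * walk_coef n k.
Proof.
rewrite pp_expectationE.
have := walk_max_value N_gt2 N_even mu nu0 (delta0 n) (or_introl erefl) k (x := x) (c := x).
rewrite !mul1r subrr => <- //; congr path_integral; apply/funext => v.
rewrite /max_functional mul1r /path_max; congr (cexp (_ - (_ * _)%:C)).
by apply: eq_bigr => y _; rewrite mul1r.
Qed.

(** The minimum of the path is the opposite of the maximum of the reflected path, so
    [walk_max_value] applies with [e = -1]; the reflection also changes the sign of [mu]. *)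
Lemma pp_expectation_min n k :
  pp_expectation N x k (dyadic R n)
    (fun v => cexp ('i * (- mu * last x v)%:C + (nu * path_min x v)%:C)) =
  cexp ('i * (- mu * x)%:C + (nu * x)%:C) * walk_coef n k.
Proof.
rewrite pp_expectationE.
have := walk_max_value N_gt2 N_even mu nu0 (delta0 n) (or_intror erefl) k (x := x) (c := - x).
rewrite mulN1r subrr lexx => /(_ isT); rewrite !mulrN RtoCN [(- (nu * x))%:C]RtoCN opprK.
rewrite -!RtoCN -!mulNr => <-.
congr path_integral; apply/funext => v; rewrite /max_functional; congr cexp.
rewrite mulN1r mulrN -mulNr -RtoCN -mulrN; congr (_ + (_ * _)%:C).
rewrite /path_min; elim: v => [|y v ih]; first by rewrite !big_nil opprK.
by rewrite !big_cons ih mulN1r oppr_max opprK.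
Qed.

End DyadicWalk.

(** * The limit over dyadic grids *)

Section StepIntegral.
Context {R : realType}.
Notation RT := (measurableTypeR R).
Notation leb := (@lebesgue_measure R).

Lemma ccvgV (u : nat -> R[i]) l : l != 0 -> ccvg u l -> ccvg (fun n => (u n)^-1) l^-1.
Proof. by move=> l0 ul; exact: (cvgV (K := R[i]) l0 ul). Qed.

Lemma ccvg_shift (u : nat -> R[i]) l : ccvg (fun n => u n.+1) l -> ccvg u l.
Proof.
move=> /ccvgP[h1 h2]; apply/ccvgP; split.
- by move: h1; rewrite (cvg_shiftS (fun n => complex.Re (u n))).
- by move: h2; rewrite (cvg_shiftS (fun n => complex.Im (u n))).
Qed.

Lemma cintegral_itv (a b : R) (z : R[i]) : a <= b ->
  cintegrable leb (fun t : RT => if a < t <= b then z else 0) /\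
  cintegral leb (fun t : RT => if a < t <= b then z else 0) = z * (b - a)%:C.
Proof.
move=> ab.
have E : (fun t : RT => if a < t <= b then z else 0) =
    (fun t : RT => z * (\1_(`]a, b]%classic : set RT) t)%:C).
  apply/funext => t; rewrite indicE; case: ifPn => h.
    by rewrite mem_set ?mulr1//= in_itv.
  by rewrite memNset ?mulr0//= in_itv; exact/negP.
have ii : cintegrable leb (fun t : RT => (\1_(`]a, b]%classic : set RT) t)%:C : R[i]).
  split; last exact: integrable0.
  exact: (@integrable_indic_itv R a b false false).
rewrite E; split; first exact: cintegrableZ.
rewrite cintegralZ//; congr (_ * _); apply: cplx_eq => /=; last first.
  by rewrite /Rintegral integral0.
rewrite /Rintegral integral_indic//= setIT lebesgue_measure_itv/= lte_fin.
by case: ltP => // ba; apply/esym/eqP; rewrite subr_eq0 eq_le ba ab.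
Qed.

Variables (G : R -> R[i]) (h : R) (h0 : 0 < h).

(** Positive times are rounded up, so that time 0, where the integrand is singular, is never
    sampled. *)
Definition grid_index (t : R) : nat := `|Num.ceil (t / h)|%N.
Definition step_fun (t : R) : R[i] :=
  if 0 < t then G ((grid_index t)%:R * h) else 0.

Lemma grid_indexE t j : 0 < t -> (j.+1 == grid_index t) = (j%:R * h < t <= j.+1%:R * h).
Proof.
move=> t0; have c0 : 0 < Num.ceil (t / h) by rewrite ceil_gt0 divr_gt0.
rewrite -(eqr_nat int) natz natz /grid_index gtz0_abs// eq_sym ceil_eq.
have -> : j.+1%:Z - 1 = j by rewrite -addn1 PoszD addrK.
by rewrite -!pmulrn ltr_pdivlMr// ler_pdivrMr.
Qed.

Lemma grid_index_bounds t : 0 < t -> t <= (grid_index t)%:R * h <= t + h.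
Proof.
move=> t0; have c0 : 0 < Num.ceil (t / h) by rewrite ceil_gt0 divr_gt0.
have g0 : (0 < grid_index t)%N by rewrite /grid_index absz_gt0 gt_eqF.
have := grid_indexE (grid_index t).-1 t0; rewrite prednK// eqxx => /esym/andP[a b].
by rewrite b /= -[X in X%:R](prednK g0) -natr1 mulrDl mul1r lerD2r ltW.
Qed.

Definition step_trunc (m : nat) (t : R) : R[i] :=
  \sum_(j < m) if j%:R * h < t <= j.+1%:R * h then G (j.+1%:R * h) else 0.

Lemma step_truncE m t :
  step_trunc m t = if (0 < t) && (grid_index t <= m)%N then step_fun t else 0.
Proof.
rewrite /step_trunc /step_fun; have [t0|t0] /= := ltP 0 t; last first.
  apply: big1 => j _; rewrite ifF//; apply/negbTE; rewrite negb_and -leNgt.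
  by rewrite (le_trans t0)// mulr_ge0// ltW.
have g0 : (0 < grid_index t)%N.
  by rewrite /grid_index absz_gt0 gt_eqF// ceil_gt0 divr_gt0.
under eq_bigr do rewrite -grid_indexE//.
elim: m => [|m ih]; first by rewrite big_ord0 leqn0 gtn_eqF.
rewrite big_ord_recr /= ih; case: eqP => [e|/eqP ne].
  by rewrite -e ltnn add0r leqnn.
by rewrite addr0 [in RHS]leq_eqVlt eq_sym (negbTE ne) ltnS.
Qed.

(** An infinite Riemann sum is treated as the integral of one step function; its partial sums are
    the integrals of the truncations [step_trunc], which [K] dominates. *)
Lemma cintegral_step (K : R -> R) : leb.-integrable setT (EFin \o (K : RT -> R)) ->
  (forall t, nm (step_fun t) <= K t) ->
  cintegrable leb (step_fun : RT -> R[i]) /\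
  ccvg (fun m => \sum_(j < m) G (j.+1%:R * h) * h%:C) (cintegral leb step_fun).
Proof.
move=> iK GK.
have nj j : j%:R <= j.+1%:R :> R by rewrite ler_nat.
have I (j : nat) := @cintegral_itv (j%:R * h) (j.+1%:R * h) (G (j.+1%:R * h))
  (ler_wpM2r (ltW h0) (nj j)).
have tI m : cintegral leb (step_trunc m) = \sum_(j < m) G (j.+1%:R * h) * h%:C.
  rewrite cintegral_sum => [|j _]; last exact: (I j).1.
  apply: eq_bigr => j _; rewrite (I j).2 -natr1; congr (_ * _%:C); ring.
have := @cintegral_dct R _ RT leb step_trunc step_fun K.
rewrite (funext tI); apply => //.
- move=> m; apply: (@cintegrable_cmeas R _ _ leb); apply: cintegrable_sum => j _.
  exact: (I j).1.
- move=> t; apply: cvg_near_cst; near=> m; rewrite step_truncE /step_fun.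
  case: ltP => //= t0; rewrite ifT//.
  by near: m; exists (grid_index t).
- move=> m t; rewrite step_truncE; case: ifP => _ //.
  by rewrite nm0 (le_trans _ (GK t))// nm_ge0.
Unshelve. all: by end_near.
Qed.

End StepIntegral.

Section DiscountedLimit.
Context {R : realType} (N : nat) (N_gt2 : (2 < N)%N) (N_even : ~~ odd N).
Notation RT := (measurableTypeR R).
Notation leb := (@lebesgue_measure R).
Notation Phi := (@Phi R N).
Variables (mu nu : R) (nu0 : 0 <= nu) (lam : R[i]) (lam_re : 0 < complex.Re lam).
Notation L := (frullani N mu nu lam 1).

Let a := complex.Re lam.

(** The exponent [1/N - 1] is nonpositive. The majorant at a grid point, which lies to the right of
    [t], is thus below the majorant at [t], uniformly in the mesh. *)
Lemma tscale_ratio (s t : R) : 0 < s -> s <= t -> tscale N t / t <= tscale N s / s.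
Proof.
move=> s0 st; have t0 : 0 < t := lt_le_trans s0 st.
have N1 : N%:R^-1 <= 1 :> R.
  by rewrite invf_le1 ?ler1n ?ltr0n (ltn_trans _ N_gt2).
have u1 : 1 <= t / s by rewrite ler_pdivlMr// mul1r.
have -> : tscale N t = tscale N s * (t / s) `^ N%:R^-1.
  rewrite /tscale -powRM.
  - by rewrite mulrC divfK// gt_eqF.
  - exact: ltW.
  - exact: le_trans u1.
rewrite ler_pdivrMr// -mulrA; apply: ler_wpM2l; first exact: powR_ge0.
by rewrite [leRHS]mulrC; exact: ler1_powR u1 N1.
Qed.

Lemma step_bound : exists2 K : R -> R, leb.-integrable setT (EFin \o (K : RT -> R)) &
  forall h t, 0 < h -> nm (step_fun L h t) <= K t.
Proof.
have [C C0 hC] := frullani_bound N_gt2 N_even mu nu0 lam.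
exists (fun t => C * (if 0 < t then expR (- a * t) * (tscale N t / t) else 0)).
  by have := integrableZl measurableT C (integrable_singular N_gt2 lam_re).
move=> h t h0; rewrite /step_fun; case: ifPn => t0; last by rewrite nm0 mulr0.
have /andP[b1 _] := grid_index_bounds h0 t0.
set s := _ * h in b1 *; have s0 : 0 < s := lt_le_trans t0 b1.
apply: le_trans (hC a 1 s _) _; first by rewrite expr1n mulr1.
rewrite s0; apply: ler_wpM2l => //; apply: ler_pM; rewrite ?expR_ge0//.
- by apply: divr_ge0; [exact: powR_ge0|exact: ltW].
- by rewrite ler_expR !mulNr lerN2; apply: ler_wpM2l => //; exact: ltW.
- exact: tscale_ratio.
Qed.

Lemma frullani_right_cvg (tn : nat -> R) (t : R) : 0 < t -> (forall n, t <= tn n <= t + 1) ->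
  tn @ \oo --> t -> ccvg (fun n => L (tn n)) (L t).
Proof.
move=> t0 tb tt; rewrite /frullani; apply: ccvgM; last first.
  apply: ccvg_real; rewrite [X in _ --> X]/posinv t0.
  have -> : (fun n => posinv (tn n)) = (fun n => (tn n)^-1).
    apply/funext => n; rewrite /posinv ifT//.
    by have /andP[h _] := tb n; exact: lt_le_trans h.
  exact: (cvgV (lt0r_neq0 t0) tt).
apply: ccvgM; last first.
  apply: ccvgD; last exact: ccvg_cst.
  exact: (Phi_cvg N_gt2 N_even nu0 t0 tb tt).
apply: ccvg_cexp; apply: ccvgM; last exact: ccvg_cst.
apply: ccvg_ext (ccvgZ (- lam) (ccvg_real tt)) _ _ => [n|]; by rewrite mulNr.
Qed.

Lemma step_cvg : ccvg (fun n => cintegral leb (step_fun L (2^-1 ^+ n))) (cintegral leb L).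
Proof.
have [K iK hK] := step_bound.
have h0 n : 0 < 2^-1 ^+ n :> R by rewrite exprn_gt0// invr_gt0.
have h2 : `|2^-1 : R| < 1 by rewrite ger0_norm ?invr_ge0// invf_lt1// ltr1n.
refine (@cintegral_dct R _ RT leb (fun n => step_fun L (2^-1 ^+ n)) L K _ _ iK _).2.
- move=> n; exact: (cintegrable_cmeas (cintegral_step (h0 n) iK (fun t => hK _ t (h0 n))).1).
- move=> t; rewrite /step_fun; have [t0|t0] := ltP 0 t; last first.
    rewrite /frullani /posinv ltNge t0 mulr0; exact: ccvg_cst.
  have b n := grid_index_bounds (h0 n) t0.
  apply: frullani_right_cvg => //.
    move=> n; have /andP[b1 b2] := b n; rewrite b1 (le_trans b2)// lerD2l.
    by rewrite exprn_ile1 ?invr_ge0// invf_le1// ler1n.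
  apply: (squeeze_cvgr _ (cvg_cst t)).
    by near=> n; exact: b.
  rewrite -[X in _ --> X]addr0; apply: cvgD; first exact: cvg_cst.
  exact: cvg_expr.
- by move=> n t; exact: hK.
Unshelve. all: by end_near.
Qed.

(** [newton_series] is used twice: [P] for the walk, [Q] for constant coefficients 1, whose series
    is geometric. In the quotient the exponent is the sum of [z ^+ j * (Phi (j h) - 1) / j], and
    [1 / j = h / (j h)] makes it the Riemann sum of [frullani]. *)
Lemma walk_series n : let z := cexp (- lam / 2 ^+ n) in
  nm z < 1 /\ ccvg (fun m => \sum_(k < m.+1) walk_coef N mu nu n k * z ^+ k)
    ((1 - z)^-1 * cexp (cintegral leb (step_fun L (2^-1 ^+ n)))).
Proof.
move=> z; pose h : R := 2^-1 ^+ n.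
have h0 : 0 < h by rewrite exprn_gt0// invr_gt0.
have zE : z = cexp (- lam * h%:C) by rewrite /z /h RtoCX RtoCV RtoCn exprVn.
have zX j : z ^+ j = cexp (- (lam * (j%:R * h)%:C)).
  have -> : - (lam * (j%:R * h)%:C) = (- lam * h%:C) *+ j.
    by rewrite (RtoCM j%:R h) RtoCn -[RHS]mulr_natl; move: (h%:C) => u; ring.
  by rewrite zE cexpMn.
have z1 : nm z < 1.
  rewrite zE nm_cexp -expR0 ltr_expR mulrC cReZ cReN mulrN oppr_lt0.
  by rewrite mulr_gt0.
split => //.
have zn1 : 1 - z != 0.
  apply/eqP => /eqP; rewrite subr_eq0 => /eqP e; by move: z1; rewrite -e nm1 ltxx.
pose c k := walk_coef N mu nu n k.
pose av j : R[i] := if j is j'.+1 then Phi mu nu (j'.+1%:R * h) else 0.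
have [C C0 hC] := Phi_bound N_gt2 N_even mu nu0.
have [A hA] : exists A : nat, forall j, nm (av j) <= A%:R.
  exists (Num.bound C) => -[|j]; first by rewrite [av _]/= nm0.
  by rewrite (le_trans (hC _ (mulr_gt0 (ltr0Sn _ _) h0)).1)// ltW// archi_boundP.
have P := newton_series (a := av) (c := c) hA (max_weight_le0 nu (lexx 0))
  (walk_recursion N_gt2 N_even mu nu0 h0) z1.
have Q : ccvg (fun m => (\sum_(k < m.+1) 1 * z ^+ k) *
    cexp (- \sum_(j < m) 1 * z ^+ j.+1 / j.+1%:R)) 1.
  apply: (@newton_series R (fun=> 1) (fun=> 1) 1 _ erefl _ z z1) => [j|k]; first by rewrite nm1.
  by rewrite mulr1 sumr_const card_ord mulr1.
have [K iK hK] := step_bound.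
have E := ccvg_cexp (cintegral_step h0 iK (fun t => hK h t h0)).2.
have geo m : \sum_(k < m.+1) 1 * z ^+ k = (1 - z)^-1 * (1 - z ^+ m.+1).
  have := subrX1 z m.+1; under [in RHS]eq_bigr do rewrite -[z ^+ _]mul1r.
  set G := \sum_(k < m.+1) _ => e.
  have -> : 1 - z ^+ m.+1 = (1 - z) * G by rewrite -[LHS]opprB e -mulNr opprB.
  by rewrite mulKf.
have zX0 : ccvg (fun m => z ^+ m.+1) 0.
  apply: (ccvg_nm (e := fun m => nm z ^+ m)) => [m|].
    by rewrite subr0 nmX; apply: ler_wiXn2l; rewrite ?nm_ge0 ?ltW.
  by apply: cvg_expr; rewrite ger0_norm ?nm_ge0.
have Z : ccvg (fun m => \sum_(k < m.+1) 1 * z ^+ k) (1 - z)^-1.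
  have D := ccvgD (ccvg_cst 1) (ccvgZ (-1) zX0).
  apply: ccvg_ext (ccvgZ (1 - z)^-1 D) _ _ => [m|]; first by rewrite geo mulN1r.
  by rewrite mulr0 addr0 mulr1.
(* The partial sum [X] is rewritten, at each finite [m], as [(G * exp (- S1))^-1 * (X * exp (- SA))
   * (G * exp (SA - S1))]; the first two factors tend to 1 and the last one to the claimed limit. *)
apply: ccvg_ext (ccvgM (ccvgM (ccvgV (oner_neq0 _) Q) P) (ccvgM Z E)) _ _ => [m|]; last first.
  by rewrite invr1 2!mul1r.
pose SA := \sum_(j < m) av j.+1 * z ^+ j.+1 / j.+1%:R.
pose S1 := \sum_(j < m) 1 * z ^+ j.+1 / j.+1%:R.
pose G := \sum_(k < m.+1) 1 * z ^+ k.
have -> : \sum_(j < m) L (j.+1%:R * h) * h%:C = SA - S1.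
  rewrite -sumrB; apply: eq_bigr => j _; rewrite /frullani /posinv mulr_gt0//.
  have -> : 1%:C ^+ N = 1 :> R[i] by rewrite expr1n.
  rewrite mulr1 -zX.
  have e : ((j.+1%:R * h)^-1)%:C * h%:C = j.+1%:R^-1 :> R[i].
    rewrite -RtoCM -RtoCn -RtoCV; congr _%:C; rewrite invfM -mulrA mulVf ?mulr1//.
    exact: lt0r_neq0.
  rewrite -mulrA e mulrBr mulr1 mulrBl mul1r; congr (_ / _ - _).
  by rewrite mulrC.
rewrite cexpD -/SA -/S1 -/G.
set X := \sum_(k < m.+1) _.
have cSA : cexp (- SA) * cexp SA = 1 by rewrite -cexpD addNr cexp0.
have q0 : G * cexp (- S1) != 0.
  apply: mulf_neq0; last exact: cexp_neq0.
  rewrite /G geo; apply: mulf_neq0; first by rewrite invr_eq0.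
  apply/eqP => /eqP; rewrite subr_eq0 => /eqP e.
  have : nm z ^+ m.+1 < 1 by rewrite exprn_ilt1 ?nm_ge0.
  by rewrite -nmX -e nm1 ltxx.
move: cSA q0; move: (cexp (- SA)) (cexp SA) (cexp (- S1)) => eA' eA e1 eAA q0.
have -> : (G * e1)^-1 * (X * eA') * (G * (eA * e1)) =
  (G * e1)^-1 * (G * e1) * X * (eA' * eA) by ring.
by rewrite eAA mulVf// mul1r mulr1.
Qed.

Definition XM_limit (Z : R[i]) : R[i] :=
  lam^-1 * Z * \prod_(l < N) (theta R l * principal_root N lam /
    (theta R l * principal_root N lam + cshift mu nu l)).

Lemma discounted_walk (x : R) (F : seq R -> R[i]) (Z : R[i]) :
  (forall n k, pp_expectation N x k (dyadic R n) F = Z * walk_coef N mu nu n k) ->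
  discounted_expectation N x lam F (XM_limit Z).
Proof.
move=> hF.
pose S n := Z * ((1 - cexp (- lam / 2 ^+ n))^-1 *
  cexp (cintegral leb (step_fun L (2^-1 ^+ n)))).
exists S; split.
  move=> n; have [_ h] := walk_series n.
  rewrite /cseries_to; apply: ccvg_shift.
  apply: ccvg_ext (ccvgZ Z h) _ _ => [m|//].
  rewrite big_mkord mulr_sumr; apply: eq_bigr => k _.
  have -> : cexp (- lam * (dyadic R n k)%:C) = cexp (- lam / 2 ^+ n) ^+ k.
    rewrite -cexpMn; congr cexp; rewrite -[RHS]mulr_natl /dyadic.
    rewrite RtoCM RtoCn RtoCV RtoCX RtoCn.
    by move: (2 ^+ n)^-1 => u; ring.
  by rewrite hF; move: (cexp _ ^+ k) (walk_coef _ _ _ _ _) => u v; ring.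
have lam0 : lam != 0 by apply/eqP => e; move: lam_re; rewrite e ltxx.
apply: ccvg_ext (ccvgZ (lam^-1 * Z) (ccvg_cexp step_cvg)) _ _ => [n|].
  have [z1 _] := walk_series n.
  have zn1 : 1 - cexp (- lam / 2 ^+ n) != 0.
    apply/eqP => /eqP; rewrite subr_eq0 => /eqP e; by move: z1; rewrite -e nm1 ltxx.
  rewrite /S; move: (1 - _) zn1 (cexp _) => d d0 e.
  have -> : d / lam * (Z * (d^-1 * e)) = (d * d^-1) * (lam^-1 * Z * e) by ring.
  by rewrite divff// mul1r.
by rewrite (cexp_cintegral_frullani N_gt2 N_even mu nu0 lam_re).
Qed.

End DiscountedLimit.

(** * The joint density *)

Section PartialFractions.
Context {F : fieldType} (I : finType) (P : pred I) (b : I -> F).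

(* Lagrange interpolation: both sides, times [\prod (b j + u)], are polynomials
   in [u] of degree less than the number of nodes, equal at each [- b j]. *)
Lemma partial_fractions (i0 : I) (u : F) : P i0 -> injective b ->
  (forall j, P j -> b j + u != 0) ->
  \sum_(j | P j) b j * (\prod_(l | P l && (l != j)) (b l / (b l - b j))) / (b j + u) =
  \prod_(j | P j) (b j / (b j + u)).
Proof.
move=> Pi0 b_inj bu.
pose A j := \prod_(l | P l && (l != j)) (b l / (b l - b j)).
pose D j : {poly F} := \prod_(l | P l && (l != j)) ('X - (- b l)%:P).
pose p : {poly F} := \sum_(j | P j) (b j * A j) *: D j - (\prod_(j | P j) b j)%:P.
have De j v : (D j).[v] = \prod_(l | P l && (l != j)) (b l + v).
  by rewrite horner_prod; apply: eq_bigr => l _; rewrite !hornerE addrC opprK.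
have pe v : p.[v] = \sum_(j | P j) b j * A j * \prod_(l | P l && (l != j)) (b l + v)
    - \prod_(j | P j) b j.
  rewrite hornerD hornerN hornerC horner_sum; congr (_ - _).
  by apply: eq_bigr => j _; rewrite hornerZ De.
have card0 : (0 < #|P|)%N by apply/card_gt0P; exists i0.
have sD j : P j -> (size (D j) <= #|P|)%N.
  move=> Pj; rewrite /D -big_filter size_prod_XsubC -cardE.
  rewrite (cardD1 j P) [j \in P]Pj add1n ltnS; apply: eq_leq; apply: eq_card => l.
  by rewrite !inE andbC.
have sp : (size p <= #|P|)%N.
  rewrite (leq_trans (size_polyD _ _))// geq_max size_polyN; apply/andP; split.
    rewrite (leq_trans (size_sum _ _ _))//; apply/bigmax_leqP => j Pj.
    by rewrite (leq_trans (size_scale_leq _ _))// sD.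
  by rewrite size_polyC (leq_trans (leq_b1 _)).
have p0 : p = 0.
  apply: (@roots_geq_poly_eq0 _ p [seq - b j | j <- enum P]).
  - apply/allP => v /mapP[j]; rewrite mem_enum => Pj ->.
    rewrite /root pe (bigD1 j)//= [X in _ + X - _]big1 ?addr0 => [|k /andP[Pk kj]]; last first.
      by rewrite (bigD1 j)/= ?subrr ?mul0r ?mulr0//; rewrite [P j]Pj eq_sym.
    rewrite -mulrA /A -big_split /= [X in _ - X](bigD1 j)//=.
    rewrite subr_eq0; apply/eqP; congr (_ * _); apply: eq_bigr => l /andP[_ lj].
    by rewrite divfK// subr_eq0 (inj_eq b_inj).
  - by rewrite map_inj_uniq ?enum_uniq// => x y /oppr_inj/b_inj.
  - by rewrite size_map -cardE.
have := pe u; rewrite p0 horner0 => /esym/eqP; rewrite subr_eq0 => /eqP e.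
rewrite prodf_div -e mulr_suml; apply: eq_bigr => j Pj.
rewrite [X in _ = _ / X](bigD1 j)//= -/(A j).
have q0 : \prod_(l | P l && (l != j)) (b l + u) != 0.
  by apply/prodf_neq0 => l /andP[Pl _]; exact: bu.
rewrite /=; move: (A j) (\prod_(l | _) (b l + u)) q0 (b j + u) (bu j Pj) => c v v0 w w0.
by field; rewrite w0 v0.
Qed.

End PartialFractions.

(** * The density as a product of two one-sided functions *)

Section JointDensity.
Context {R : realType} (N : nat) (N_gt2 : (2 < N)%N) (N_even : ~~ odd N).
Notation RT := (measurableTypeR R).
Notation leb := (@lebesgue_measure R).
Notation theta := (@theta R N).
Variables (lam : R[i]) (lam_re : 0 < complex.Re lam).

Let N_gt0 : (0 < N)%N := ltn_trans (isT : (0 < 2)%N) N_gt2.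
Let r0 := principal_root N lam.
Let b (j : 'I_N) : R[i] := theta j * r0.
Let r00 : r0 != 0. Proof. exact: principal_root_neq0. Qed.

Let b_re j : inJ R j -> 0 < complex.Re (b j).
Proof. by move=> Jj; have := Re_theta_root N_gt2 N_even lam_re j; rewrite Jj. Qed.

(** By [psiE], the density for the maximum is [lam^-1 * half_phi (z - x) * half_phi (z - y)],
    support conditions included; for the minimum both arguments change sign. *)
Definition half_phi (t : R) : R[i] := if 0 <= t then phi N lam (- t) else 0.

Lemma half_phiE t : half_phi t = \sum_(j < N | inJ R j) b j * Defs.coefA R j *
  (if 0 <= t then cexp (- b j * t%:C) else 0).
Proof.
rewrite /half_phi; case: ifP => _; last by rewrite big1// => j _; rewrite mulr0.
rewrite /phi mulr_sumr; apply: eq_bigr => j _.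
have -> : theta j * principal_root N lam * (- t)%:C = - b j * t%:C.
  by rewrite RtoCN /b -/r0; ring.
by rewrite /b -/r0; move: (cexp _) => e; ring.
Qed.

Lemma half_phi_bound : exists2 B : R, 0 < B & exists2 M : R, 0 <= M &
  forall t, nm (half_phi t) <= M * expR (- B * `|t|).
Proof.
pose B := \big[Num.min/1]_(j < N | inJ R j) complex.Re (b j).
exists B.
  by apply: (big_ind (fun v => 0 < v)) => // x y x0 y0; rewrite lt_min x0 y0.
exists (\sum_(j < N | inJ R j) nm (b j * Defs.coefA R j)).
  by apply: sumr_ge0 => j _; exact: nm_ge0.
move=> t; rewrite half_phiE mulr_suml (le_trans (nm_sum _ _ _))//; apply: ler_sum => j Jj.
rewrite [nm (_ * if _ then _ else _)]nmM; apply: ler_wpM2l; first exact: nm_ge0.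
case: ifP => t0; last by rewrite nm0 expR_ge0.
have re : complex.Re (- b j * t%:C) = - (t * complex.Re (b j)).
  by rewrite mulrC cReZ cReN mulrN.
rewrite nm_cexp re ler_expR ger0_norm// mulNr lerN2 [leLHS]mulrC.
by apply: ler_wpM2l => //; exact: bigmin_le_cond.
Qed.

Lemma cmeas_half_phi : cmeas (half_phi : RT -> R[i]).
Proof.
rewrite (funext half_phiE).
under eq_fun do rewrite big_mkcond; apply: cmeas_sum => j.
case: (boolP (inJ R j)) => Jj; last exact: cmeas_cst.
apply: cmeasM; first exact: cmeas_cst.
exact: (cintegrable_cmeas (cintegral_cexpN_ge0 (b_re Jj)).1).
Qed.

Let shift_re s j : 0 <= complex.Re s -> inJ R j -> 0 < complex.Re (b j + s).
Proof. by move=> s0 Jj; rewrite cReD ltr_pwDl// b_re. Qed.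

(** Termwise integration yields a sum of simple fractions, which [partial_fractions] recombines; the
    common factor [r0] of the nodes [b j] drops out of the coefficients [coefA]. *)
Lemma half_phi_laplace s : 0 <= complex.Re s ->
  cintegrable leb (fun t : RT => half_phi t * cexp (- s * t%:C)) /\
  cintegral leb (fun t : RT => half_phi t * cexp (- s * t%:C)) =
    \prod_(j < N | inJ R j) (b j / (b j + s)).
Proof.
move=> s0.
have sb j (Jj : inJ R j) := cintegral_cexpN_ge0 (shift_re s0 Jj).
have E : (fun t : RT => half_phi t * cexp (- s * t%:C)) = (fun t : RT =>
    \sum_(j < N | inJ R j) b j * Defs.coefA R j *
    (if 0 <= t then cexp (- (b j + s) * t%:C) else 0)).
  apply/funext => t; rewrite half_phiE mulr_suml; apply: eq_bigr => j _.
  rewrite -mulrA; congr (_ * _); case: ifP => _; last by rewrite mul0r.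
  by rewrite -cexpD; congr cexp; ring.
have SI j : inJ R j -> cintegrable leb (fun t : RT => b j * Defs.coefA R j *
    (if 0 <= t then cexp (- (b j + s) * t%:C) else 0)).
  by move=> Jj; apply: cintegrableZ; exact: (sb j Jj).1.
rewrite E; split; first exact: cintegrable_sum.
rewrite cintegral_sum//.
(* Either an index or the index of the opposite root belongs to [J]. *)
have [i0 Ji0] : exists i0 : 'I_N, inJ R i0.
  pose l := Ordinal N_gt0; case: (boolP (inJ R l)) => Jl; first by exists l.
  by exists (ord_opp N_gt2 l); rewrite inJ_opp// inKE.
rewrite -(@partial_fractions _ _ (fun j => inJ R j) b i0)//.
- apply: eq_bigr => j Jj; rewrite cintegralZ ?(sb j Jj).2//; last exact: (sb j Jj).1.
  congr (_ * _ / _); apply: eq_bigr => l _; rewrite /b -mulrBl.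
  by rewrite -mulf_div divff// mulr1.
- by move=> j k /(mulIf r00)/theta_inj; exact.
- move=> j Jj; apply/eqP => e; have := shift_re s0 Jj; by rewrite e ltxx.
Qed.

Lemma cintegral_sign (e a : R) (f : RT -> R[i]) : e = 1 \/ e = -1 -> cintegrable leb f ->
  cintegrable leb (fun t : RT => f (e * (t - a))) /\
  cintegral leb (fun t : RT => f (e * (t - a))) = cintegral leb f.
Proof.
case=> -> fi.
  under eq_fun do rewrite mul1r.
  exact: cintegral_shift.
have [fi1 <-] := cintegral_opp fi; have [fi2 <-] := cintegral_shift (- a) fi1.
by under eq_fun do rewrite mulN1r.
Qed.

Section Joint.
Variables (mu nu : R) (nu0 : 0 < nu) (x e : R) (e1 : e = 1 \/ e = -1).

Let ne1 : - e = 1 \/ - e = -1. Proof. by case: e1 => ->; [right|left; rewrite opprK]. Qed.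

Definition joint_integrand (q : RT * RT) : R[i] :=
  cexp ('i * (mu * (e * q.1))%:C - (nu * (e * q.2))%:C) *
  (lam^-1 * half_phi (e * (q.2 - x)) * half_phi (e * (q.2 - q.1))).

Let ne (t : R) : `|e * t| = `|t|.
Proof. by rewrite normrM; case: e1 => ->; rewrite ?normrN normr1 mul1r. Qed.

Lemma integrable_expR_abs (c a : R) : 0 < c ->
  leb.-integrable setT (EFin \o (fun t : RT => expR (- c * `|t - a|))).
Proof.
move=> c0; have cC : 0 < complex.Re c%:C by [].
have [[i _] _] := cintegral_two_sided cC cC.
have i2 : leb.-integrable setT (EFin \o (fun t : RT => expR (- c * `|t|))).
  move: i; congr (_.-integrable _ _); apply/funext => t; congr EFin.
  case: ltP => t0; rewrite -?RtoCN -RtoCM cexp_real /=.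
    by rewrite gtr0_norm.
  by rewrite ler0_norm// mulrNN.
exact: (integrable_shift (- a) i2).1.
Qed.

Lemma cintegrable_joint : cintegrable (leb \x leb)%E joint_integrand.
Proof.
have [B B0 [M M0 hM]] := half_phi_bound.
(* As [|y - x| <= |z - x| + |z - y|], half of the rate suffices to exchange the decay in [z - x] and
   [z - y] for a product of a function of [y] and one of [z]. *)
pose B2 := B / 2; have B20 : 0 < B2 by rewrite divr_gt0.
pose C := expR (- nu * (e * x)) * (nm lam^-1 * (M * M)).
refine (@cintegrable_prodM R _ _ RT RT leb leb joint_integrand
  (fun z => expR (- B2 * `|z - x|)) (fun y => C * expR (- B2 * `|y - x|)) _ _ _ _).
- rewrite /joint_integrand; apply: cmeasM.
    apply: cmeas_cexp; apply: cmeasD.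
      apply: cmeasM; first exact: cmeas_cst.
      apply: cmeas_real; by apply: measurable_funM => //; apply: measurable_funM.
    under eq_fun do rewrite -RtoCN; apply: cmeas_real.
    apply: (measurableT_comp (@oppr_measurable R _)) => //.
    by apply: measurable_funM => //; apply: measurable_funM.
  apply: cmeasM; first apply: cmeasM; first exact: cmeas_cst.
    refine (@cmeas_comp R _ _ (RT * RT)%type RT half_phi (fun z => e * (z.2 - x) : RT) cmeas_half_phi _).
    by apply: measurable_funM => //; apply: measurable_funB.
  refine (@cmeas_comp R _ _ (RT * RT)%type RT half_phi (fun z => e * (z.2 - z.1) : RT) cmeas_half_phi _).
  apply: measurable_funM => //; apply: measurable_funB; [exact: (@measurable_snd _ _ RT RT)|exact: (@measurable_fst _ _ RT RT)].
- move=> y z; rewrite /joint_integrand /=.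
  have [h|h] := leP 0 (e * (z - x)); last first.
    have -> : half_phi (e * (z - x)) = 0 by rewrite /half_phi leNgt h.
    by rewrite mulr0 mul0r mulr0 nm0 !mulr_ge0 ?expR_ge0 ?nm_ge0.
  rewrite nmM [nm (lam^-1 * _ * _)]nmM [nm (lam^-1 * _)]nmM.
  have -> : C * expR (- B2 * `|y - x|) * expR (- B2 * `|z - x|) =
      expR (- nu * (e * x)) * (nm lam^-1 * (M * M * (expR (- B2 * `|y - x|) * expR (- B2 * `|z - x|)))).
    by rewrite /C; ring.
  apply: ler_pM; rewrite ?mulr_ge0 ?nm_ge0//.
    rewrite nm_cexp Re_iM cReN /= ler_expR mulNr lerN2; apply: ler_wpM2l; first exact: ltW.
    by rewrite -subr_ge0 -mulrBr.
  rewrite -mulrA; apply: ler_wpM2l; first exact: nm_ge0.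
  apply: (@le_trans _ _ (M * expR (- B * `|z - x|) * (M * expR (- B * `|z - y|)))).
    apply: ler_pM; rewrite ?nm_ge0//.
      by rewrite -(ne (z - x)); exact: hM.
    by rewrite -(ne (z - y)); exact: hM.
  have -> : M * expR (- B * `|z - x|) * (M * expR (- B * `|z - y|)) =
    M * M * (expR (- B * `|z - x|) * expR (- B * `|z - y|)) by ring.
  apply: ler_wpM2l; first exact: mulr_ge0.
  rewrite -!expRD ler_expR.
  have t : `|y - x| <= `|z - x| + `|z - y|.
    have -> : y - x = (z - x) - (z - y) by ring.
    exact: ler_normB.
  have -> : B = B2 * 2 by rewrite /B2 divfK.
  rewrite -[leRHS]opprK lerNr opprD !mulNr !opprK opprD !opprK -!mulrA -!mulrDr.
  apply: ler_wpM2l; first exact: ltW.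
  by move: (normr_ge0 (z - y)) t; lra.
- exact: integrable_expR_abs.
- by have := integrableZl measurableT C (integrable_expR_abs x B20).
Qed.

(** Integrating over [y] first gives the transform of [half_phi] at ['i * mu], times a phase in [z];
    the integral over [z] is then its transform at [nu - 'i * mu]. *)
Lemma cintegral_joint : cintegral (leb \x leb)%E joint_integrand =
  XM_limit N mu nu lam (cexp ('i * (mu * (e * x))%:C - (nu * (e * x))%:C)).
Proof.
rewrite (cintegral21 cintegrable_joint).2.
have s1 : 0 <= complex.Re ('i * mu%:C) by rewrite Re_imR.
have s2 : 0 <= complex.Re (nu%:C - 'i * mu%:C) by rewrite cReD cReN Re_imR oppr0 addr0 ltW.
have [i1 l1] := half_phi_laplace s1; have [i2 l2] := half_phi_laplace s2.
have inner z : cintegral leb (fun y : RT => joint_integrand (y, z)) =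
    (cexp ('i * (mu * (e * x))%:C - (nu * (e * x))%:C) * lam^-1 *
      \prod_(j < N | inJ R j) (b j / (b j + 'i * mu%:C))) *
    (half_phi (e * (z - x)) * cexp (- (nu%:C - 'i * mu%:C) * (e * (z - x))%:C)).
  have [j1 k1] := cintegral_sign z ne1 i1; rewrite l1 in k1.
  transitivity (cintegral leb (fun y : RT =>
    (cexp ('i * (mu * (e * z))%:C - (nu * (e * z))%:C) * (lam^-1 * half_phi (e * (z - x)))) *
    (half_phi (- e * (y - z)) * cexp (- ('i * mu%:C) * (- e * (y - z))%:C)))).
    apply: eq_cintegral => y; rewrite /joint_integrand /=.
    have -> : - e * (y - z) = e * (z - y) by ring.
    have -> : cexp ('i * (mu * (e * y))%:C - (nu * (e * z))%:C) =
      cexp ('i * (mu * (e * z))%:C - (nu * (e * z))%:C) *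
      cexp (- ('i * mu%:C) * (e * (z - y))%:C).
      by rewrite -cexpD; congr cexp; rewrite !(RtoCM, RtoCD, RtoCN); ring.
    by move: (cexp _) (cexp _) => u v; ring.
  rewrite cintegralZ// k1.
  have -> : cexp ('i * (mu * (e * z))%:C - (nu * (e * z))%:C) =
     cexp ('i * (mu * (e * x))%:C - (nu * (e * x))%:C) *
     cexp (- (nu%:C - 'i * mu%:C) * (e * (z - x))%:C).
    by rewrite -cexpD; congr cexp; rewrite !(RtoCM, RtoCD, RtoCN); ring.
  by move: (cexp _) (cexp _) (\prod_(j < N | _) _) => u v w; ring.
rewrite (eq_cintegral _ inner).
have [j2 k2] := cintegral_sign x e1 i2.
rewrite cintegralZ// k2 l2 /XM_limit.
suff -> : \prod_(l < N) (theta l * principal_root N lam /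
      (theta l * principal_root N lam + cshift mu nu l)) =
    \prod_(j < N | inJ R j) (b j / (b j + (nu%:C - 'i * mu%:C))) *
    \prod_(j < N | inJ R j) (b j / (b j + 'i * mu%:C)).
  by move: (cexp _) (\prod_(j < N | _) _) (\prod_(j < N | _) _) => u v w; ring.
rewrite (bigID (fun l => inJ R l)) /=; congr (_ * _).
  by apply: eq_bigr => l Jl; rewrite /cshift Jl.
(* Replacing [j] in [J] by the index of the opposite root in [K] turns [b / (b + 'i * mu)] into
   [b / (b - 'i * mu)]. *)
rewrite [RHS](reindex_inj (inv_inj (ord_oppK N_gt2 N_even (R := R))))/=.
apply: eq_big => [l|l Kl]; first by rewrite inJ_opp// inKE.
rewrite /cshift (negbTE Kl) /b theta_opp// -/r0.
by rewrite mulNr -[RHS]mulrNN opprK -invrN opprD opprK.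
Qed.

End Joint.

End JointDensity.

Theorem theorem4p6 (R : realType) (N : nat) (x : R) (lam : R[i])
    (N_gt2 : (2 < N)%N) (N_even : ~~ odd N) (lam_re : 0 < complex.Re lam) :
  is_XM_density N x lam (fun y z : R =>
    if Num.max x y <= z then lam^-1 * phi N lam (x - z) * psi N lam (z - y)
    else 0) /\
  is_Xm_density N x lam (fun y z : R =>
    if z <= Num.min x y then lam^-1 * psi N lam (x - z) * phi N lam (z - y)
    else 0).
Proof.
split; split.
- by move=> y z /negbTE ->.
- move=> mu nu nu0 g.
  have -> : g = joint_integrand N lam mu nu x 1.
    apply/funext => -[y z]; rewrite /g /joint_integrand /= !mul1r; congr (_ * _).
    rewrite /half_phi !subr_ge0 ge_max psiE// !opprB.
    by case: (x <= z); case: (y <= z); rewrite ?mulr0 ?mul0r.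
  split; first exact: (cintegrable_joint N_gt2 N_even lam_re _ nu0 _ (or_introl erefl)).
  rewrite (cintegral_joint N_gt2 N_even lam_re _ nu0 _ (or_introl erefl))// !mul1r.
  apply: discounted_walk => //; first exact: ltW.
  by move=> n k; exact: (pp_expectation_max N_gt2 N_even mu (ltW nu0)).
- by move=> y z /negbTE ->.
- move=> mu nu nu0 g.
  (* The reflected variables are [- y] and [- z], and ['i * mu * y + nu * z] equals
     ['i * (- mu) * (- y) - nu * (- z)]. *)
  have -> : g = joint_integrand N lam (- mu) nu x (-1).
    apply/funext => -[y z]; rewrite /g /joint_integrand /= !mulN1r; congr (cexp _ * _).
      by rewrite mulrNN mulrN RtoCN opprK.
    rewrite /half_phi !opprB !subr_ge0 le_min psiE// opprB.
    by case: (z <= x); case: (z <= y); rewrite ?mulr0 ?mul0r.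
  split; first exact: (cintegrable_joint N_gt2 N_even lam_re _ nu0 _ (or_intror erefl)).
  rewrite (cintegral_joint N_gt2 N_even lam_re _ nu0 _ (or_intror erefl))//.
  apply: discounted_walk => //; first exact: ltW.
  move=> n k; have := pp_expectation_min N_gt2 N_even (- mu) (ltW nu0) x n k.
  by rewrite opprK mulN1r mulrNN mulrN RtoCN opprK.
Qed.
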